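(* Let $\lambda=(\lambda_1,\lambda_2,\lambda_3)\in\mathbb C^3$ with $\lambda_1+\lambda_2+\lambda_3=0$ and with $\mathrm{Re}(\lambda_1-\lambda_2)$, $\mathrm{Re}(\lambda_2-\lambda_3)$ sufficiently large, let $m_1,m_2\in\mathbb Z$, $\psi(n(x,y,z))=e^{2\pi i(m_1x+m_2y)}$, and let $w=(\mathrm t(-1,1,-1),1)\in\widetilde G$. For $f=\begin{pmatrix}f_1\\ f_2\end{pmatrix}\in\widetilde V^\infty_{-\lambda,{}^\intercal\phi^{-1}}$, $$\begin{aligned}&\Big\langle f(\tilde g),\int_{\Gamma_\infty\backslash N}\tilde E_{w_\ell}(n\tilde g)\psi(n)\,dn\Big\rangle_{\lambda,\phi}\\ &=\sum_{A_1>0,\,A_2>0}|4A_1|^{-1-\lambda_1+\lambda_2}|4A_2|^{-1-\lambda_2+\lambda_3}\big(\Sigma(A_1,A_2;-m_1,m_2)+i\,\Sigma(A_1,-A_2;-m_1,m_2)\big)\int_{\mathbb R^3}f_1(n(x,y,z)w)\psi^{-1}(n(x,y,z))\,dx\,dy\,dz\\ &\ +\sum_{A_1>0,\,A_2>0}|4A_1|^{-1-\lambda_1+\lambda_2}|4A_2|^{-1-\lambda_2+\lambda_3}\big(-\Sigma(A_1,A_2;-m_1,-m_2)-i\,\Sigma(A_1,-A_2;-m_1,-m_2)\big)\int_{\mathbb R^3}f_2(n(x,y,z)w)\psi^{-1}(n(x,y,z))\,dx\,dy\,dz,\end{aligned}$$ where the sums are over positive integers $A_1,A_2$.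
   Context: **Groups.** $G=\mathrm{SL}(3,\mathbb R)$; $B$ is its upper triangular subgroup; $N=\{n(x,y,z)\}$ with $n(x,y,z)=\begin{pmatrix}1&x&z\\0&1&y\\0&0&1\end{pmatrix}$; $A$ is the group of diagonal matrices with positive entries; $\mathrm t(a,b,c)=\mathrm{diag}(a,b,c)$. $w_{\alpha_1}=\begin{pmatrix}0&-1&0\\1&0&0\\0&0&1\end{pmatrix}$, $w_{\alpha_2}=\begin{pmatrix}1&0&0\\0&0&-1\\0&1&0\end{pmatrix}$, $w_\ell=w_{\alpha_1}w_{\alpha_2}w_{\alpha_1}=\begin{pmatrix}0&0&1\\0&-1&0\\1&0&0\end{pmatrix}$. For nonzero reals $(x,y)_{\mathbb R}=-1$ if $x,y<0$ and $1$ otherwise. $(\frac{\cdot}{\cdot})$ is the Kronecker symbol. The Plücker coordinates of a matrix with second row $(d,e,f)$ and third row $(g,h,i)$ are $(A_1',B_1',C_1',A_2',B_2',C_2')=(-g,-h,-i,-(dh-eg),di-fg,-(ei-fh))$. **Double cover.** Let $X_1(g)=\det g$, let $X_2(g)$ be the first nonzero entry of $-A_2',B_2',-C_2'$, let $X_3(g)$ be the first nonzero entry of $-A_1',-B_1',-C_1'$, and $\Delta(g)=\mathrm t(X_1/X_2,X_2/X_3,X_3)$. The Banks–Levy–Sepanski cocycle $\sigma:G\times G\to\{\pm1\}$ is computed by: $\sigma(\mathrm t(a_1,a_2,a_3),\mathrm t(b_1,b_2,b_3))=(a_1,b_2)_{\mathbb R}(a_1,b_3)_{\mathbb R}(a_2,b_3)_{\mathbb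 R}$ (for diagonal matrices of any determinant); $\sigma(a,h)=\sigma(a,\Delta(h))$ for $a$ diagonal; $\sigma(w_\alpha,h)=\sigma(\Delta(w_\alpha h)\Delta(h),-\Delta(h))$ for $w_\alpha\in\{w_{\alpha_1},w_{\alpha_2}\}$; and if $g_1=naw_1\cdots w_kn'$ is the Bruhat decomposition ($n,n'\in N$, $a$ diagonal, $w_1\cdots w_k$ a reduced word in $w_{\alpha_1},w_{\alpha_2}$) then $\sigma(g_1,g_2)=\sigma(a,w_1\cdots w_kn'g_2)\sigma(w_1,w_2\cdots w_kn'g_2)\cdots\sigma(w_k,n'g_2)$. $\widetilde G=G\times\{\pm1\}$ with $(g_1,\epsilon_1)(g_2,\epsilon_2)=(g_1g_2,\epsilon_1\epsilon_2\sigma(g_1,g_2))$. $N$ and $A$ are regarded as subgroups $\widetilde N,\widetilde A$ of $\widetilde G$ via $g\mapsto(g,1)$. $\widetilde N_-=(w_\ell,1)^{-1}\widetilde N(w_\ell,1)$; $\widetilde M=\{(\mathrm t(\epsilon_1,\epsilon_2,\epsilon_1\epsilon_2),\pm1):\epsilon_i=\pm1\}$. **Principal series.** $\phi:\widetilde M\to \mathrm{SL}(2,\mathbb C)$ is the representation $\phi((\mathrm t(\epsilon_1,\epsilon_2,\epsilon_1\epsilon_2),\pm1))=\pm\begin{pmatrix}0&-1\\1&0\end{pmatrix}^{(1-\epsilon_1)/2}\begin{pmatrix}-i&0\\0&i\end{pmatrix}^{(1-\epsilon_2)/2}$. $\rho=(1,0,-1)$. For $\mu\in\mathbb C^3$ with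 coordinate sum $0$ and a two-dimensional representation $\eta$ of $\widetilde M$, $\widetilde V^{\infty}_{\mu,\eta}$ (resp. $\widetilde V^{-\infty}_{\mu,\eta}$) is the space of smooth (resp. distributional) $f:\widetilde G\to\mathbb C^2$ with $f(\tilde g\tilde m an_-)=\prod_i a_i^{-(\mu_i-\rho_i)}\,\eta(\tilde m^{-1})f(\tilde g)$ for $\tilde m\in\widetilde M$, $a=\mathrm t(a_1,a_2,a_3)\in\widetilde A$, $n_-\in\widetilde N_-$; $\widetilde G$ acts by $(\pi(h)f)(g)=f(h^{-1}g)$. The $\widetilde G$-invariant pairing $\widetilde V^\infty_{-\lambda,{}^\intercal\phi^{-1}}\times\widetilde V^{-\infty}_{\lambda,\phi}\to\mathbb C$ is the extension to distributions of $\langle f,h\rangle_{\lambda,\phi}=\int_{N}(f_1h_1+f_2h_2)((w',1)n)\,dn$ ($w'$ any Weyl representative, $dn=dx\,dy\,dz$). $\tilde\tau\in\widetilde V^{-\infty}_{\lambda,\phi}$ is the element whose restriction to $(w_\ell,1)n(x,y,z)$ is $\begin{pmatrix}\delta_{(0,0,0)}(x,y,z)\\0\end{pmatrix}$, i.e. $\langle f,\tilde\tau\rangle_{\lambda,\phi}=f_1((w_\ell,1))$; it is left $\widetilde N$-invariant. **Arithmetic group and splitting.** $\Gamma=\Gamma_1(4)$ is the group of $\gamma\in\mathrm{SL}(3,\mathbb Z)$ congruent mod $4$ to an upper triangular unipotent matrix; $\Gamma_\infty=N\cap\mathrm{SL}(3,\mathbb Z)$. Elements of $\Gamma$ have Plücker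 coordinates of the form $(4A_1,4B_1,C_1,4A_2,4B_2,C_2)$ with integers $A_i,B_i,C_i$; $\gamma\in Nw_\ell B$ iff $A_1,A_2\neq0$. Miller's splitting is a homomorphism $S:\Gamma\to\widetilde G$, $S(\gamma)=(\gamma,s(\gamma))$, $s(\gamma)\in\{\pm1\}$. On $\Gamma\cap Nw_\ell B$: if $A_1>0$ and $A_2/D$ is odd, with $D=\gcd(A_1,A_2)$, $D_1=\gcd(D,B_1)$, $D_2=D/D_1$, $\epsilon=(\frac{-1}{B_1/D_1})$, then $$s(\gamma)=\Big(\tfrac{\epsilon}{-A_1A_2}\Big)\Big(\tfrac{A_1/D}{A_2/D}\Big)\Big(\tfrac{B_1/D_1}{A_1/D}\Big)\Big(\tfrac{4B_2/D_2}{|A_2|/D}\Big)\Big(\tfrac{D_1}{C_1}\Big)\Big(\tfrac{D_2}{C_2}\Big),$$ and the remaining cases follow from $s(\mathrm t(1,1,-1)\gamma\,\mathrm t(1,1,-1))=s(\gamma)$ and $s(w_\ell{}^\intercal\gamma^{-1}w_\ell^{-1})=(-A_1,-A_2)_{\mathbb R}\,s(\gamma)$. Moreover $s$ is left and right $\Gamma_\infty$-invariant. **Exponential sums.** For nonzero integers $A_1,A_2$ let $\mathbb S(A_1,A_2)$ be the set of $\gamma\in\Gamma$ with Plücker coordinates $(4A_1,*,*,4A_2,*,* )$, and for integers $m_1,m_2$ let $\Sigma(A_1,A_2;m_1,m_2)=\sum_{\gamma\in\Gamma_\infty\backslash\mathbb S(A_1,A_2)/\Gamma_\infty}s(\gamma)e^{2\pi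 i(m_1\frac{B_1}{A_1}+m_2\frac{B_2}{A_2})}$. **Eisenstein distribution.** $\tilde E_{w_\ell}(\tilde g)=\sum_{\gamma\in\Gamma_\infty\backslash(\Gamma\cap Nw_\ell B)}\pi(S(\gamma)^{-1})\tilde\tau(\tilde g)\in\widetilde V^{-\infty}_{\lambda,\phi}$ (the big-cell part of the Eisenstein distribution $\sum_{\gamma\in\Gamma_\infty\backslash\Gamma}\pi(S(\gamma)^{-1})\tilde\tau$), convergent when $\mathrm{Re}(\lambda_1-\lambda_2)$ and $\mathrm{Re}(\lambda_2-\lambda_3)$ are sufficiently large. The measure on $\Gamma_\infty\backslash N$ is induced by $dx\,dy\,dz$, and $\tilde E_{w_\ell}(n\tilde g)$ means $\pi(n^{-1})\tilde E_{w_\ell}$. *)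

(* Defs.v *)
From HB Require Import structures.
From mathcomp Require Import all_boot all_order all_algebra.
From mathcomp Require Import all_classical all_reals all_analysis.
From mathcomp Require Import complex.

Set Implicit Arguments.
Unset Strict Implicit.
Unset Printing Implicit Defensive.

Import Order.TTheory GRing.Theory Num.Theory.
Import numFieldNormedType.Exports.
Local Open Scope classical_set_scope.
Local Open Scope ring_scope.

(* MathComp-Analysis, over an arbitrary R : realType, with R[i] for the complex
   numbers. A sign is a bool b, standing for (-1) ^+ b; products of signs are
   (+). *)

(** * Matrices *)

Definition i0 : 'I_3 := @Ordinal 3 0 isT.
Definition i1 : 'I_3 := @Ordinal 3 1 isT.
Definition i2 : 'I_3 := @Ordinal 3 2 isT.

Section Matrices.
Variable T : comNzRingType.

Definition mat3 (a b c d e f g h i : T) : 'M[T]_3 :=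
  \matrix_(r < 3, k < 3)
    nth 0 (nth [::] [:: [:: a; b; c]; [:: d; e; f]; [:: g; h; i]] r) k.

Definition nmx (x y z : T) : 'M[T]_3 := mat3 1 x z 0 1 y 0 0 1.
Definition tmx (a b c : T) : 'M[T]_3 := mat3 a 0 0 0 b 0 0 0 c.
Definition w_alpha1 : 'M[T]_3 := mat3 0 (-1) 0 1 0 0 0 0 1.
Definition w_alpha2 : 'M[T]_3 := mat3 1 0 0 0 0 (-1) 0 1 0.
Definition w_long : 'M[T]_3 := w_alpha1 *m w_alpha2 *m w_alpha1.

Definition unip : set 'M[T]_3 :=
  [set g | exists x y z, g = nmx x y z].
Definition borel : set 'M[T]_3 :=
  [set g | \det g = 1 /\ forall i j : 'I_3, (j < i)%N -> g i j = 0].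

(* Pluecker coordinates A1', B1', C1', A2', B2', C2' *)
Definition pA1 (m : 'M[T]_3) : T := - m i2 i0.
Definition pB1 (m : 'M[T]_3) : T := - m i2 i1.
Definition pC1 (m : 'M[T]_3) : T := - m i2 i2.
Definition pA2 (m : 'M[T]_3) : T := - (m i1 i0 * m i2 i1 - m i1 i1 * m i2 i0).
Definition pB2 (m : 'M[T]_3) : T := m i1 i0 * m i2 i2 - m i1 i2 * m i2 i0.
Definition pC2 (m : 'M[T]_3) : T := - (m i1 i1 * m i2 i2 - m i1 i2 * m i2 i1).

End Matrices.

Arguments w_alpha1 {T}.
Arguments w_alpha2 {T}.
Arguments w_long {T}.

(** * The Kronecker symbol *)

Definition kronecker_prime (a : int) (p : nat) : int :=
  if p == 2%N then
    if (2 %| a)%Z then 0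
    else if ((a %% 8)%Z == 1) || ((a %% 8)%Z == 7) then 1 else -1
  else
    if (p%:Z %| a)%Z then 0
    else if [exists x : 'I_p, (p%:Z %| (val x)%:Z ^+ 2 - a)%Z] then 1 else -1.

Definition kronecker (a n : int) : int :=
  if n == 0 then (if (absz a == 1)%N then 1 else 0)
  else (if (a < 0) && (n < 0) then -1 else 1) *
       \prod_(p <- primes (absz n)) kronecker_prime a p ^+ logn p (absz n).

(** * The double cover of SL(3,R) *)

Section Cover.
Variable R : realType.

Definition hilbert (x y : R) : bool := (x < 0) && (y < 0).

Definition first_nz (a b c : R) : R :=
  if a != 0 then a else if b != 0 then b else c.

Definition X1 (g : 'M[R]_3) : R := \det g.
Definition X2 (g : 'M[R]_3) : R := first_nz (- pA2 g) (pB2 g) (- pC2 g).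
Definition X3 (g : 'M[R]_3) : R := first_nz (- pA1 g) (- pB1 g) (- pC1 g).
Definition Delta (g : 'M[R]_3) : 'M[R]_3 :=
  tmx (X1 g / X2 g) (X2 g / X3 g) (X3 g).

Definition sigma_diag (a b : 'M[R]_3) : bool :=
  hilbert (a i0 i0) (b i1 i1) (+) hilbert (a i0 i0) (b i2 i2)
  (+) hilbert (a i1 i1) (b i2 i2).

Definition sigma_simple (w h : 'M[R]_3) : bool :=
  sigma_diag (Delta (w *m h) *m Delta h) (- Delta h).

Definition wprod (ws : seq 'M[R]_3) : 'M[R]_3 := foldr mulmx 1%:M ws.

(* sigma(w_1, w_2 ... w_k h) sigma(w_2, w_3 ... w_k h) ... sigma(w_k, h) *)
Fixpoint sigma_word (ws : seq 'M[R]_3) (h : 'M[R]_3) : bool :=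
  if ws is w :: ws' then sigma_simple w (wprod ws' *m h) (+) sigma_word ws' h
  else false.

(* One reduced word for each of the six Weyl elements; the long element has a
   second one, w_alpha2 w_alpha1 w_alpha2, which gives the same sigma. *)
Definition reduced_words : seq (seq 'M[R]_3) :=
  [:: [::]; [:: w_alpha1]; [:: w_alpha2]; [:: w_alpha1; w_alpha2];
      [:: w_alpha2; w_alpha1]; [:: w_alpha1; w_alpha2; w_alpha1]].

Definition bruhat (g : 'M[R]_3) :
    set ('M[R]_3 * 'M[R]_3 * seq 'M[R]_3 * 'M[R]_3) :=
  [set d | let: (n, a, ws, n') := d in
     [/\ unip n, is_diag_mx a, ws \in reduced_words, unip n' &
         g = n *m a *m wprod ws *m n']].

(* Neither the choice of n nor that of n' affects the value. *)
Definition sigma (g1 g2 : 'M[R]_3) : bool :=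
  let: (_, a, ws, n') := xget (1%:M, 1%:M, [::], 1%:M) (bruhat g1) in
  sigma_diag a (Delta (wprod ws *m (n' *m g2)))
  (+) sigma_word ws (n' *m g2).

(* The cover is the subset tG of the ambient type Gt; functions on the cover are
   functions on Gt of which only the values on tG matter. *)
Definition Gt : Type := ('M[R]_3 * bool)%type.
Definition tG : set Gt := [set g | \det g.1 = 1].

Definition tmul (g h : Gt) : Gt := (g.1 *m h.1, g.2 (+) h.2 (+) sigma g.1 h.1).
Definition tinv (g : Gt) : Gt :=
  (invmx g.1, g.2 (+) sigma g.1 (invmx g.1)).
Definition lift (g : 'M[R]_3) : Gt := (g, false).

Definition tN : set Gt := [set lift n | n in @unip R].
Definition tA : set Gt :=
  [set g | exists a1 a2 a3 : R, [/\ 0 < a1, 0 < a2, 0 < a3, a1 * a2 * a3 = 1 &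
     g = lift (tmx a1 a2 a3)]].
Definition conj_wl (n : Gt) : Gt :=
  tmul (tmul (tinv (lift w_long)) n) (lift w_long).
Definition tNminus : set Gt := [set conj_wl n | n in tN].
Definition tM : set Gt :=
  [set g | exists e1 e2 b : bool,
     g = (tmx ((-1) ^+ e1) ((-1) ^+ e2) ((-1) ^+ e1 * (-1) ^+ e2), b)].

(** * Complex-valued analysis *)

Definition cexp (z : R[i]) : R[i] :=
  (expR (complex.Re z) * cos (complex.Im z) +i* (expR (complex.Re z) * sin (complex.Im z)))%C.
(* a ^ z, for a > 0 *)
Definition cpow (a : R) (z : R[i]) : R[i] := cexp ((ln a)%:C%C * z).
(* exp(2 pi i x) *)
Definition e2pi (x : R) : R[i] :=
  (cos (2 * pi * x) +i* sin (2 * pi * x))%C.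

Definition csummable (I : choiceType) (D : set I) (F : I -> R[i]) : Prop :=
  summable D (fun k => (complex.Re `|F k|)%:E).
Definition rsum (I : choiceType) (D : set I) (F : I -> R) : R :=
  fine (\esum_(k in D) ((EFin \o F)^\+)%E k) -
  fine (\esum_(k in D) ((EFin \o F)^\-)%E k).
(* the unordered sum of F over D, when csummable D F *)
Definition csum (I : choiceType) (D : set I) (F : I -> R[i]) : R[i] :=
  (rsum D (@complex.Re R \o F) +i* rsum D (@complex.Im R \o F))%C.

Definition leb3 := ((@lebesgue_measure R \x @lebesgue_measure R)
                    \x @lebesgue_measure R)%E.

Definition cintegrable (D : set (R * R * R)) (F : R * R * R -> R[i]) : Prop :=
  leb3.-integrable D (EFin \o (@complex.Re R \o F)) /\
  leb3.-integrable D (EFin \o (@complex.Im R \o F)).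
Definition cint (D : set (R * R * R)) (F : R * R * R -> R[i]) : R[i] :=
  (Rintegral leb3 D (@complex.Re R \o F) +i*
   Rintegral leb3 D (@complex.Im R \o F))%C.

Definition n3 (p : R * R * R) : 'M[R]_3 := nmx p.1.1 p.1.2 p.2.

(** * Smooth sections of the principal series *)

Definition section : Type := Gt -> 'cV[R[i]]_2.

(* The topology of the cover is not the product topology of Gt. The lifts of N,
   A and N_- are continuous and n a n_- is a local diffeomorphism, so the
   following maps R^8 -> tG, for g in tG, cover tG by open charts of its Lie
   group structure. *)
Definition chart (g : Gt) (v : 'rV[R]_8) : Gt :=
  let x (k : nat) := v 0 (inord k) in
  tmul (tmul (tmul g (lift (nmx (x 0%N) (x 1%N) (x 2%N))))
             (lift (tmx (expR (x 3%N)) (expR (x 4%N))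
                        (expR (- x 3%N - x 4%N)))))
       (conj_wl (lift (nmx (x 5%N) (x 6%N) (x 7%N)))).

Definition pderiv (m : nat) (al : seq 'I_m) (F : 'rV[R]_m -> R) :
    'rV[R]_m -> R :=
  foldr (fun k G => (fun v => 'D_(delta_mx 0 k) G v)) F al.

Definition smooth (m : nat) (F : 'rV[R]_m -> R) : Prop :=
  forall al : seq 'I_m,
    continuous (pderiv al F) /\
    forall (k : 'I_m) (v : 'rV[R]_m), derivable (pderiv al F) v (delta_mx 0 k).

Definition re_chart (f : section) (g : Gt) (j : 'I_2) (v : 'rV[R]_8) : R :=
  complex.Re (f (chart g v) j 0).
Definition im_chart (f : section) (g : Gt) (j : 'I_2) (v : 'rV[R]_8) : R :=
  complex.Im (f (chart g v) j 0).

Definition smooth_section (f : section) : Prop :=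
  forall (g : Gt) (j : 'I_2), tG g ->
    smooth (re_chart f g j) /\ smooth (im_chart f g j).

(* (1 - e_k) / 2 is 1 when the k-th diagonal entry is negative, 0 otherwise *)
Definition phi (m : Gt) : 'M[R[i]]_2 :=
  let J : 'M[R[i]]_2 := \matrix_(r < 2, c < 2)
    nth 0 (nth [::] [:: [:: 0; -1]; [:: 1; 0]] r) c in
  let K : 'M[R[i]]_2 := \matrix_(r < 2, c < 2)
    nth 0 (nth [::] [:: [:: - 'i%C; 0]; [:: 0; 'i%C]] r) c in
  (-1) ^+ m.2 *: (J ^+ (m.1 i0 i0 < 0)%R *m K ^+ (m.1 i1 i1 < 0)%R).

Definition contragredient (eta : Gt -> 'M[R[i]]_2) (m : Gt) : 'M[R[i]]_2 :=
  (invmx (eta m))^T.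

Definition rho : 'rV[R[i]]_3 := \row_(k < 3) nth 0 [:: 1; 0; -1] k.

Definition equivariant (mu : 'rV[R[i]]_3) (eta : Gt -> 'M[R[i]]_2)
    (f : section) : Prop :=
  forall g m a nm : Gt, tG g -> tM m -> tA a -> tNminus nm ->
    f (tmul (tmul (tmul g m) a) nm) =
    (\prod_(k < 3) cpow (a.1 k k) (- (mu 0 k - rho 0 k))) *:
      (eta (tinv m) *m f g).

Definition Vsmooth (mu : 'rV[R[i]]_3) (eta : Gt -> 'M[R[i]]_2) : set section :=
  [set f | smooth_section f /\ equivariant mu eta f].

(** * Distribution vectors *)

(* V^{-oo}_{lam,phi} is realised, through the invariant pairing, as the
   continuous dual of V^oo_{-lam, transpose of phi^-1}, the latter with the
   topology of uniform convergence on compact sets of all derivatives. A smooth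
   h in V^oo_{lam,phi} is the functional
   f |-> \int_N (f_1 h_1 + f_2 h_2)((w',1) n) dn. *)
Definition functional : Type := section -> R[i].

Definition pairing (f : section) (T : functional) : R[i] := T f.

Definition seminorm_le (gs : seq Gt) (k : nat) (r : R) (f : section) (M : R) :=
  forall (g : Gt) (al : seq 'I_8) (j : 'I_2) (v : 'rV[R]_8),
    g \in gs -> (size al <= k)%N -> (forall l, `|v 0 l| <= r) ->
    `|pderiv al (re_chart f g j) v| <= M /\
    `|pderiv al (im_chart f g j) v| <= M.

Definition Vdist (lam : 'rV[R[i]]_3) : set functional :=
  [set T |
    let V := Vsmooth (- lam) (contragredient phi) in
    (forall (c : R[i]) (f h : section), V f -> V h ->
       T (fun g => c *: f g + h g) = c * T f + T h) /\
    exists (gs : seq Gt) (k : nat) (r C : R),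
      (forall g, g \in gs -> tG g) /\
      forall (f : section) (M : R), V f -> seminorm_le gs k r f M ->
        complex.Re `|T f| <= C * M].

Definition act (h : Gt) (f : section) : section := fun g => f (tmul (tinv h) g).
(* <f, pi(h) T> = <pi(h^-1) f, T> *)
Definition act_dist (h : Gt) (T : functional) : functional :=
  fun f => pairing (act (tinv h) f) T.

Definition tau : functional := fun f => f (lift w_long) 0 0.

(** * The arithmetic group and Miller's splitting *)

Definition Gamma : set 'M[int]_3 :=
  [set g | [/\ \det g = 1,
     forall k : 'I_3, (4 %| g k k - 1)%Z &
     forall k l : 'I_3, (l < k)%N -> (4 %| g k l)%Z]].
Definition Gamma_oo : set 'M[int]_3 := @unip int.

Definition toR (g : 'M[int]_3) : 'M[R]_3 := map_mx intr g.

Definition big_cell : set 'M[int]_3 :=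
  [set g | Gamma g /\ exists n b : 'M[R]_3,
     [/\ unip n, borel b & toR g = n *m w_long *m b]].

(* A1, B1, A2, B2 of g in Gamma; the divisions are exact *)
Definition A1 (g : 'M[int]_3) : int := (pA1 g %/ 4)%Z.
Definition B1 (g : 'M[int]_3) : int := (pB1 g %/ 4)%Z.
Definition C1 (g : 'M[int]_3) : int := pC1 g.
Definition A2 (g : 'M[int]_3) : int := (pA2 g %/ 4)%Z.
Definition B2 (g : 'M[int]_3) : int := (pB2 g %/ 4)%Z.
Definition C2 (g : 'M[int]_3) : int := pC2 g.

Definition miller_formula (g : 'M[int]_3) : int :=
  let D := gcdz (A1 g) (A2 g) in
  let D1 := gcdz D (B1 g) in
  let D2 := (D %/ D1)%Z in
  let eps := kronecker (-1) (B1 g %/ D1)%Z in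
  kronecker eps (- (A1 g * A2 g)) *
  kronecker (A1 g %/ D)%Z (A2 g %/ D)%Z *
  kronecker (B1 g %/ D1)%Z (A1 g %/ D)%Z *
  kronecker (4 * B2 g %/ D2)%Z (`|A2 g| %/ D)%Z *
  kronecker D1 (C1 g) *
  kronecker D2 (C2 g).

Definition splitting (s : 'M[int]_3 -> bool) (g : 'M[int]_3) : Gt :=
  (toR g, s g).

Record miller_splitting (s : 'M[int]_3 -> bool) : Prop := MillerSplitting {
  miller_hom : forall g h, Gamma g -> Gamma h ->
    splitting s (g *m h) = tmul (splitting s g) (splitting s h);
  miller_big_cell : forall g, big_cell g -> 0 < A1 g ->
    ~~ (2 %| A2 g %/ gcdz (A1 g) (A2 g))%Z%Z ->
    (-1) ^+ s g = miller_formula g;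
  miller_conj : forall g, big_cell g ->
    s (tmx 1 1 (-1) *m g *m tmx 1 1 (-1)) = s g;
  miller_dual : forall g, big_cell g ->
    s (w_long *m (invmx g)^T *m invmx w_long) =
    hilbert (- (A1 g)%:~R) (- (A2 g)%:~R) (+) s g;
  miller_left : forall d g, Gamma_oo d -> Gamma g -> s (d *m g) = s g;
  miller_right : forall d g, Gamma_oo d -> Gamma g -> s (g *m d) = s g }.

(* H \ X and H \ X / H, as sets of cosets, and a representative of a coset *)
Definition left_quotient (H X : set 'M[int]_3) : set (set 'M[int]_3) :=
  [set [set h *m g | h in H] | g in X].
Definition double_quotient (H X : set 'M[int]_3) : set (set 'M[int]_3) :=
  [set [set h *m g *m k | h in H & k in H] | g in X].
Definition coset_repr (C : set 'M[int]_3) : 'M[int]_3 := xget 0 C.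

Definition Sset (a1 a2 : int) : set 'M[int]_3 :=
  [set g | [/\ Gamma g, pA1 g = 4 * a1 & pA2 g = 4 * a2]].

(* There are finitely many double cosets, so the finitely supported sum is the
   actual sum. *)
Definition Sigma (s : 'M[int]_3 -> bool) (a1 a2 m1 m2 : int) : R[i] :=
  \sum_(C \in double_quotient Gamma_oo (Sset a1 a2))
    (-1) ^+ s (coset_repr C) *
    e2pi (m1%:~R * ((B1 (coset_repr C))%:~R / a1%:~R) +
          m2%:~R * ((B2 (coset_repr C))%:~R / a2%:~R)).

(** * The Eisenstein distribution and its Fourier coefficients *)

Definition eisenstein_term (s : 'M[int]_3 -> bool) (C : set 'M[int]_3) :
    functional :=
  act_dist (tinv (splitting s (coset_repr C))) tau.

Definition eisenstein (s : 'M[int]_3 -> bool) : functional :=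
  fun f => csum (left_quotient Gamma_oo big_cell)
                (fun C => pairing f (eisenstein_term s C)).

(* the character psi of N, evaluated on n(x,y,z) *)
Definition psi (m1 m2 : int) (n : 'M[R]_3) : R[i] :=
  e2pi (m1%:~R * n i0 i1 + m2%:~R * n i1 i2).

(* coordinates (x,y,z) of a fundamental domain of Gamma_oo \ N *)
Definition unit_cube : set (R * R * R) :=
  (`[0, 1[ `*` `[0, 1[) `*` `[0, 1[.

(* g |-> T(n g) psi(n), with T(n g) = pi(n^-1) T *)
Definition twisted_translate (m1 m2 : int) (T : functional) (n : 'M[R]_3) :
    functional :=
  fun f => psi m1 m2 n * pairing f (act_dist (tinv (lift n)) T).

(* the weak integral of the above over Gamma_oo \ N *)
Definition fourier_coefficient (m1 m2 : int) (T : functional) : functional :=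
  fun f => cint unit_cube (fun p => pairing f (twisted_translate m1 m2 T (n3 p))).

Definition w_end : Gt := lift (tmx (-1) 1 (-1)).

(* the integrand f_(k+1)(n(x,y,z) w) psi^-1(n(x,y,z)) *)
Definition jacquet_integrand (m1 m2 : int) (f : section) (k : 'I_2)
    (p : R * R * R) : R[i] :=
  f (tmul (lift (n3 p)) w_end) k 0 * (psi m1 m2 (n3 p))^-1.

Definition positive_pairs : set (int * int) :=
  [set a : int * int | 0 < a.1 /\ 0 < a.2].

End Cover.

Arguments unit_cube : clear implicits.

(* Main.v *)
(* For g = n w_long b in the big cell, the term of g in the Eisenstein distribution, evaluated at
   pi(n(p)) f, is s(g) times a monomial in |4 A_1|, |4 A_2| times f at n(p)^-1 n(X, Y, Z), where
   (X, Y, Z) is rational in the Pluecker coordinates of g; the signs of A_1, A_2 only select the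
   component of f and a factor 1 or i. Right translation of g by Gamma_oo translates p by the
   lattice, so that grouping the cosets by double cosets unfolds the integral over the unit cube
   to R^3, and the measure preserving change of variables p |-> n(p)^-1 n(X, Y, Z) turns it into
   a Jacquet integral times the exponential of Sigma. The four sign patterns of (A_1, A_2) are
   then brought to A_1 > 0 by conjugation with t(1, 1, -1).

   All exchanges of sums and integrals rest on one decay estimate: pivoting on maximal minors
   writes n(x, y, z) = P n' a n_- with P among six Weyl elements, n' in a fixed box and a
   controlled by x, y, z, whence |f(n(x, y, z))| is at most a constant times
   ((1 + x^2)(1 + y^2)(1 + z^2))^-1. A coset is determined by five of its Pluecker coordinates,
   so this also dominates the Eisenstein series. *)

(* The cocycle is not handled through a cocycle identity. [sigma] evaluates its formula at a Bruhat
   decomposition picked by a choice operator, so its values are first shown to be well determined on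
   the two cells that occur, the Borel subgroup and the big cell. The signs that survive there
   depend only on the signs of diagonal entries. In the decay estimate the sign stays unknown,
   because only absolute values matter.

   The threshold 5 makes an inverse sixth power available in the second variable of the weight, and
   it is spent twice. On N it pays for two factors in y and one in z; the second factor in y is
   needed because translation by p shears the third coordinate by a multiple of Y. In the series it
   pays |A_2|^4 for replacing the two quotients over A_2 by their numerators, and leaves |A_2|^-2
   for the sum over A_2.

   Conjugation by t(1, 1, -1) keeps B_1/A_1 and negates B_2/A_2, which is why m_2 alone changes sign
   in the second sum. *)
From HB Require Import structures.
Require Import Defs.
From mathcomp Require Import all_boot all_order all_algebra.
From mathcomp Require Import all_classical all_reals all_analysis.
From mathcomp Require Import measurable_realfun complex.
From mathcomp Require Import ring lra.
Import Order.TTheory GRing.Theory Num.Theory.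
Import numFieldNormedType.Exports.
Local Open Scope classical_set_scope.
Local Open Scope ring_scope.
Set Implicit Arguments.
Unset Strict Implicit.
Unset Printing Implicit Defensive.
Local Notation lift := Defs.lift.

(** * Unordered sums *)

Section RealSums.
Context {R : realType}.
Implicit Types (I J : choiceType).

Definition rsummable I (D : set I) (f : I -> R) := summable D (EFin \o f).

Lemma esumZl I (D : set I) (a : I -> \bar R) (c : R) : 0 <= c ->
  (forall i, (0 <= a i)%E) ->
  \esum_(i in D) (c%:E * a i)%E = (c%:E * \esum_(i in D) a i)%E.
Proof.
move=> c0 a0; rewrite /esum -ereal_supZl//; last first.
  by apply/set0P; exists 0%E; exists set0; [exact: fsets_set0|rewrite fsbig_set0].
congr ereal_sup; apply/seteqP; split => [_ [X DX <-]|_ [_ [X DX <-] <-]].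
  exists (\sum_(i \in X) a i)%E; first by exists X.
  by rewrite ge0_mule_fsumr.
by exists X => //; rewrite ge0_mule_fsumr.
Qed.

Lemma eq_rsummable I (D : set I) (f g : I -> R) :
  {in D, f =1 g} -> rsummable D f -> rsummable D g.
Proof.
move=> fg; rewrite /rsummable /summable.
by under eq_esum do [rewrite /= fg//; last exact/mem_set].
Qed.

Lemma eq_rsum I (D : set I) (f g : I -> R) : {in D, f =1 g} ->
  rsum D f = rsum D g.
Proof.
move=> fg; rewrite /rsum; congr (fine _ - fine _); apply: eq_esum => i Di;
  by rewrite ?funeposE ?funenegE /= fg//; exact/mem_set.
Qed.

Lemma rsummable_le I (D : set I) (f g : I -> R) :
  (forall i, D i -> `|f i| <= g i) -> rsummable D g -> rsummable D f.
Proof.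
move=> fg; apply: le_lt_trans; apply: le_esum => i Di /=.
by rewrite lee_fin (le_trans (fg _ Di))// ler_norm.
Qed.

Lemma rsummable_norm I (D : set I) (f : I -> R) :
  rsummable D f -> rsummable D (fun i => `|f i|).
Proof.
rewrite /rsummable /summable.
by under [X in _ -> (X < _)%E]eq_esum do rewrite /= normr_id.
Qed.

Lemma rsummable_ge0 I (D : set I) (f : I -> R) :
  (forall i, D i -> 0 <= f i) ->
  rsummable D f <-> (\esum_(i in D) (f i)%:E < +oo)%E.
Proof.
move=> f0; rewrite /rsummable /summable.
by under eq_esum do rewrite /= ger0_norm ?f0//.
Qed.

Lemma rsummable_posneg I (D : set I) (f : I -> R) : rsummable D f ->
  (\esum_(i in D) (Num.max (f i) 0)%:E < +oo)%E /\
  (\esum_(i in D) (Num.max (- f i) 0)%:E < +oo)%E.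
Proof.
move=> sf; split; (apply: le_lt_trans sf; apply: le_esum => i Di;
  rewrite lee_fin ge_max normr_ge0 andbT); first exact: ler_norm.
by rewrite -normrN ler_norm.
Qed.

Lemma rsumE I (D : set I) (f : I -> R) :
  rsum D f = fine (\esum_(i in D) (Num.max (f i) 0)%:E)
           - fine (\esum_(i in D) (Num.max (- f i) 0)%:E).
Proof.
by rewrite /rsum; congr (fine _ - fine _); apply: eq_esum => i Di;
  rewrite ?funeposE ?funenegE /= EFin_max.
Qed.

Lemma esum_fin_num I (D : set I) (u : I -> R) :
  (forall i, D i -> 0 <= u i) -> (\esum_(i in D) (u i)%:E < +oo)%E ->
  \esum_(i in D) (u i)%:E \is a fin_num.
Proof. by move=> u0 ?; rewrite ge0_fin_numE// esum_ge0. Qed.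

(** Linearity and Fubini produce splittings of [f] other than the positive and negative parts; any
    splitting into nonnegative summable families computes the same value. *)
Lemma rsum_diff I (D : set I) (u v f : I -> R) :
  (forall i, D i -> 0 <= u i) -> (forall i, D i -> 0 <= v i) ->
  (\esum_(i in D) (u i)%:E < +oo)%E -> (\esum_(i in D) (v i)%:E < +oo)%E ->
  (forall i, D i -> f i = u i - v i) ->
  rsum D f = fine (\esum_(i in D) (u i)%:E) - fine (\esum_(i in D) (v i)%:E).
Proof.
move=> u0 v0 /(rsummable_ge0 u0) su /(rsummable_ge0 v0) sv fE.
have fin (w : I -> R) : (forall i, D i -> 0 <= w i) -> rsummable D w ->
    \esum_(i in D) (w i)%:E \is a fin_num.
  move=> w0; rewrite /rsummable summableE.
  by under eq_esum do rewrite /= ger0_norm ?w0//.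
have := esumB su sv (fun i Di => u0 i Di) (fun i Di => v0 i Di).
rewrite rsumE -[X in _ -> X]/(_ = _).
have -> : \esum_(i in D) ((EFin \o u) \- (EFin \o v))^\+%E i =
    \esum_(i in D) (Num.max (f i) 0)%:E.
  by apply: eq_esum => i Di; rewrite funeposE EFin_max (fE _ Di).
have -> : \esum_(i in D) ((EFin \o u) \- (EFin \o v))^\-%E i =
    \esum_(i in D) (Num.max (- f i) 0)%:E.
  by apply: eq_esum => i Di; rewrite funenegE EFin_max (fE _ Di) EFinN.
have sf : rsummable D f.
  apply: (@eq_rsummable _ _ (u \- v)) => [i /set_mem Di|].
    by rewrite /= fE.
  exact: (summableB su sv).
have [p n] := rsummable_posneg sf.
rewrite -fineB//.
- by move=> ->; rewrite fineB// fin.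
- by rewrite ge0_fin_numE// esum_ge0// => i _; rewrite lee_fin le_max lexx orbT.
- by rewrite ge0_fin_numE// esum_ge0// => i _; rewrite lee_fin le_max lexx orbT.
Qed.

Lemma rsummableD I (D : set I) (f g : I -> R) :
  rsummable D f -> rsummable D g -> rsummable D (fun i => f i + g i).
Proof. exact: summableD. Qed.

Lemma maxr0_ge0 (x : R) : 0 <= Num.max x 0.
Proof. by rewrite le_max lexx orbT. Qed.

Lemma maxr0_diff (x : R) : x = Num.max x 0 - Num.max (- x) 0.
Proof.
by case/orP: (le_total x 0) => h;
  [rewrite max_r// max_l ?oppr_ge0//|rewrite max_l// max_r ?oppr_le0//]; ring.
Qed.

Lemma rsumD I (D : set I) (f g : I -> R) :
  rsummable D f -> rsummable D g ->
  rsum D (fun i => f i + g i) = rsum D f + rsum D g.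
Proof.
move=> /rsummable_posneg[fp fn] /rsummable_posneg[gp gn].
have fin (h : I -> R) : (\esum_(i in D) (Num.max (h i) 0)%:E < +oo)%E ->
    \esum_(i in D) (Num.max (h i) 0)%:E \is a fin_num.
  by apply: esum_fin_num => i _; exact: maxr0_ge0.
have E (h k : I -> R) : \esum_(i in D) (Num.max (h i) 0 + Num.max (k i) 0)%:E =
    (\esum_(i in D) (Num.max (h i) 0)%:E + \esum_(i in D) (Num.max (k i) 0)%:E)%E.
  by rewrite -esumD//; move=> i _; rewrite lee_fin maxr0_ge0.
rewrite (@rsum_diff _ D (fun i => Num.max (f i) 0 + Num.max (g i) 0)
  (fun i => Num.max (- f i) 0 + Num.max (- g i) 0)); last first.
- by move=> i _; rewrite {1}(maxr0_diff (f i)) {1}(maxr0_diff (g i)); ring.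
- by rewrite (E (fun i => - f i) (fun i => - g i)) lte_add_pinfty.
- by rewrite E lte_add_pinfty.
- by move=> i _; rewrite addr_ge0// maxr0_ge0.
- by move=> i _; rewrite addr_ge0// maxr0_ge0.
rewrite E (E (fun i => - f i) (fun i => - g i)) !fineD ?fin//.
by rewrite !rsumE; ring.
Qed.

Lemma rsummableZ I (D : set I) (c : R) (f : I -> R) :
  rsummable D f -> rsummable D (fun i => c * f i).
Proof.
move=> sf; rewrite /rsummable /summable.
under eq_esum do rewrite /= normrM EFinM.
by rewrite esumZl// lte_mul_pinfty// ?lee_fin.
Qed.

Lemma rsumN I (D : set I) (f : I -> R) :
  rsum D (fun i => - f i) = - rsum D f.
Proof.
rewrite !rsumE opprB; congr (_ - _).
by congr fine; apply: eq_esum => i _; rewrite opprK.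
Qed.

Lemma rsumZ I (D : set I) (c : R) (f : I -> R) : rsummable D f ->
  rsum D (fun i => c * f i) = c * rsum D f.
Proof.
wlog c0 : c / 0 <= c => [H sf|].
  have [/H->//|c0] := leP 0 c.
  rewrite -[RHS]opprK -mulNr -H ?oppr_ge0 1?ltW// -rsumN.
  by apply: eq_rsum => i _; rewrite mulNr opprK.
move=> /rsummable_posneg[fp fn].
rewrite (@rsum_diff _ D (fun i => c * Num.max (f i) 0)
  (fun i => c * Num.max (- f i) 0)).
- under eq_esum do rewrite EFinM.
  rewrite [X in _ - fine X](eq_esum (b := fun i => (c%:E * (Num.max (- f i) 0)%:E)%E))//.
  have fin (h : I -> R) : (\esum_(i in D) (Num.max (h i) 0)%:E < +oo)%E ->
      \esum_(i in D) (Num.max (h i) 0)%:E \is a fin_num.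
    by apply: esum_fin_num => i _; exact: maxr0_ge0.
  rewrite !esumZl//; try by move=> i; rewrite lee_fin maxr0_ge0.
  by rewrite !fineM//= ?fin// ?(fin (fun i => - f i))// rsumE mulrBr.
- by move=> i _; rewrite mulr_ge0 ?maxr0_ge0.
- by move=> i _; rewrite mulr_ge0 ?maxr0_ge0.
- under eq_esum do rewrite EFinM.
  rewrite esumZl ?lte_mul_pinfty ?lee_fin// => i; by rewrite lee_fin maxr0_ge0.
- under eq_esum do rewrite EFinM.
  rewrite esumZl ?lte_mul_pinfty ?lee_fin// => i; by rewrite lee_fin maxr0_ge0.
- by move=> i _; rewrite -mulrBr -maxr0_diff.
Qed.

Lemma rsummable_reindex I J (D : set I) (E : set J) (e : J -> I) (f : I -> R) :
  set_bij E D e -> rsummable D f <-> rsummable E (f \o e).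
Proof. by move=> be; rewrite /rsummable /summable (@reindex_esum R _ _ E D e _ be). Qed.

Lemma rsum_reindex I J (D : set I) (E : set J) (e : J -> I) (f : I -> R) :
  set_bij E D e -> rsum D f = rsum E (f \o e).
Proof. by move=> be; rewrite !rsumE !(@reindex_esum R _ _ E D e _ be). Qed.

Lemma ler_norm_rsum I (D : set I) (f : I -> R) : rsummable D f ->
  `|rsum D f| <= fine (\esum_(i in D) `|f i|%:E).
Proof.
move=> sf; have [p n] := rsummable_posneg sf.
have g0 (h : I -> R) : (0 <= \esum_(i in D) (Num.max (h i) 0)%:E)%E.
  by apply: esum_ge0 => i _; rewrite lee_fin maxr0_ge0.
have -> : \esum_(i in D) `|f i|%:E = (\esum_(i in D) (Num.max (f i) 0)%:E +
    \esum_(i in D) (Num.max (- f i) 0)%:E)%E.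
  rewrite -esumD; try by move=> i _; rewrite lee_fin maxr0_ge0.
  apply: eq_esum => i _; rewrite -EFinD; congr EFin.
  case/orP: (le_total (f i) 0) => h.
    by rewrite ler0_norm// max_r// max_l ?oppr_ge0// add0r.
  by rewrite ger0_norm// max_l// max_r ?oppr_le0// addr0.
rewrite fineD ?ge0_fin_numE// ?(g0 (fun i => - f i))// rsumE.
have := fine_ge0 (g0 f); have := fine_ge0 (g0 (fun i => - f i)).
by move=> /= a b; rewrite ler_norml; apply/andP; split; lra.
Qed.

Section fubini.
Variables (I J : choiceType) (D : set I) (E : I -> set J) (f : I -> J -> R).
Hypothesis sf : rsummable (D `*`` E) (fun k => f k.1 k.2).

(** Used with [g] the absolute value, the positive part and the negative part of [f]. The inner sums
    pass through [fine], so their finiteness has to be settled before the iterated sum is compared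
    with the sum over pairs. *)
Lemma esum_fubini_lty (g : I -> J -> R) : (forall i j, 0 <= g i j <= `|f i j|) ->
  [/\ forall i, D i -> (\esum_(j in E i) (g i j)%:E < +oo)%E,
   (\esum_(i in D) (fine (\esum_(j in E i) (g i j)%:E))%:E < +oo)%E &
   fine (\esum_(i in D) (fine (\esum_(j in E i) (g i j)%:E))%:E) =
   fine (\esum_(k in D `*`` E) (g k.1 k.2)%:E)].
Proof.
move=> gf.
have g0 i j : (0 <= (g i j)%:E)%E by rewrite lee_fin; case/andP: (gf i j).
have H : (\esum_(k in D `*`` E) (g k.1 k.2)%:E < +oo)%E.
  apply: le_lt_trans sf; apply: le_esum => k _; rewrite lee_fin.
  by case/andP: (gf k.1 k.2).
have EE := @esum_esum R _ _ D E (fun i j => (g i j)%:E) (fun i j _ _ => g0 i j).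
have inner i : D i -> (\esum_(j in E i) (g i j)%:E < +oo)%E.
  move=> Di; apply: le_lt_trans H; rewrite -EE.
  (* An inner sum is a single nonnegative term of the outer sum, hence finite. *)
  rewrite (esumID [set i]); last by move=> k _; apply: esum_ge0.
  have -> : D `&` [set i] = [set i] by apply: setIidr => ? ->.
  rewrite esum_set1; last exact: esum_ge0.
  by apply: leeDl; apply: esum_ge0 => k _; apply: esum_ge0.
have E2 : \esum_(i in D) (fine (\esum_(j in E i) (g i j)%:E))%:E =
    \esum_(k in D `*`` E) (g k.1 k.2)%:E.
  rewrite -EE; apply: eq_esum => i Di; rewrite fineK// ge0_fin_numE ?inner//.
  exact: esum_ge0.
by split => //; rewrite E2.
Qed.

Let pf i j : 0 <= Num.max (f i j) 0 <= `|f i j|.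
Proof. by rewrite maxr0_ge0 ge_max normr_ge0 ler_norm. Qed.
Let nf i j : 0 <= Num.max (- f i j) 0 <= `|f i j|.
Proof. by rewrite maxr0_ge0 ge_max normr_ge0 -normrN ler_norm. Qed.

Lemma rsummable_inner i : D i -> rsummable (E i) (f i).
Proof.
move=> Di; have [|H _ _] := @esum_fubini_lty (fun i j => `|f i j|).
  by move=> ? ?; rewrite lexx normr_ge0.
exact: H.
Qed.

Lemma rsum_fubini : rsummable D (fun i => rsum (E i) (f i)) /\
  rsum D (fun i => rsum (E i) (f i)) = rsum (D `*`` E) (fun k => f k.1 k.2).
Proof.
split.
  have [|H1 H2 _] := @esum_fubini_lty (fun i j => `|f i j|).
    by move=> ? ?; rewrite lexx normr_ge0.
  apply: (@rsummable_le _ _ _ (fun i => fine (\esum_(j in E i) `|f i j|%:E))).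
    by move=> i Di; apply/ler_norm_rsum/rsummable_inner.
  apply/rsummable_ge0 => // i _; apply: fine_ge0; apply: esum_ge0 => j _.
  by rewrite lee_fin.
have [P1 P2 P3] := esum_fubini_lty pf.
have [N1 N2 N3] := esum_fubini_lty nf.
rewrite (@rsum_diff _ D
  (fun i => fine (\esum_(j in E i) (Num.max (f i j) 0)%:E))
  (fun i => fine (\esum_(j in E i) (Num.max (- f i j) 0)%:E)))//.
- by rewrite P3 N3 rsumE.
- move=> i _; apply: fine_ge0; apply: esum_ge0 => j _; rewrite lee_fin.
  exact: maxr0_ge0.
- move=> i _; apply: fine_ge0; apply: esum_ge0 => j _; rewrite lee_fin.
  exact: maxr0_ge0.
- by move=> i _; rewrite rsumE.
Qed.

End fubini.

Lemma rsum_fset I (D : set I) (f : I -> R) : finite_set D ->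
  rsummable D f /\ rsum D f = \sum_(i \in D) f i.
Proof.
move=> fD.
have s (g : I -> R) : (forall i, 0 <= g i) ->
    \esum_(i in D) (g i)%:E = (\sum_(i \in D) g i)%:E.
  move=> g0; rewrite esum_fset//; last by move=> i _; rewrite lee_fin.
  by rewrite !fsbig_finite//= sumEFin.
split.
  by rewrite /rsummable /summable (s (fun i => `|f i|))// ltry.
rewrite rsumE (s (fun i => Num.max (f i) 0)); last by move=> i; exact: maxr0_ge0.
rewrite (s (fun i => Num.max (- f i) 0)); last by move=> i; exact: maxr0_ge0.
rewrite /= !fsbig_finite//= -sumrB; apply: eq_bigr => i _.
by rewrite -maxr0_diff.
Qed.

End RealSums.

Section ComplexSums.
Context {R : realType}.
Implicit Types (I J : choiceType) (z w : R[i]).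

(** The norm of [R[i]] is itself a complex number; comparison with real majorants needs its real
    value. *)
Definition nrm z : R := complex.Re `|z|.

Lemma nrmE z : nrm z = Num.sqrt (complex.Re z ^+ 2 + complex.Im z ^+ 2).
Proof. by rewrite /nrm normc_def. Qed.

Lemma norm_nrm z : `|z| = (nrm z)%:C%C.
Proof. by rewrite nrmE normc_def. Qed.

Lemma nrm_ge0 z : 0 <= nrm z.
Proof. by rewrite nrmE sqrtr_ge0. Qed.

Lemma nrm1 : nrm 1 = 1 :> R.
Proof. by rewrite /nrm normr1. Qed.

Lemma nrmM z w : nrm (z * w) = nrm z * nrm w.
Proof.
by apply: (@complexI R); rewrite -norm_nrm normrM !norm_nrm rmorphM.
Qed.

Lemma nrmN z : nrm (- z) = nrm z.
Proof. by rewrite /nrm normrN. Qed.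

Lemma ler_nrmD z w : nrm (z + w) <= nrm z + nrm w.
Proof.
have := ler_normD z w.
by rewrite !norm_nrm -rmorphD lecR.
Qed.

Lemma ler_Re_nrm z : `|complex.Re z| <= nrm z.
Proof. by rewrite nrmE -sqrtr_sqr ler_wsqrtr// lerDl sqr_ge0. Qed.

Lemma ler_Im_nrm z : `|complex.Im z| <= nrm z.
Proof. by rewrite nrmE -sqrtr_sqr ler_wsqrtr// lerDr sqr_ge0. Qed.

Lemma ler_nrm_ReIm z : nrm z <= `|complex.Re z| + `|complex.Im z|.
Proof.
rewrite nrmE -[leRHS]ger0_norm ?addr_ge0// -sqrtr_sqr ler_wsqrtr//.
rewrite sqrrD !real_normK ?num_real// addrAC lerDl mulrn_wge0// mulr_ge0//.
Qed.

Lemma ReM z w : complex.Re (z * w) =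
  complex.Re z * complex.Re w - complex.Im z * complex.Im w.
Proof. by case: z; case: w. Qed.

Lemma ImM z w : complex.Im (z * w) =
  complex.Re z * complex.Im w + complex.Im z * complex.Re w.
Proof. by case: z => a b; case: w => c d /=; rewrite addrC. Qed.

Lemma ReD z w : complex.Re (z + w) = complex.Re z + complex.Re w.
Proof. by case: z; case: w. Qed.

Lemma ImD z w : complex.Im (z + w) = complex.Im z + complex.Im w.
Proof. by case: z; case: w. Qed.

Lemma eq_ReIm z w : complex.Re z = complex.Re w -> complex.Im z = complex.Im w ->
  z = w.
Proof. by case: z => a b; case: w => c d /= -> ->. Qed.

Lemma csummable_nrm I (D : set I) (F : I -> R[i]) :
  csummable D F <-> rsummable D (fun i => nrm (F i)).
Proof. by split => h; exact: h. Qed.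

Lemma csummableP I (D : set I) (F : I -> R[i]) : csummable D F <->
  rsummable D (@complex.Re R \o F) /\ rsummable D (@complex.Im R \o F).
Proof.
split => [/csummable_nrm s|[s1 s2]].
  by split; apply: rsummable_le s => i _; [exact: ler_Re_nrm|exact: ler_Im_nrm].
apply/csummable_nrm.
apply: rsummable_le (rsummableD (rsummable_norm s1) (rsummable_norm s2)) => i _ /=.
by rewrite ger0_norm ?nrm_ge0// (le_trans (ler_nrm_ReIm _)).
Qed.

Lemma csummable_le I (D : set I) (F : I -> R[i]) (g : I -> R) :
  (forall i, D i -> nrm (F i) <= g i) -> rsummable D g -> csummable D F.
Proof.
move=> Fg sg; apply/csummable_nrm; apply: rsummable_le sg => i Di.
by rewrite ger0_norm ?nrm_ge0// Fg.
Qed.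

Lemma eq_csum I (D : set I) (F G : I -> R[i]) : {in D, F =1 G} ->
  csum D F = csum D G.
Proof.
by move=> FG; rewrite /csum; congr (_ +i* _)%C; apply: eq_rsum => i Di /=;
  rewrite FG.
Qed.

Lemma eq_csummable I (D : set I) (F G : I -> R[i]) : {in D, F =1 G} ->
  csummable D F -> csummable D G.
Proof.
move=> FG /csummable_nrm h; apply/csummable_nrm; apply: eq_rsummable h => i Di.
by rewrite FG.
Qed.

Lemma csumD I (D : set I) (F G : I -> R[i]) :
  csummable D F -> csummable D G ->
  csum D (fun i => F i + G i) = csum D F + csum D G.
Proof.
move=> /csummableP[F1 F2] /csummableP[G1 G2]; apply: eq_ReIm.
  rewrite ReD /= -rsumD//; apply: eq_rsum => i _; exact: ReD.
rewrite ImD /= -rsumD//; apply: eq_rsum => i _; exact: ImD.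
Qed.

Lemma csummableZ I (D : set I) (c : R[i]) (F : I -> R[i]) :
  csummable D F -> csummable D (fun i => c * F i).
Proof.
move=> /csummable_nrm sF; apply: (csummable_le _ (rsummableZ (nrm c) sF)) => i _.
by rewrite nrmM.
Qed.

Lemma csumZ I (D : set I) (c : R[i]) (F : I -> R[i]) :
  csummable D F -> csum D (fun i => c * F i) = c * csum D F.
Proof.
move=> /csummableP[F1 F2]; apply: eq_ReIm.
  rewrite ReM /= -mulNr -!rsumZ// -rsumD; try exact: rsummableZ.
  by apply: eq_rsum => i _ /=; rewrite ReM mulNr.
rewrite ImM /= -!rsumZ// -rsumD; try exact: rsummableZ.
by apply: eq_rsum => i _ /=; rewrite ImM.
Qed.

Lemma csummable_reindex I J (D : set I) (E : set J) (e : J -> I)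
    (F : I -> R[i]) : set_bij E D e -> csummable D F <-> csummable E (F \o e).
Proof. exact: rsummable_reindex. Qed.

Lemma csum_reindex I J (D : set I) (E : set J) (e : J -> I) (F : I -> R[i]) :
  set_bij E D e -> csum D F = csum E (F \o e).
Proof. by move=> be; rewrite /csum !(rsum_reindex _ be). Qed.

Lemma csum_fubini I J (D : set I) (E : I -> set J) (F : I -> J -> R[i]) :
  csummable (D `*`` E) (fun k => F k.1 k.2) ->
  [/\ forall i, D i -> csummable (E i) (F i),
     csummable D (fun i => csum (E i) (F i)) &
     csum D (fun i => csum (E i) (F i)) = csum (D `*`` E) (fun k => F k.1 k.2)].
Proof.
move=> /csummableP[s1 s2]; split.
- move=> i Di; apply/csummableP; split.
    exact: (@rsummable_inner _ _ _ D E (fun i j => complex.Re (F i j))).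
  exact: (@rsummable_inner _ _ _ D E (fun i j => complex.Im (F i j))).
- apply/csummableP; split.
    by have [] := @rsum_fubini _ _ _ D E (fun i j => complex.Re (F i j)) s1.
  by have [] := @rsum_fubini _ _ _ D E (fun i j => complex.Im (F i j)) s2.
- apply: eq_ReIm.
    by have [] := @rsum_fubini _ _ _ D E (fun i j => complex.Re (F i j)) s1.
  by have [] := @rsum_fubini _ _ _ D E (fun i j => complex.Im (F i j)) s2.
Qed.

Lemma csum_fset I (D : set I) (F : I -> R[i]) : finite_set D ->
  csummable D F /\ csum D F = \sum_(i \in D) F i.
Proof.
move=> fD.
have [s1 e1] := rsum_fset (@complex.Re R \o F) fD.
have [s2 e2] := rsum_fset (@complex.Im R \o F) fD.
split; first exact/csummableP.
apply: eq_ReIm; rewrite /= ?e1 ?e2 !fsbig_finite//=.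
  by rewrite (raddf_sum (@complex.Re R)).
by rewrite (raddf_sum (@complex.Im R)).
Qed.

(** The factor 2 comes from bounding the sums of real and imaginary parts separately. *)
Lemma ler_nrm_csum I (D : set I) (F : I -> R[i]) (g : I -> R) (B : R) :
  (forall i, D i -> nrm (F i) <= g i) -> (\esum_(i in D) (g i)%:E <= B%:E)%E ->
  nrm (csum D F) <= 2 * B.
Proof.
move=> Fg gB.
have g0 i : D i -> 0 <= g i by move=> /Fg; apply: le_trans; exact: nrm_ge0.
have sg : rsummable D g by apply/rsummable_ge0 => //; rewrite (le_lt_trans gB)// ltry.
have /csummableP[s1 s2] : csummable D F by apply: csummable_le sg.
have key (h : I -> R) : (forall i, D i -> `|h i| <= g i) -> rsummable D h ->
    `|rsum D h| <= B.
  move=> hg sh; apply: (le_trans (ler_norm_rsum sh)); rewrite -lee_fin fineK.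
    by apply: le_trans gB; apply: le_esum => i Di; rewrite lee_fin hg.
  by apply: esum_fin_num.
rewrite (le_trans (ler_nrm_ReIm _))// mulr2n mulrDl mul1r lerD//; apply: key => //.
  by move=> i Di; apply: le_trans (Fg i Di); exact: ler_Re_nrm.
by move=> i Di; apply: le_trans (Fg i Di); exact: ler_Im_nrm.
Qed.

End ComplexSums.

(** * Integration over R^3 *)

Section Leb3.
Context {R : realType}.
Local Notation mu := (@lebesgue_measure R).
Local Notation T1 := (measurableTypeR R).
Local Open Scope ereal_scope.

Definition sgn_shift (b : bool) (a x : T1) : T1 := ((-1) ^+ b * x + a)%R.

Lemma measurable_sgn_shift b a : measurable_fun setT (sgn_shift b a).
Proof. by apply: measurable_funD => //; exact: measurable_funM. Qed.

Lemma lebesgue_measure_shift (a : R) (A : set R) : measurable A ->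
  pushforward mu (sgn_shift false a) A = mu A.
Proof.
move=> mA; apply/esym/lebesgue_measure_unique => //=; first exact: measurable_sgn_shift.
move=> _ _ [[u v]] _ <-.
rewrite /pushforward /=.
have -> : sgn_shift false a @^-1` `]u, v]%classic = `](u - a)%R, (v - a)%R]%classic.
  apply/seteqP; split => x; rewrite /= !in_itv /= /sgn_shift expr0 mul1r;
  by rewrite ltrBlDr lerBrDr.
rewrite !lebesgue_measure_itv/= !lte_fin ltrD2r.
by case: ifP => // _; rewrite -!EFinB; congr EFin; ring.
Qed.

(** Translations preserve the measure because they preserve the lengths of half-open intervals; the
    reflection is split off by one further change of variable. *)
Lemma ge0_integral_sgn_shift b a (f : T1 -> \bar R) :
  measurable_fun setT f -> (forall x, 0 <= f x) ->
  \int[mu]_x f (sgn_shift b a x) = \int[mu]_x f x.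
Proof.
move=> mf f0.
have H a' (g : T1 -> \bar R) : measurable_fun setT g -> (forall x, 0 <= g x) ->
    \int[mu]_x g (sgn_shift false a' x) = \int[mu]_x g x.
  move=> mg g0.
  have := @ge0_integral_pushforward _ _ _ _ _ _ (measurable_sgn_shift false a') mu
    setT g measurableT mg (fun y _ => g0 y).
  rewrite preimage_setT => <-.
  apply: eq_measure_integral => [|? A mA _]; last exact: lebesgue_measure_shift.
  exact: measurable_sgn_shift.
case: b; last exact: H.
have mo : measurable_fun setT (-%R : T1 -> T1) by exact: (measurable_funN (@measurable_id _ T1 setT)).
have mfa : measurable_fun setT (fun x => f (sgn_shift false a x)).
  by apply: (measurableT_comp mf); exact: measurable_sgn_shift.
have := @ge0_integral_pushforward _ _ _ _ _ _ mo mu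
    setT _ measurableT mfa (fun y _ => f0 _).
rewrite preimage_setT -(H a f)// => E.
transitivity (\int[mu]_x ((fun x => f (sgn_shift false a x)) \o -%R) x).
  apply: eq_integral => x _ /=; congr f; rewrite /sgn_shift expr1 expr0.
  by rewrite mulN1r mul1r.
rewrite -E; apply: eq_measure_integral => A mA _; exact: (lebesgue_measureN mA).
Qed.

(** Triangular maps, whose last coordinate is shifted by a function of the first two. They cover the
    left translations of N as well as inversion followed by a right translation, and they preserve
    Lebesgue measure by Tonelli, the last coordinate being integrated first. *)
Definition aff3 (b1 b2 b3 : bool) (a1 a2 : T1) (t : T1 * T1 -> T1) (p : T1 * T1 * T1)
    : T1 * T1 * T1 :=
  (sgn_shift b1 a1 p.1.1, sgn_shift b2 a2 p.1.2, sgn_shift b3 (t p.1) p.2).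

Lemma measurable_aff3 b1 b2 b3 a1 a2 (t : T1 * T1 -> T1) :
  measurable_fun setT t ->
  measurable_fun setT (aff3 b1 b2 b3 a1 a2 t : T1 * T1 * T1 -> T1 * T1 * T1).
Proof.
move=> mt; apply: measurable_fun_pair => /=.
  apply: measurable_fun_pair => /=.
    apply: measurableT_comp; first exact: measurable_sgn_shift.
    exact: (measurableT_comp measurable_fst).
  apply: measurableT_comp; first exact: measurable_sgn_shift.
  exact: (measurableT_comp measurable_snd).
apply: measurable_funD; first exact: measurable_funM.
exact: measurableT_comp.
Qed.

(** Named so that the product measure can carry the sigma-finite structure that Tonelli asks for
    when passing from two to three variables. *)
Definition leb2 : set (T1 * T1)%type -> \bar R := (mu \x mu)%E.

HB.instance Definition _ := Measure.on leb2.

Let sigma_finite_leb2 : sigma_finite setT leb2.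
Proof.
have /sigma_finiteP[F [TF ndF Foo]] := sigma_finiteT mu.
exists (fun n => F n `*` F n) => [|k].
  apply/seteqP; split => // -[x y] _.
  have [[n _ Fnx] [k _ Fky]] : (\bigcup_i F i) x /\ (\bigcup_i F i) y by rewrite -TF.
  exists (maxn n k) => //; split.
    by move: x Fnx; exact/subsetPset/ndF/leq_maxl.
  by move: y Fky; exact/subsetPset/ndF/leq_maxr.
have [mF Fk] := Foo k; split; first exact: measurableX.
by rewrite /leb2 product_measure1E// lte_mul_pinfty// ge0_fin_numE.
Qed.

HB.instance Definition _ := Measure_isSigmaFinite.Build _ _ _ leb2
  sigma_finite_leb2.

Lemma leb3E : @leb3 R = (leb2 \x mu)%E.
Proof. by []. Qed.

Lemma leb3_tonelli (G : T1 * T1 * T1 -> \bar R) :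
  measurable_fun setT G -> (forall p, 0 <= G p) ->
  \int[@leb3 R]_p G p = \int[leb2]_q \int[mu]_z G (q, z).
Proof. by move=> mG G0; rewrite leb3E; exact: fubini_tonelli1. Qed.

Lemma leb2_tonelli (G : T1 * T1 -> \bar R) :
  measurable_fun setT G -> (forall p, 0 <= G p) ->
  \int[leb2]_q G q = \int[mu]_x \int[mu]_y G (x, y).
Proof. by move=> mG G0; exact: fubini_tonelli1. Qed.

Lemma ge0_integral_aff3 b1 b2 b3 a1 a2 (t : T1 * T1 -> T1)
    (G : T1 * T1 * T1 -> \bar R) :
  measurable_fun setT t -> measurable_fun setT G -> (forall p, 0 <= G p) ->
  \int[@leb3 R]_p G (aff3 b1 b2 b3 a1 a2 t p) = \int[@leb3 R]_p G p.
Proof.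
move=> mt mG G0.
have mGa : measurable_fun setT (fun p => G (aff3 b1 b2 b3 a1 a2 t p)).
  apply: (measurableT_comp mG); exact: measurable_aff3.
rewrite (leb3_tonelli mG)// (leb3_tonelli mGa)//.
set K := fun q => \int[mu]_z G (q, z).
have mK : measurable_fun setT K by exact: measurable_fun_fubini_tonelli_F.
have K0 q : 0 <= K q by exact: integral_ge0.
pose h (q : T1 * T1) : T1 * T1 := (sgn_shift b1 a1 q.1, sgn_shift b2 a2 q.2).
have mh : measurable_fun setT h.
  apply: measurable_fun_pair => /=; apply: measurableT_comp => //;
  exact: measurable_sgn_shift.
transitivity (\int[leb2]_q K (h q)).
  apply: eq_integral => q _; rewrite /K.
  apply: (@ge0_integral_sgn_shift b3 (t q) (fun z => G (h q, z))) => //.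
  exact: measurableT_comp.
have mKh : measurable_fun setT (fun q => K (h q)) by exact: measurableT_comp mh.
rewrite (leb2_tonelli mK K0).
etransitivity; first exact: (leb2_tonelli mKh (fun q => K0 (h q))).
pose L := fun x => \int[mu]_y K (x, y).
have mL : measurable_fun setT L by exact: measurable_fun_fubini_tonelli_F.
have L0 x : 0 <= L x by exact: integral_ge0.
transitivity (\int[mu]_x L (sgn_shift b1 a1 x)); last first.
  exact: (ge0_integral_sgn_shift b1 a1 mL L0).
apply: eq_integral => x _; rewrite /L.
apply: (@ge0_integral_sgn_shift b2 a2 (fun y => K (sgn_shift b1 a1 x, y))) => //.
exact: measurableT_comp.
Qed.

End Leb3.

(** * Sums over countable sets under the integral sign *)

Section SumIntegral.
Context d (T : measurableType d) {R : realType} (mu : {measure set T -> \bar R}).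
Context (I : choiceType) (D : set I).
Hypothesis cD : countable D.
Local Open Scope ereal_scope.

(* A sum over a countable set is a series over nat with zeros inserted; the
   option type avoids choosing a default element of I. *)
Let esum_enum : exists h : nat -> option I, (forall n i, h n = Some i -> D i) /\
  forall a : I -> \bar R, (forall i, D i -> 0 <= a i) ->
    \esum_(i in D) a i = \sum_(n <oo) oapp a 0 (h n).
Proof.
have /countable_injP[g gI] := cD.
pose h n : option I := if pselect (exists i, D i /\ g i = n) is left e
  then Some (projT1 (cid e)) else None.
have hD n i : h n = Some i -> D i /\ g i = n.
  by rewrite /h; case: pselect => // e [<-]; case: (cid e).
have hg i : D i -> h (g i) = Some i.
  move=> Di; rewrite /h; case: pselect => [e|]; last by case; exists i.
  by congr Some; case: (cid e) => /= j [Dj /gI]; apply; rewrite inE.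
exists h; split => [n i /hD[]//|a a0].
have oa0 n : 0 <= oapp a 0 (h n).
  by case E : (h n) => [i|] //=; have [/a0] := hD _ _ E.
rewrite nneseries_esumT// (esumID (g @` D)) ?setTI//.
rewrite [X in _ = _ + X]esum1 ?adde0; last first.
  move=> n /= nD; case E : (h n) => [i|] //=; have [Di gi] := hD _ _ E.
  by exfalso; apply: nD; exists i.
rewrite esum_image => [|i j Di Dj]; last exact: gI.
by apply: eq_esum => i Di /=; rewrite hg.
Qed.

Lemma ge0_measurable_esum (E : set T) (f : I -> T -> \bar R) :
  (forall i, D i -> measurable_fun E (f i)) -> (forall i x, D i -> 0 <= f i x) ->
  measurable_fun E (fun x => \esum_(i in D) f i x).
Proof.
move=> mf f0; have [h [hD hE]] := esum_enum.
rewrite (_ : (fun x => _) = fun x => \sum_(n <oo) oapp (f ^~ x) 0 (h n)); last first.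
  by apply/funext => x; rewrite hE// => i; exact: f0.
apply: (@ge0_emeasurable_sum _ _ _ _ _ xpredT) => [n x Ex _|n _].
  by case E1 : (h n) => [i|] //=; apply: f0; exact: hD E1.
by case E1 : (h n) => [i|] /=; [apply: mf; exact: hD E1|exact: measurable_cst].
Qed.

Lemma integral_esum (E : set T) (f : I -> T -> \bar R) : measurable E ->
  (forall i, D i -> measurable_fun E (f i)) -> (forall i x, D i -> 0 <= f i x) ->
  \int[mu]_(x in E) (\esum_(i in D) f i x) =
  \esum_(i in D) \int[mu]_(x in E) f i x.
Proof.
move=> mE mf f0; have [h [hD hE]] := esum_enum.
rewrite hE; last by move=> i Di; apply: integral_ge0 => x _; exact: f0.
transitivity (\int[mu]_(x in E) \sum_(n <oo) oapp (f ^~ x) 0 (h n)).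
  by apply: eq_integral => x _; apply: hE => i; exact: f0.
rewrite integral_nneseries//.
- apply: eq_eseriesr => n _; case: (h n) => [i|] //=; exact: integral0.
- move=> n; case E1 : (h n) => [i|] /=; [apply: mf; exact: hD E1|].
  exact: measurable_cst.
- by move=> n x Ex; case E1 : (h n) => [i|] //=; apply: f0; exact: hD E1.
Qed.

End SumIntegral.

Section ContinuousMeasurable.
Context {R : realType}.
Local Notation T1 := (measurableTypeR R).

Definition grid (k : nat) (x : R) : R := (Num.floor (k.+1%:R * x))%:~R / k.+1%:R.

Lemma grid_cvg (x : R) : grid ^~ x @ \oo --> x.
Proof.
apply/cvgrPdist_lt => e e0.
apply: filterS (near_infty_natSinv_lt (PosNum e0)) => k /=; apply: le_lt_trans.
have k0 : 0 < k.+1%:R :> R by [].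
have /andP[fl fu] := floor_itv (k.+1%:R * x).
have -> : x - grid k x = (k.+1%:R * x - (Num.floor (k.+1%:R * x))%:~R) / k.+1%:R.
  by rewrite /grid; field; rewrite lt0r_neq0.
rewrite ger0_norm ?divr_ge0 ?subr_ge0// -[leRHS]mul1r ler_pM2r ?invr_gt0//.
by rewrite lerBlDl ltW// -[1]/(1%:~R) -intrD.
Qed.

Lemma grid3_cvg (x y z : R) :
  (fun k => (grid k x, grid k y, grid k z)) @ \oo --> (x, y, z).
Proof.
apply: (cvg_pair (G := nbhs (x, y)) (H := nbhs z)); last exact: grid_cvg.
by apply: (cvg_pair (G := nbhs x) (H := nbhs y)); exact: grid_cvg.
Qed.

(** Continuity refers to the product topology, measurability to the product sigma-algebra. [f] is
    the pointwise limit of its values at grid points, and each approximation is constant on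
    countably many boxes. *)
Lemma continuous_measurable3 (f : R * R * R -> R) : continuous f ->
  measurable_fun setT (f : T1 * T1 * T1 -> T1).
Proof.
move=> cf.
pose h k (p : T1 * T1 * T1) := f (grid k p.1.1, grid k p.1.2, grid k p.2).
apply: (@measurable_fun_cvg _ _ _ _ h) => [k|p _]; last first.
  apply: (@cvg_comp _ _ _ (fun k => (grid k p.1.1, grid k p.1.2, grid k p.2)) f
    _ _ _ _ (cf p)); case: p => -[x y] z /=.
  exact: grid3_cvg.
move=> _ A mA; rewrite setTI.
pose g (m : int) : T1 := m%:~R / k.+1%:R.
pose cell (m : int) : set T1 := [set x | m%:~R <= k.+1%:R * x < (m + 1)%:~R].
pose F (m : int * int * int) : set (T1 * T1 * T1) :=
  if asbool (A (f (g m.1.1, g m.1.2, g m.2))) then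
    (cell m.1.1 `*` cell m.1.2) `*` cell m.2 else set0.
have -> : h k @^-1` A = \bigcup_m F m.
  apply/seteqP; split => [[[x y] z] Ap|[[x y] z] [[[a b] c] _]].
    exists (Num.floor (k.+1%:R * x), Num.floor (k.+1%:R * y), Num.floor (k.+1%:R * z)) => //.
    rewrite /F asboolT//=; split => /=; first split; exact: floor_itv.
  rewrite /F; case: asboolP => //= Aabc [/= [+ +] +].
  move=> /= /floor_def xa /floor_def yb /floor_def zc.
  by rewrite /h /grid /= xa yb zc.
apply: countable_bigcupT_measurable => // m; rewrite /F.
have mcell j : measurable (cell j).
  rewrite [X in measurable X](_ : _ = `[g j, g (j + 1)[%classic).
    exact: measurable_itv.
  apply/seteqP; split => x; rewrite /cell /g /= in_itv /=;
    by rewrite ler_pdivrMr// ltr_pdivlMr// [x * _]mulrC.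
by case: asboolP => // _; apply: measurableX => //; exact: measurableX.
Qed.

End ContinuousMeasurable.

(** * Exchange on the unit cube, and tiling of the space by its translates *)

Section RealIntegrals.
Context {R : realType}.
Local Notation mu := (@lebesgue_measure R).
Local Notation T1 := (measurableTypeR R).
Local Notation T3 := (T1 * T1 * T1)%type.
Local Notation mu3 := (@leb2 R \x mu)%E.
Implicit Types (f g u v : T3 -> T1).

Lemma measurable_unit_cube : measurable (unit_cube R : set T3).
Proof. by apply: measurableX; [apply: measurableX|]; exact: measurable_itv. Qed.

Lemma leb3_unit_cube : mu3 (unit_cube R) = 1%E.
Proof.
have mI : measurable (`[0, 1[%classic : set T1) by exact: measurable_itv.
have i1 : mu (`[0, 1[%classic : set T1) = 1%E.
  by rewrite lebesgue_measure_itv/= lte01 EFinN sube0.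
have i2 : leb2 (`[0, 1[ `*` `[0, 1[ : set (T1 * T1)) = 1%E.
  rewrite /leb2 product_measure1E// -[RHS]mule1.
  by congr (_ * _)%E; exact: i1.
etransitivity; first by apply: product_measure1E => //; exact: measurableX.
by rewrite -[RHS]mule1; congr (_ * _)%E; [exact: i2|exact: i1].
Qed.

Lemma bounded_integrable_cube f (b : R) : measurable_fun setT f ->
  (forall p, unit_cube R p -> `|f p| <= b) ->
  mu3.-integrable (unit_cube R) (EFin \o f) /\
  `|Rintegral mu3 (unit_cube R) f| <= b.
Proof.
move=> mf fb; have mC := measurable_unit_cube.
have mfC : measurable_fun (unit_cube R : set T3) f by exact: measurable_funS mf.
have le : (\int[mu3]_(p in unit_cube R) `|f p|%:E <= b%:E)%E.
  apply: (@le_trans _ _ (\int[mu3]_(p in unit_cube R) b%:E)%E).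
    apply: ge0_le_integral => //.
    by apply/measurable_EFinP; exact: measurableT_comp.
  rewrite le_eqVlt; apply/orP; left; apply/eqP; rewrite -[RHS]mule1.
  etransitivity; first exact: integral_cst.
  by congr (_ * _)%E; exact: leb3_unit_cube.
have intf : mu3.-integrable (unit_cube R) (EFin \o f).
  apply/integrableP; split; first exact/measurable_EFinP.
  exact: le_lt_trans le (ltry _).
split=> //; rewrite (le_trans (le_normr_Rintegral mC intf))//.
rewrite /Rintegral -lee_fin fineK//.
rewrite ge0_fin_numE ?integral_ge0//; exact: le_lt_trans le (ltry _).
Qed.

Section exchange.
Context (I : choiceType) (D : set I).
Hypothesis cD : countable D.
Variables (b : I -> R).
Hypothesis sb : rsummable D b.

(** The cube has measure 1, so the pointwise bound [b i] also bounds the integral of [u i]: one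
    summable family controls both sides. *)
Lemma ge0_exchange (u : I -> T3 -> T1) :
  (forall i, D i -> measurable_fun setT (u i)) ->
  (forall i p, 0 <= u i p) ->
  (forall i p, D i -> unit_cube R p -> u i p <= b i) ->
  let U p := fine (\esum_(i in D) (u i p)%:E) in
  [/\ forall p, unit_cube R p -> (\esum_(i in D) (u i p)%:E < +oo)%E,
     mu3.-integrable (unit_cube R) (EFin \o U),
     (\esum_(i in D) (Rintegral mu3 (unit_cube R) (u i))%:E < +oo)%E &
     Rintegral mu3 (unit_cube R) U =
     fine (\esum_(i in D) (Rintegral mu3 (unit_cube R) (u i))%:E)].
Proof.
move=> mu_ u0 ub U; have mC := measurable_unit_cube.
have b0 i : D i -> 0 <= b i.
  move=> Di; apply: le_trans (u0 i (0, 0, 0)) (ub _ _ Di _).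
  by split; [split|] => /=; rewrite in_itv /= lexx ltr01.
have sb' : (\esum_(i in D) (b i)%:E < +oo)%E.
  exact: (proj1 (rsummable_ge0 b0) sb).
have fin p : unit_cube R p -> (\esum_(i in D) (u i p)%:E < +oo)%E.
  move=> Cp; apply: le_lt_trans sb'; apply: le_esum => i Di.
  by rewrite lee_fin ub.
have Ub i : D i -> mu3.-integrable (unit_cube R) (EFin \o u i) /\
    `|Rintegral mu3 (unit_cube R) (u i)| <= b i.
  move=> Di; apply: bounded_integrable_cube => [|p Cp]; first exact: mu_.
  by rewrite ger0_norm ?u0 ?ub.
have UE p : unit_cube R p -> (U p)%:E = \esum_(i in D) (u i p)%:E.
  move=> Cp; rewrite fineK// esum_fin_num ?fin// => i _; exact: u0.
have mE : measurable_fun (unit_cube R : set T3) (fun p => \esum_(i in D) (u i p)%:E).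
  apply: ge0_measurable_esum => // [i Di|i p _]; last by rewrite lee_fin u0.
  by apply/measurable_EFinP; apply: measurable_funS (mu_ i Di).
have IE : (\int[mu3]_(p in unit_cube R) (U p)%:E =
    \esum_(i in D) (Rintegral mu3 (unit_cube R) (u i))%:E)%E.
  transitivity (\int[mu3]_(p in unit_cube R) (\esum_(i in D) (u i p)%:E))%E.
    by apply: eq_integral => p /set_mem Cp; exact: UE.
  rewrite integral_esum//.
  - apply: eq_esum => i Di; rewrite /Rintegral fineK//.
    exact: integrable_fin_num (proj1 (Ub i Di)).
  - move=> i Di; apply/measurable_EFinP; apply: measurable_funS (mu_ i Di) => //.
  - by move=> i p _; rewrite lee_fin u0.
have fi : (\esum_(i in D) (Rintegral mu3 (unit_cube R) (u i))%:E < +oo)%E.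
  apply: le_lt_trans sb'; apply: le_esum => i Di; rewrite lee_fin.
  exact: le_trans (ler_norm _) (proj2 (Ub i Di)).
split => //; last by rewrite /Rintegral IE.
apply/integrableP; split.
  apply: eq_measurable_fun mE => p /set_mem Cp; by rewrite /= -UE.
under eq_integral => p _.
  rewrite /= ger0_norm; last first.
    by apply: fine_ge0; apply: esum_ge0 => i _; rewrite lee_fin u0.
  over.
by rewrite IE.
Qed.

Lemma rsum_exchange (f : I -> T3 -> T1) :
  (forall i, D i -> measurable_fun setT (f i)) ->
  (forall i p, D i -> unit_cube R p -> `|f i p| <= b i) ->
  mu3.-integrable (unit_cube R) (EFin \o (fun p => rsum D (f^~ p))) /\
  Rintegral mu3 (unit_cube R) (fun p => rsum D (f^~ p)) =
  rsum D (fun i => Rintegral mu3 (unit_cube R) (f i)).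
Proof.
move=> mf fb; have mC := measurable_unit_cube.
pose u i p := Num.max (f i p) 0; pose v i p := Num.max (- f i p) 0.
have mu_ i : D i -> measurable_fun setT (u i).
  by move=> Di; apply: measurable_maxr => //; exact: mf.
have mv_ i : D i -> measurable_fun setT (v i).
  by move=> Di; apply: measurable_maxr => //; apply: measurable_funN; exact: mf.
have [|i p Di Cp|U1 U2 U3 U4] := ge0_exchange mu_.
- by move=> i p; exact: maxr0_ge0.
- by rewrite (le_trans _ (fb i p Di Cp))// ge_max normr_ge0 ler_norm.
have [|i p Di Cp|V1 V2 V3 V4] := ge0_exchange mv_.
- by move=> i p; exact: maxr0_ge0.
- by rewrite (le_trans _ (fb i p Di Cp))// ge_max normr_ge0 -normrN ler_norm.
set U := fun p => fine (\esum_(i in D) (u i p)%:E) in U2 U4.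
set V := fun p => fine (\esum_(i in D) (v i p)%:E) in V2 V4.
have E p : rsum D (f^~ p) = U p - V p by rewrite rsumE.
have -> : (fun p => rsum D (f^~ p)) = (fun p => U p - V p) by apply/funext.
split; first exact: (integrableB mC U2 V2).
rewrite RintegralB// U4 V4; apply/esym/rsum_diff => //.
- by move=> i Di; apply: Rintegral_ge0 => p _; exact: maxr0_ge0.
- by move=> i Di; apply: Rintegral_ge0 => p _; exact: maxr0_ge0.
- move=> i Di; rewrite -RintegralB//.
  + by apply: eq_Rintegral => p _; exact: maxr0_diff.
  + apply: (proj1 (bounded_integrable_cube (b := b i) (mu_ i Di) _)) => p Cp.
    rewrite ger0_norm ?maxr0_ge0// (le_trans _ (fb i p Di Cp))//.
    by rewrite ge_max normr_ge0 ler_norm.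
  + apply: (proj1 (bounded_integrable_cube (b := b i) (mv_ i Di) _)) => p Cp.
    rewrite ger0_norm ?maxr0_ge0// (le_trans _ (fb i p Di Cp))//.
    by rewrite ge_max normr_ge0 -normrN ler_norm.
Qed.

End exchange.

(** Left translation by n(a, b, c) on N, in coordinates. *)
Definition heis_shift (a b c : T1) : T3 -> T3 :=
  aff3 false false false a b (fun q => c + a * q.2).

Definition lattice_shift (m : int * int * int) : T3 -> T3 :=
  heis_shift m.1.1%:~R m.1.2%:~R m.2%:~R.

Let measurable_heis_corr (a c : T1) :
  measurable_fun setT (fun q : T1 * T1 => c + a * q.2).
Proof. by apply: measurable_funD => //; apply: measurable_funM. Qed.

Lemma measurable_heis_shift a b c : measurable_fun setT (heis_shift a b c).
Proof. by apply: measurable_aff3; exact: measurable_heis_corr. Qed.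

Lemma heis_shift_inv a b c p : heis_shift (- a) (- b) (a * b - c) (heis_shift a b c p) = p.
Proof.
by case: p => -[x y] z; rewrite /heis_shift /aff3 /sgn_shift /=;
  congr (_, _, _); ring.
Qed.

Lemma ge0_integral_heis_shift a b c (G : T3 -> \bar R) :
  measurable_fun setT G -> (forall p, (0 <= G p)%E) ->
  (\int[mu3]_p G (heis_shift a b c p) = \int[mu3]_p G p)%E.
Proof.
move=> mG G0; exact: (@ge0_integral_aff3 R false false false a b _ G (measurable_heis_corr a c)).
Qed.

Lemma fundamental_domain (p : T3) : exists2 m : int * int * int,
  unit_cube R (heis_shift (- m.1.1%:~R) (- m.1.2%:~R) (m.1.1%:~R * m.1.2%:~R - m.2%:~R) p) &
  forall m' : int * int * int,
  unit_cube R (heis_shift (- m'.1.1%:~R) (- m'.1.2%:~R) (m'.1.1%:~R * m'.1.2%:~R - m'.2%:~R) p) -> m' = m.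
Proof.
case: p => -[x y] z.
pose a := Num.floor x; pose b := Num.floor y.
(* The third coordinate is reduced last: removing [a] and [b] by a left translation changes [z] by
   [- a * (y - b)]. *)
pose c := Num.floor (z - a%:~R * (y - b%:~R)).
exists (a, b, c).
  have /andP[a1 a2] := floor_itv x; have /andP[b1 b2] := floor_itv y.
  have /andP[c1 c2] := floor_itv (z - a%:~R * (y - b%:~R)).
  rewrite !intrD in a2 b2 c2.
  rewrite /heis_shift /aff3 /sgn_shift /=; split; [split|] => /=;
    rewrite in_itv /= -/a -/b -/c; apply/andP; split; rewrite -/a -/b -/c in a1 a2 b1 b2 c1 c2 *; lra.
move=> [[a' b'] c']; rewrite /heis_shift /aff3 /sgn_shift /=.
move=> [[/=]]; rewrite !in_itv /= => /andP[a1 a2] /andP[b1 b2] /andP[c1 c2].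
have ea : a' = a by apply/esym/floor_def; rewrite intrD; apply/andP; split; lra.
have eb : b' = b by apply/esym/floor_def; rewrite intrD; apply/andP; split; lra.
have ec : c' = c.
  by apply/esym/floor_def; rewrite -ea -eb intrD; apply/andP; split; lra.
by rewrite ea eb ec.
Qed.

(** Exactly one translate of the cube contains a given point, so [G] is the sum of its restrictions
    to the translates; each piece is moved back to the cube by the invariance of the measure. *)
Lemma ge0_tiling (G : T3 -> \bar R) :
  measurable_fun setT G -> (forall p, (0 <= G p)%E) ->
  (\int[mu3]_p G p = \esum_(m in [set: int * int * int])
     \int[mu3]_(p in unit_cube R) G (lattice_shift m p))%E.
Proof.
move=> mG G0.
pose back (m : int * int * int) : T3 -> T3 :=
  heis_shift (- m.1.1%:~R) (- m.1.2%:~R) (m.1.1%:~R * m.1.2%:~R - m.2%:~R).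
pose K (m : int * int * int) (p : T3) : \bar R :=
  ((\1_(unit_cube R) (back m p))%:E * G p)%E.
have mI : measurable_fun setT (fun p : T3 => (\1_(unit_cube R) p : R)%:E).
  by apply/measurable_EFinP; apply: measurable_indic; exact: measurable_unit_cube.
have mK m : measurable_fun setT (K m).
  apply: emeasurable_funM => //.
  by apply: (measurableT_comp mI); exact: measurable_heis_shift.
have K0 m p : (0 <= K m p)%E by rewrite mule_ge0// lee_fin.
transitivity (\int[mu3]_p \esum_(m in [set: int * int * int]) K m p)%E.
  apply: eq_integral => p _; have [m Cm mE] := fundamental_domain p.
  rewrite (esumID [set m])// setTI setTI.
  rewrite esum_set1// [X in (_ + X)%E]esum1.
    by rewrite adde0 /K indicE mem_set// mul1e.
  move=> m' /= m'm; rewrite /K indicE memNset ?mul0e// => /mE.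
  exact: m'm.
rewrite integral_esum//; last exact: countableP.
apply: eq_esum => m _.
rewrite -(ge0_integral_heis_shift m.1.1%:~R m.1.2%:~R m.2%:~R (mK m))//.
rewrite [RHS]integral_mkcond; apply: eq_integral => p _.
rewrite /K /back heis_shift_inv /patch indicE.
by case: ifP => _; rewrite (mul1e, mul0e).
Qed.

Lemma integrable_posneg f : mu3.-integrable setT (EFin \o f) ->
  [/\ measurable_fun setT f,
  (\int[mu3]_p (Num.max (f p) 0)%:E < +oo)%E &
  (\int[mu3]_p (Num.max (- f p) 0)%:E < +oo)%E].
Proof.
move=> /integrableP[mf If]; have mf' : measurable_fun setT f by exact/measurable_EFinP.
split=> //; (apply: le_lt_trans If; apply: ge0_le_integral => //=).
- by move=> p _; rewrite lee_fin maxr0_ge0.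
- by apply/measurable_EFinP; apply: measurable_maxr.
- by apply/measurable_EFinP; exact: measurableT_comp.
- by move=> p _; rewrite lee_fin ge_max normr_ge0 ler_norm.
- by move=> p _; rewrite lee_fin maxr0_ge0.
- by apply/measurable_EFinP; apply: measurable_maxr => //; exact: measurable_funN.
- by apply/measurable_EFinP; exact: measurableT_comp.
- by move=> p _; rewrite lee_fin ge_max normr_ge0 -normrN ler_norm.
Qed.

End RealIntegrals.

Section ComplexIntegrals.
Context {R : realType}.
Local Notation mu := (@lebesgue_measure R).
Local Notation T1 := (measurableTypeR R).
Local Notation T3 := (T1 * T1 * T1)%type.
Local Notation mu3 := (@leb2 R \x mu)%E.
Implicit Types (f : T3 -> T1) (F G : R * R * R -> R[i]).

Lemma Rintegral_posneg f : mu3.-integrable setT (EFin \o f) ->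
  Rintegral mu3 setT f = fine (\int[mu3]_p (Num.max (f p) 0)%:E)
    - fine (\int[mu3]_p (Num.max (- f p) 0)%:E).
Proof.
move=> /integrable_posneg[mf P N].
have mp : measurable_fun setT (fun p => Num.max (f p) 0) by exact: measurable_maxr.
have mn : measurable_fun setT (fun p => Num.max (- f p) 0).
  by apply: measurable_maxr => //; exact: measurable_funN.
have ip : mu3.-integrable setT (EFin \o (fun p => Num.max (f p) 0)).
  apply/integrableP; split; first exact/measurable_EFinP.
  by under eq_integral do rewrite /= ger0_norm ?maxr0_ge0//.
have im : mu3.-integrable setT (EFin \o (fun p => Num.max (- f p) 0)).
  apply/integrableP; split; first exact/measurable_EFinP.
  by under eq_integral do rewrite /= ger0_norm ?maxr0_ge0//.
rewrite -[LHS]/(Rintegral mu3 setT f).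
transitivity (Rintegral mu3 setT (fun p => Num.max (f p) 0 - Num.max (- f p) 0)).
  by apply: eq_Rintegral => p _; exact: maxr0_diff.
exact: (RintegralB measurableT ip im).
Qed.

Lemma Rintegral_aff3 b1 b2 b3 a1 a2 (t : T1 * T1 -> T1) f :
  measurable_fun setT t -> mu3.-integrable setT (EFin \o f) ->
  mu3.-integrable setT (EFin \o (f \o aff3 b1 b2 b3 a1 a2 t)) /\
  Rintegral mu3 setT (f \o aff3 b1 b2 b3 a1 a2 t) = Rintegral mu3 setT f.
Proof.
move=> mt If; have [mf P N] := integrable_posneg If.
pose phi := aff3 b1 b2 b3 a1 a2 t.
have mphi : measurable_fun setT phi by exact: measurable_aff3.
have E (G : T3 -> \bar R) : measurable_fun setT G -> (forall p, (0 <= G p)%E) ->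
    (\int[mu3]_p G (phi p) = \int[mu3]_p G p)%E.
  exact: ge0_integral_aff3.
have Ifphi : mu3.-integrable setT (EFin \o (f \o phi)).
  apply/integrableP; split.
    by apply/measurable_EFinP; exact: measurableT_comp.
  rewrite (E (fun p => `|(EFin \o f) p|%E))//.
  - by have /integrableP[] := If.
  - by apply: measurableT_comp => //; exact/measurable_EFinP.
split=> //; rewrite !Rintegral_posneg//.
by rewrite (E (fun p => (Num.max (f p) 0)%:E)) ?(E (fun p => (Num.max (- f p) 0)%:E))//;
 try (by move=> p; rewrite lee_fin maxr0_ge0);
 apply/measurable_EFinP; apply: measurable_maxr => //; exact: measurable_funN.
Qed.

Lemma rsum_tiling f : mu3.-integrable setT (EFin \o f) ->
  rsummable [set: int * int * int]
    (fun m => Rintegral mu3 (unit_cube R) (f \o lattice_shift m)) /\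
  rsum [set: int * int * int]
    (fun m => Rintegral mu3 (unit_cube R) (f \o lattice_shift m)) = Rintegral mu3 setT f.
Proof.
move=> If; have [mf P N] := integrable_posneg If.
have mC := @measurable_unit_cube R.
pose u p := Num.max (f p) 0; pose v p := Num.max (- f p) 0.
have key (g : T3 -> T1) : measurable_fun setT g -> (forall p, 0 <= g p) ->
    (\int[mu3]_p (g p)%:E < +oo)%E ->
    [/\ forall m, mu3.-integrable (unit_cube R) (EFin \o (g \o lattice_shift m)),
      forall m, 0 <= Rintegral mu3 (unit_cube R) (g \o lattice_shift m),
      (\esum_(m in [set: int * int * int])
        (Rintegral mu3 (unit_cube R) (g \o lattice_shift m))%:E < +oo)%E &
      (\esum_(m in [set: int * int * int])
        (Rintegral mu3 (unit_cube R) (g \o lattice_shift m))%:E = \int[mu3]_p (g p)%:E)%E].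
  move=> mg g0 Ig.
  have T : (\int[mu3]_p (g p)%:E = \esum_(m in [set: int * int * int])
     \int[mu3]_(p in unit_cube R) (g (lattice_shift m p))%:E)%E.
    apply: (@ge0_tiling R (EFin \o g)); first exact/measurable_EFinP.
    by move=> p; rewrite lee_fin.
  have fin m : (\int[mu3]_(p in unit_cube R) (g (lattice_shift m p))%:E < +oo)%E.
    apply: le_lt_trans Ig; rewrite T.
    rewrite (esumID [set m])//; last first.
      by move=> i _; apply: integral_ge0 => p _; rewrite lee_fin.
    rewrite setTI esum_set1; last by apply: integral_ge0 => p _; rewrite lee_fin.
    apply: leeDl; apply: esum_ge0 => i _.
    by apply: integral_ge0 => p _; rewrite lee_fin.
  have E : \esum_(m in [set: int * int * int])
        (Rintegral mu3 (unit_cube R) (g \o lattice_shift m))%:E = (\int[mu3]_p (g p)%:E)%E.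
    rewrite T; apply: eq_esum => m _; rewrite /Rintegral fineK//.
    rewrite ge0_fin_numE ?fin//.
    by apply: integral_ge0 => p _; rewrite lee_fin; exact: g0.
  split=> //; last by rewrite E.
    move=> m; apply/integrableP; split.
      apply/measurable_EFinP; apply: measurable_funS (measurableT_comp mg (measurable_heis_shift _ _ _)) => //.
    by under eq_integral do rewrite /= ger0_norm//.
  by move=> m; apply: Rintegral_ge0 => p _; exact: g0.
have mu_ : measurable_fun setT u by exact: measurable_maxr.
have mv_ : measurable_fun setT v.
  by apply: measurable_maxr => //; exact: measurable_funN.
have [U1 U2 U3 U4] := key u mu_ (fun p => maxr0_ge0 _) P.
have [V1 V2 V3 V4] := key v mv_ (fun p => maxr0_ge0 _) N.
have fE m : Rintegral mu3 (unit_cube R) (f \o lattice_shift m) =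
    Rintegral mu3 (unit_cube R) (u \o lattice_shift m) -
    Rintegral mu3 (unit_cube R) (v \o lattice_shift m).
  etransitivity; last exact: (RintegralB mC (U1 m) (V1 m)).
  by apply: eq_Rintegral => p _; exact: maxr0_diff.
split.
  apply: (@rsummable_le _ _ _ _ (fun m =>
    Rintegral mu3 (unit_cube R) (u \o lattice_shift m) +
    Rintegral mu3 (unit_cube R) (v \o lattice_shift m))).
    move=> m _; rewrite fE (le_trans (ler_normB _ _))// !ger0_norm//.
  by apply: rsummableD; apply/rsummable_ge0.
rewrite (rsum_diff _ _ U3 V3)//.
by rewrite U4 V4 Rintegral_posneg.
Qed.

Lemma cint_aff3 b1 b2 b3 a1 a2 (t : T1 * T1 -> T1) F :
  measurable_fun setT t -> cintegrable setT F ->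
  cintegrable setT (F \o aff3 b1 b2 b3 a1 a2 t) /\
  cint setT (F \o aff3 b1 b2 b3 a1 a2 t) = cint setT F.
Proof.
move=> mt [I1 I2].
have [J1 E1] := Rintegral_aff3 b1 b2 b3 a1 a2 mt I1.
have [J2 E2] := Rintegral_aff3 b1 b2 b3 a1 a2 mt I2.
split; first by split.
by apply: eq_ReIm; [exact: E1|exact: E2].
Qed.

Lemma csum_tiling F : cintegrable setT F ->
  csummable [set: int * int * int] (fun m => cint (unit_cube R) (F \o lattice_shift m)) /\
  csum [set: int * int * int] (fun m => cint (unit_cube R) (F \o lattice_shift m)) =
  cint setT F.
Proof.
move=> [I1 I2]; have [S1 E1] := rsum_tiling I1; have [S2 E2] := rsum_tiling I2.
split; first by apply/csummableP; split; [exact: S1|exact: S2].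
by apply: eq_ReIm; [exact: E1|exact: E2].
Qed.

Definition cmeasurable F : Prop :=
  measurable_fun setT (@complex.Re R \o F : T3 -> T1) /\
  measurable_fun setT (@complex.Im R \o F : T3 -> T1).

Lemma cmeasurableM F G : cmeasurable F -> cmeasurable G ->
  cmeasurable (fun p => F p * G p).
Proof.
move=> [F1 F2] [G1 G2]; split.
  rewrite (_ : _ \o _ = fun p => complex.Re (F p) * complex.Re (G p) -
    complex.Im (F p) * complex.Im (G p)); last by apply/funext => p; exact: ReM.
  by apply: measurable_funB; exact: measurable_funM.
rewrite (_ : _ \o _ = fun p => complex.Re (F p) * complex.Im (G p) +
  complex.Im (F p) * complex.Re (G p)); last by apply/funext => p; exact: ImM.
by apply: measurable_funD; exact: measurable_funM.
Qed.

Lemma cmeasurable_comp F (phi : T3 -> T3) : measurable_fun setT phi ->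
  cmeasurable F -> cmeasurable (F \o phi).
Proof.
by move=> mphi [F1 F2]; split;
  [exact: (measurableT_comp F1 mphi)|exact: (measurableT_comp F2 mphi)].
Qed.

Lemma cmeasurable_cst (c : R[i]) : cmeasurable (fun=> c).
Proof. by split; exact: measurable_cst. Qed.

Lemma cintegrable_le F (g : T3 -> T1) : cmeasurable F ->
  (forall p, nrm (F p) <= g p) -> mu3.-integrable setT (EFin \o g) ->
  cintegrable setT F.
Proof.
move=> [F1 F2] Fg Ig.
have H (h : T3 -> T1) : measurable_fun setT h -> (forall p, `|h p| <= nrm (F p)) ->
    mu3.-integrable setT (EFin \o h).
  move=> mh hF; apply: (le_integrable _ _ _ Ig) => //; first exact/measurable_EFinP.
  move=> p _ /=; rewrite lee_fin (le_trans (hF p))// (le_trans (Fg p))//.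
  exact: ler_norm.
by split; apply: H => // p; [exact: ler_Re_nrm|exact: ler_Im_nrm].
Qed.

Lemma cintegrable_measurable F : cintegrable setT F -> cmeasurable F.
Proof.
by move=> [/integrableP[/measurable_EFinP F1 _] /integrableP[/measurable_EFinP F2 _]].
Qed.

Lemma cintZ (c : R[i]) (E : set (R * R * R)) F : measurable (E : set T3) ->
  cintegrable E F ->
  cintegrable E (fun p => c * F p) /\ cint E (fun p => c * F p) = c * cint E F.
Proof.
move=> mE [I1 I2].
have Z (a : R) (f : T3 -> T1) : mu3.-integrable E (EFin \o f) ->
    mu3.-integrable E (EFin \o (fun p => a * f p)).
  move=> If; apply: (eq_integrable mE _ _ _ (integrableZl mE a If)) => p _.
  by rewrite /= EFinM.
pose re p := complex.Re (F p); pose im p := complex.Im (F p).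
have [a1 a2 a3 a4] : [/\ mu3.-integrable E (EFin \o (fun p => complex.Re c * re p)),
  mu3.-integrable E (EFin \o (fun p => complex.Im c * im p)),
  mu3.-integrable E (EFin \o (fun p => complex.Re c * im p)) &
  mu3.-integrable E (EFin \o (fun p => complex.Im c * re p))].
  by split; apply: Z.
have re_E : @complex.Re R \o (fun p => c * F p) =
    (fun p => complex.Re c * re p - complex.Im c * im p).
  by apply/funext => p; exact: ReM.
have im_E : @complex.Im R \o (fun p => c * F p) =
    (fun p => complex.Re c * im p + complex.Im c * re p).
  by apply/funext => p; exact: ImM.
split.
  split; rewrite ?re_E ?im_E.
    exact: (integrableB mE a1 a2).
  exact: (integrableD mE a3 a4).
apply: eq_ReIm; rewrite /= ?re_E ?im_E.
  rewrite ReM /=; etransitivity; first exact: (RintegralB mE a1 a2).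
  by congr (_ - _); exact: RintegralZl.
rewrite ImM /=; etransitivity; first exact: (RintegralD mE a3 a4).
by congr (_ + _); exact: RintegralZl.
Qed.

Lemma csum_exchange (I : choiceType) (D : set I) (b : I -> R)
    (F : I -> R * R * R -> R[i]) : countable D -> rsummable D b ->
  (forall i, D i -> cmeasurable (F i)) ->
  (forall i p, D i -> unit_cube R p -> nrm (F i p) <= b i) ->
  cintegrable (unit_cube R) (fun p => csum D (F^~ p)) /\
  cint (unit_cube R) (fun p => csum D (F^~ p)) =
  csum D (fun i => cint (unit_cube R) (F i)).
Proof.
move=> cD sb mF Fb.
have [I1 E1] := @rsum_exchange R I D cD b sb (fun i => @complex.Re R \o F i)
  (fun i Di => proj1 (mF i Di))
  (fun i p Di Cp => le_trans (ler_Re_nrm _) (Fb i p Di Cp)).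
have [I2 E2] := @rsum_exchange R I D cD b sb (fun i => @complex.Im R \o F i)
  (fun i Di => proj2 (mF i Di))
  (fun i p Di Cp => le_trans (ler_Im_nrm _) (Fb i p Di Cp)).
split; first by split; [exact: I1|exact: I2].
by apply: eq_ReIm; [exact: E1|exact: E2].
Qed.

Lemma cintegrable_cube F (b : R) : cmeasurable F ->
  (forall p, unit_cube R p -> nrm (F p) <= b) ->
  cintegrable (unit_cube R) F /\ nrm (cint (unit_cube R) F) <= 2 * b.
Proof.
move=> [F1 F2] Fb.
have [I1 B1] := bounded_integrable_cube F1
  (fun p Cp => le_trans (ler_Re_nrm _) (Fb p Cp)).
have [I2 B2] := bounded_integrable_cube F2
  (fun p Cp => le_trans (ler_Im_nrm _) (Fb p Cp)).
split; first by split; [exact: I1|exact: I2].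
by rewrite (le_trans (ler_nrm_ReIm _))// mulr2n mulrDl mul1r lerD.
Qed.

Lemma eq_cint (E : set (R * R * R)) F G : {in E, F =1 G} -> cint E F = cint E G.
Proof.
by move=> FG; rewrite /cint; congr (_ +i* _)%C; apply: eq_Rintegral => p Ep /=;
  rewrite FG.
Qed.

End ComplexIntegrals.

(** * The cocycle and the sections on the big cell *)

Section Mat3.
Variable T : comNzRingType.
Implicit Types (a b c d e f g h i : T) (M : 'M[T]_3).

Lemma mat3E a b c d e f g h i : let M := mat3 a b c d e f g h i in
  ((M i0 i0 = a) * (M i0 i1 = b) * (M i0 i2 = c) *
   (M i1 i0 = d) * (M i1 i1 = e) * (M i1 i2 = f) *
   (M i2 i0 = g) * (M i2 i1 = h) * (M i2 i2 = i))%type.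
Proof. by rewrite /= !mxE. Qed.

Lemma mat3_eta M : M = mat3 (M i0 i0) (M i0 i1) (M i0 i2)
  (M i1 i0) (M i1 i1) (M i1 i2) (M i2 i0) (M i2 i1) (M i2 i2).
Proof.
apply/matrixP => r k; rewrite mxE.
by case: r => [[|[|[|r]]] hr] //; case: k => [[|[|[|k]]] hk] //=;
  congr (M _ _); apply: val_inj.
Qed.

Lemma mat3_mul a b c d e f g h i a' b' c' d' e' f' g' h' i' :
  mat3 a b c d e f g h i *m mat3 a' b' c' d' e' f' g' h' i' =
  mat3 (a * a' + b * d' + c * g') (a * b' + b * e' + c * h') (a * c' + b * f' + c * i')
       (d * a' + e * d' + f * g') (d * b' + e * e' + f * h') (d * c' + e * f' + f * i')
       (g * a' + h * d' + i * g') (g * b' + h * e' + i * h') (g * c' + h * f' + i * i').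
Proof.
apply/matrixP => r k; rewrite !mxE !big_ord_recl big_ord0 !mxE /= addr0 addrA.
by case: r => [[|[|[|r]]] hr] //; case: k => [[|[|[|k]]] hk].
Qed.

Lemma det_mat3 a b c d e f g h i : \det (mat3 a b c d e f g h i) =
  a * (e * i - f * h) - b * (d * i - f * g) + c * (d * h - e * g).
Proof.
rewrite (expand_det_row _ i0) !big_ord_recl big_ord0 /cofactor.
rewrite !(expand_det_row _ (ord0 : 'I_2)) !big_ord_recl !big_ord0 /cofactor.
rewrite !det_mx11 !mxE /= !addr0 /bump /=.
by rewrite !(expr0, expr1, exprS, addn0, addn1); ring.
Qed.

Lemma mat3_1 : 1%:M = mat3 1 0 0 0 1 0 0 0 1 :> 'M[T]_3.
Proof.
apply/matrixP => r k; rewrite !mxE.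
by case: r => [[|[|[|r]]] hr] //; case: k => [[|[|[|k]]] hk].
Qed.

Lemma w_longE : w_long = mat3 0 0 1 0 (-1) 0 1 0 0 :> 'M[T]_3.
Proof. by rewrite /w_long /w_alpha1 /w_alpha2 !mat3_mul; congr mat3; ring. Qed.

Lemma w_longK : w_long *m w_long = 1%:M :> 'M[T]_3.
Proof. by rewrite w_longE mat3_mul mat3_1; congr mat3; ring. Qed.

Lemma mul_nmx x y z x' y' z' :
  nmx x y z *m nmx x' y' z' = nmx (x + x') (y + y') (z + z' + x * y') :> 'M[T]_3.
Proof. by rewrite /nmx mat3_mul; congr mat3; ring. Qed.

Lemma nmx0 : nmx 0 0 0 = 1%:M :> 'M[T]_3.
Proof. by rewrite mat3_1. Qed.

Lemma det_nmx x y z : \det (nmx x y z : 'M[T]_3) = 1.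
Proof. by rewrite det_mat3; ring. Qed.

Lemma det_w_long : \det (w_long : 'M[T]_3) = 1.
Proof. by rewrite w_longE det_mat3; ring. Qed.

End Mat3.

Lemma mulmx1_inv (T : comUnitRingType) n (A B : 'M[T]_n) : A *m B = 1%:M -> invmx A = B.
Proof.
by move=> AB; have [uA _] := mulmx1_unit AB; rewrite -[RHS](mulKmx uA) AB mulmx1.
Qed.

Lemma inv_nmx (T : comUnitRingType) (x y z : T) :
  invmx (nmx x y z) = nmx (- x) (- y) (x * y - z).
Proof.
by apply: mulmx1_inv; rewrite mul_nmx -nmx0; congr nmx; ring.
Qed.

Lemma inv_w_long (T : comUnitRingType) : invmx w_long = w_long :> 'M[T]_3.
Proof. exact/mulmx1_inv/w_longK. Qed.

(** * Values of the cocycle on the Borel subgroup and on the big cell *)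

Section Cocycle.
Context {R : realType}.
Implicit Types (a b c d e f g h i : R) (w : 'M[R]_3).

Lemma X3_mat3 a b c d e f g h i :
  X3 (mat3 a b c d e f g h i : 'M[R]_3) = first_nz g h i.
Proof. by rewrite /X3 /pA1 /pB1 /pC1 !mat3E !opprK. Qed.

Lemma X2_mat3 a b c d e f g h i : X2 (mat3 a b c d e f g h i : 'M[R]_3) =
  first_nz (d * h - e * g) (d * i - f * g) (e * i - f * h).
Proof. by rewrite /X2 /pA2 /pB2 /pC2 !mat3E !opprK. Qed.

Lemma first_nz1 a b c : a != 0 -> first_nz a b c = a.
Proof. by rewrite /first_nz => ->. Qed.

Lemma first_nz2 b c : b != 0 -> first_nz 0 b c = b.
Proof. by rewrite /first_nz eqxx => ->. Qed.

Lemma first_nz3 c : first_nz 0 0 c = c.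
Proof. by rewrite /first_nz eqxx. Qed.

Lemma sgnM a b : a != 0 -> b != 0 -> (a * b < 0) = (a < 0) (+) (b < 0).
Proof.
move=> a0 b0; move: (a0) (b0); rewrite !neq_lt => /orP[an|ap] /orP[bn|bp].
- by rewrite an bn ltNge ltW// nmulr_rgt0.
- by rewrite an [b < 0]ltNge (ltW bp) nmulr_rlt0.
- by rewrite bn [a < 0]ltNge (ltW ap) pmulr_rlt0.
- by rewrite [a < 0]ltNge (ltW ap) [b < 0]ltNge (ltW bp) ltNge ltW// mulr_gt0.
Qed.

Lemma sgnV a : (a^-1 < 0) = (a < 0).
Proof. exact: invr_lt0. Qed.

Lemma sgnN a : a != 0 -> (- a < 0) = ~~ (a < 0).
Proof. by move=> a0; rewrite oppr_lt0 lt_neqAle eq_sym a0 leNgt. Qed.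

(** The three Hilbert symbols in the formula for a simple reflection [w], for matrices of
    determinant 1: [p2'], [p3'] are the signs of [X2], [X3] at [w *m h], and [p2], [p3] those at
    [h]. *)
Definition simple_sign (p2' p3' p2 p3 : bool) : bool :=
  ((p2' (+) p2) && ~~ (p2 (+) p3)) (+) ((p2' (+) p2) && ~~ p3)
  (+) ((p2' (+) p3' (+) p2 (+) p3) && ~~ p3).

Lemma sigma_simpleE w (h : 'M[R]_3) : \det w = 1 -> \det h = 1 ->
  X2 (w *m h) != 0 -> X3 (w *m h) != 0 -> X2 h != 0 -> X3 h != 0 ->
  sigma_simple w h =
  simple_sign (X2 (w *m h) < 0) (X3 (w *m h) < 0) (X2 h < 0) (X3 h < 0).
Proof.
move=> dw dh n1 n2 n3 n4.
rewrite /sigma_simple /sigma_diag /Delta /tmx mat3_mul !mxE /= /hilbert.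
rewrite /X1 det_mulmx dw dh !mul1r ?(mulr0, mul0r, addr0, add0r).
rewrite !sgnN ?mulf_neq0 ?invr_neq0// !(sgnM, sgnV)
  ?mulf_neq0 ?invr_neq0// /simple_sign.
by case: (X2 (w *m h) < 0); case: (X3 (w *m h) < 0); case: (X2 h < 0); case: (X3 h < 0).
Qed.

Definition long_sign (h : 'M[R]_3) : bool :=
  sigma_word [:: w_alpha1; w_alpha2; w_alpha1] h.

(** The word is followed from right to left: [h1], [h2], [h3] are the images of [h] under its
    successive suffixes, and only the signs of [X2], [X3] at these matrices enter. *)
Lemma long_signE (h : 'M[R]_3) : \det h = 1 ->
  let h1 := w_alpha1 *m h in let h2 := w_alpha2 *m h1 in let h3 := w_long *m h in
  X2 h != 0 -> X3 h != 0 -> X2 h1 != 0 -> X3 h1 != 0 ->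
  X2 h2 != 0 -> X3 h2 != 0 -> X2 h3 != 0 -> X3 h3 != 0 ->
  long_sign h = simple_sign (X2 h3 < 0) (X3 h3 < 0) (X2 h2 < 0) (X3 h2 < 0)
    (+) simple_sign (X2 h2 < 0) (X3 h2 < 0) (X2 h1 < 0) (X3 h1 < 0)
    (+) simple_sign (X2 h1 < 0) (X3 h1 < 0) (X2 h < 0) (X3 h < 0).
Proof.
move=> dh h1 h2 h3 a1 a2 a3 a4 a5 a6 a7 a8.
have d1 : \det (w_alpha1 : 'M[R]_3) = 1 by rewrite det_mat3; ring.
have d2 : \det (w_alpha2 : 'M[R]_3) = 1 by rewrite det_mat3; ring.
have e1 : wprod [::] *m h = h by rewrite /= mul1mx.
have e2 : wprod [:: w_alpha1] *m h = h1 by rewrite /= mulmx1.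
have e3 : wprod [:: w_alpha2; w_alpha1] *m h = h2 by rewrite /= mulmx1 -mulmxA.
have e4 : h3 = w_alpha1 *m h2 by rewrite /h3 /w_long -!mulmxA.
rewrite -[long_sign h]/(sigma_simple w_alpha1 (wprod [:: w_alpha2; w_alpha1] *m h)
  (+) (sigma_simple w_alpha2 (wprod [:: w_alpha1] *m h)
  (+) (sigma_simple w_alpha1 (wprod [::] *m h) (+) false))).
rewrite e1 e2 e3 addbF !sigma_simpleE -?e4 ?det_mulmx ?d1 ?d2 ?dh ?mul1r//.
by rewrite addbA.
Qed.

End Cocycle.

Section Bruhat.
Context {R : realType}.
Implicit Types (a b c d e f g h i x y z t : R).

Lemma det_tmx a b c : \det (tmx a b c : 'M[R]_3) = a * b * c.
Proof. by rewrite det_mat3; ring. Qed.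

Lemma is_diag_tmx a b c : is_diag_mx (tmx a b c : 'M[R]_3).
Proof.
apply/is_diag_mxP => r k; rewrite mxE.
by case: r => [[|[|[|r]]] hr] //; case: k => [[|[|[|k]]] hk].
Qed.

Lemma diag_tmxE (a : 'M[R]_3) : is_diag_mx a -> a = tmx (a i0 i0) (a i1 i1) (a i2 i2).
Proof.
move=> /is_diag_mxP H; rewrite {1}[a]mat3_eta (H i0 i1)// (H i0 i2)// (H i1 i0)//.
by rewrite (H i1 i2)// (H i2 i0)// (H i2 i1).
Qed.

Lemma unip_nmx x y z : unip (nmx x y z : 'M[R]_3).
Proof. by exists x, y, z. Qed.

Definition upper_mat3 (x y z b1 b2 b3 : R) (w n' : 'M[R]_3) : 'M[R]_3 :=
  nmx x y z *m tmx b1 b2 b3 *m w *m n'.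

Lemma upper_mat3E x y z b1 b2 b3 a b c d e f g h i x' y' z' :
  upper_mat3 x y z b1 b2 b3 (mat3 a b c d e f g h i) (nmx x' y' z') =
  let r1 := b1 * a + x * b2 * d + z * b3 * g in
  let r2 := b1 * b + x * b2 * e + z * b3 * h in
  let r3 := b1 * c + x * b2 * f + z * b3 * i in
  let s1 := b2 * d + y * b3 * g in
  let s2 := b2 * e + y * b3 * h in
  let s3 := b2 * f + y * b3 * i in
  mat3 r1 (r1 * x' + r2) (r1 * z' + r2 * y' + r3)
       s1 (s1 * x' + s2) (s1 * z' + s2 * y' + s3)
       (b3 * g) (b3 * (g * x' + h)) (b3 * (g * z' + h * y' + i)).
Proof. by rewrite /upper_mat3 !mat3_mul; congr mat3; ring. Qed.

Lemma mat3_inj a b c d e f g h i a' b' c' d' e' f' g' h' i' :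
  mat3 a b c d e f g h i = mat3 a' b' c' d' e' f' g' h' i' :> 'M[R]_3 ->
  ([/\ a = a', b = b' & c = c'] * [/\ d = d', e = e' & f = f'] *
   [/\ g = g', h = h' & i = i'])%type.
Proof.
move=> E; have H (r k : 'I_3) := congr1 (fun M : 'M[R]_3 => M r k) E.
by split; [split|]; split; [have := H i0 i0|have := H i0 i1|have := H i0 i2
  |have := H i1 i0|have := H i1 i1|have := H i1 i2
  |have := H i2 i0|have := H i2 i1|have := H i2 i2]; rewrite !mat3E.
Qed.

Lemma wprodE : ((wprod [::] = mat3 1 0 0 0 1 0 0 0 1 :> 'M[R]_3) *
  (wprod [:: w_alpha1] = mat3 0 (-1) 0 1 0 0 0 0 1 :> 'M[R]_3) *
  (wprod [:: w_alpha2] = mat3 1 0 0 0 0 (-1) 0 1 0 :> 'M[R]_3) *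
  (wprod [:: w_alpha1; w_alpha2] = mat3 0 0 1 1 0 0 0 1 0 :> 'M[R]_3) *
  (wprod [:: w_alpha2; w_alpha1] = mat3 0 (-1) 0 0 0 (-1) 1 0 0 :> 'M[R]_3) *
  (wprod [:: w_alpha1; w_alpha2; w_alpha1] = w_long :> 'M[R]_3))%type.
Proof.
rewrite /wprod /= !mulmx1 mat3_1 /w_long /w_alpha1 /w_alpha2 !mat3_mul.
by split; [split; [split; [split; [split|]|]|]|]; congr mat3; ring.
Qed.

Lemma reduced_wordsP (P : seq 'M[R]_3 -> Prop) :
  P [::] -> P [:: w_alpha1] -> P [:: w_alpha2] -> P [:: w_alpha1; w_alpha2] ->
  P [:: w_alpha2; w_alpha1] -> P [:: w_alpha1; w_alpha2; w_alpha1] ->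
  forall ws, ws \in reduced_words R -> P ws.
Proof.
move=> p1 p2 p3 p4 p5 p6 ws; rewrite !inE.
by do 5 (case/orP => [/eqP-> //|]); move=> /eqP->.
Qed.

Lemma wprod_diag (ws : seq 'M[R]_3) : ws \in reduced_words R -> \det (wprod ws) = 1.
Proof.
by move: ws; apply: reduced_wordsP; rewrite wprodE ?w_longE det_mat3; ring.
Qed.

Lemma bruhat_coord (n a n' g : 'M[R]_3) ws : bruhat g (n, a, ws, n') ->
  \det g = 1 -> exists x y z b1 b2 b3 x' y' z',
  [/\ [/\ n' = nmx x' y' z', a = tmx b1 b2 b3 & ws \in reduced_words R],
   [/\ b1 != 0, b2 != 0 & b3 != 0] &
   g = upper_mat3 x y z b1 b2 b3 (wprod ws) (nmx x' y' z')].
Proof.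
move=> [[x [y [z ->]]] /diag_tmxE aE wsr [x' [y' [z' ->]]] ->]; rewrite aE => dg.
exists x, y, z, (a i0 i0), (a i1 i1), (a i2 i2), x', y', z'; split => //.
have : a i0 i0 * a i1 i1 * a i2 i2 = 1.
  by move: dg; rewrite !det_mulmx !det_nmx det_tmx wprod_diag// !mulr1 mul1r.
move=> p; have : a i0 i0 * a i1 i1 * a i2 i2 != 0 by rewrite p oner_neq0.
by rewrite !mulf_eq0 !negb_or -andbA => /and3P[].
Qed.

Lemma det_upper x y z b1 b2 b3 (w : 'M[R]_3) x' y' z' : \det w = 1 ->
  \det (upper_mat3 x y z b1 b2 b3 w (nmx x' y' z')) = b1 * b2 * b3.
Proof. by move=> dw; rewrite !det_mulmx !det_nmx det_tmx dw !mulr1 mul1r. Qed.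

Lemma bruhat_ex (g n a n' : 'M[R]_3) ws : bruhat g (n, a, ws, n') ->
  bruhat g (xget (1%:M, 1%:M, [::], 1%:M) (bruhat g)).
Proof. by move=> H; apply: xgetPex; exists (n, a, ws, n'). Qed.

(** The decomposition picked by [xget] may differ from the given one, so all six cells are compared
    entrywise. Five of them force a diagonal entry to vanish; in the trivial cell the diagonal part
    is determined. The right factor is not, but [Delta] is invariant under left multiplication by
    unipotent matrices. *)
Lemma sigma_torus x y z a b c (h : 'M[R]_3) : a * b * c = 1 ->
  sigma (nmx x y z *m tmx a b c) h = sigma_diag (tmx a b c) (Delta h).
Proof.
move=> abc; set g := nmx x y z *m tmx a b c.
have gE : g = upper_mat3 x y z a b c (wprod [::]) (nmx 0 0 0).
  by rewrite /upper_mat3 nmx0 !mulmx1.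
have Hb : bruhat g (nmx x y z, tmx a b c, [::], nmx 0 0 0).
  by split; [exact: unip_nmx|exact: is_diag_tmx|rewrite inE|exact: unip_nmx|].
have dg : \det g = 1 by rewrite det_mulmx det_nmx det_tmx mul1r.
have [a0 b0 c0] : [/\ a != 0, b != 0 & c != 0].
  have : a * b * c != 0 by rewrite abc oner_neq0.
  by rewrite !mulf_eq0 !negb_or -andbA => /and3P[].
rewrite /sigma; have := bruhat_ex Hb.
case: (xget _ _) => [[[n1 a1] ws] n'] /bruhat_coord/(_ dg).
move=> [p [q [r [b1 [b2 [b3 [x' [y' [z' [[-> -> wsr] [nb1 nb2 nb3]]]]]]]]]]].
rewrite gE wprodE upper_mat3E /=; move: ws wsr; apply: reduced_wordsP;
  rewrite ?wprodE ?w_longE upper_mat3E => /mat3_inj[[[E00 E01 E02] [E10 E11 E12]] [E20 E21 E22]].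
- have e1 : b1 = a by move: E00; lra.
  have e2 : b2 = b by move: E11; rewrite ?(mulr0, mulr1, addr0, mul0r, add0r).
  have e3 : b3 = c by move: E22; rewrite ?(mulr0, mulr1, addr0, mul0r, add0r).
  rewrite e1 e2 e3 /= -mat3_1 mul1mx addbF; congr sigma_diag.
  rewrite /Delta; have [d1 d2] : X2 (nmx x' y' z' *m h) = X2 h /\ X3 (nmx x' y' z' *m h) = X3 h.
    rewrite [h]mat3_eta /nmx mat3_mul !X2_mat3 !X3_mat3.
    by split; congr first_nz; ring.
  by rewrite d1 d2 /X1 det_mulmx det_nmx mul1r.
- by exfalso; move/eqP: nb2; apply; move: E10; lra.
- by exfalso; move/eqP: nb3; apply; move: E21; lra.
- by exfalso; move/eqP: nb3; apply; move: E21; lra.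
- by exfalso; move/eqP: nb3; apply; move: E20; lra.
- by exfalso; move/eqP: nb3; apply; move: E20; lra.
Qed.

(** On the big cell the diagonal part and the right unipotent part are both functions of the matrix,
    so the choice made in [sigma] has no freedom that matters. *)
Lemma sigma_long x y z a b c x' y' z' (h : 'M[R]_3) : a * b * c = 1 ->
  sigma (nmx x y z *m tmx a b c *m w_long *m nmx x' y' z') h =
  sigma_diag (tmx a b c) (Delta (w_long *m (nmx x' y' z' *m h)))
  (+) long_sign (nmx x' y' z' *m h).
Proof.
move=> abc; set g := _ *m nmx x' y' z'.
have gE : g = upper_mat3 x y z a b c w_long (nmx x' y' z') by [].
have Hb : bruhat g (nmx x y z, tmx a b c, [:: w_alpha1; w_alpha2; w_alpha1], nmx x' y' z').
  split; [exact: unip_nmx|exact: is_diag_tmx|by rewrite !inE eqxx !orbT|exact: unip_nmx|].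
  by rewrite wprodE.
have dg : \det g = 1 by rewrite gE det_upper ?det_w_long.
have [a0 b0 c0] : [/\ a != 0, b != 0 & c != 0].
  have : a * b * c != 0 by rewrite abc oner_neq0.
  by rewrite !mulf_eq0 !negb_or -andbA => /and3P[].
rewrite /sigma; have := bruhat_ex Hb.
case: (xget _ _) => [[[n1 a1] ws] n'] /bruhat_coord/(_ dg).
move=> [p [q [r [b1 [b2 [b3 [u [v [w [[-> -> wsr] [nb1 nb2 nb3]]]]]]]]]]].
rewrite gE; move: ws wsr; apply: reduced_wordsP;
  rewrite ?wprodE ?w_longE !upper_mat3E => /mat3_inj[[[E00 E01 E02] [E10 E11 E12]] [E20 E21 E22]].
- by exfalso; move/eqP: c0; apply; move: E20; lra.
- by exfalso; move/eqP: c0; apply; move: E20; lra.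
- by exfalso; move/eqP: c0; apply; move: E20; lra.
- by exfalso; move/eqP: c0; apply; move: E20; lra.
(* In this cell the lower left entry is nonzero as well. What vanishes is the minor of the two lower
   rows and the two left columns, seen in [E11] once the bottom row and the left column have been
   compared. *)
- have e3 : b3 = c by lra.
  rewrite e3 in nb3 E10 E11 E12 E20 E21 E22.
  have eu : x' = u by apply: (mulfI c0); lra.
  have eq : y = q by apply: (mulIf c0); lra.
  by exfalso; move/eqP: b0; apply; move: E11; rewrite eu eq; lra.
- have e3 : b3 = c by lra.
  rewrite e3 in nb3 E00 E01 E02 E10 E11 E12 E20 E21 E22 *.
  have eu : x' = u by apply: (mulfI c0); lra.
  have ew : z' = w by apply: (mulfI c0); lra.
  have eq : y = q by apply: (mulIf c0); lra.
  have er : z = r by apply: (mulIf c0); lra.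
  rewrite eu ew eq er in E00 E01 E02 E10 E11 E12 *.
  have e2 : b2 = b by lra.
  rewrite e2 in nb2 E01 E02 E11 E12 *.
  have ev : y' = v by apply: (mulfI b0); lra.
  have ep : x = p by apply: (mulIf b0); lra.
  have e1 : b1 = a by move: E02; rewrite ev ep; lra.
  by rewrite ev e1 -/(wprod _) ?wprodE -w_longE.
Qed.

End Bruhat.

Section CoverElements.
Context {R : realType}.
Implicit Types (a b c x y z t : R).

Lemma prod3_neq0 a b c : a * b * c = 1 -> [/\ a != 0, b != 0 & c != 0].
Proof.
move=> abc; have : a * b * c != 0 by rewrite abc oner_neq0.
by rewrite !mulf_eq0 !negb_or -andbA => /and3P[].
Qed.

Lemma prod3_sgn a b c : a * b * c = 1 -> (c < 0) = (a < 0) (+) (b < 0).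
Proof.
move=> abc; have [a0 b0 c0] := prod3_neq0 abc.
have : (a * b * c < 0) = false by rewrite abc ltr10.
by rewrite !sgnM ?mulf_neq0//; case: (a < 0); case: (b < 0); case: (c < 0).
Qed.

(** The cocycle at two diagonal matrices of determinant 1 with the same signs [e1], [e2]; the third
    sign is then [e1 (+) e2]. *)
Definition torus_sign (e1 e2 : bool) : bool :=
  (e1 && e2) (+) (e1 && (e1 (+) e2)) (+) (e2 && (e1 (+) e2)).

Lemma sigma_diag_torus a b c a' b' c' : a * b * c = 1 -> a' * b' * c' = 1 ->
  (a < 0) = (a' < 0) -> (b < 0) = (b' < 0) ->
  sigma_diag (tmx a b c) (tmx a' b' c') = torus_sign (a < 0) (b < 0).
Proof.
move=> h h' ea eb; rewrite /sigma_diag /hilbert !mat3E (prod3_sgn h') -ea -eb.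
by [].
Qed.

Lemma sigma_diag1 (h : 'M[R]_3) : sigma_diag (tmx 1 1 1) h = false.
Proof. by rewrite /sigma_diag /hilbert !mat3E ltr10. Qed.

Lemma Delta_torus a b c x y z : a * b * c = 1 ->
  Delta (tmx a b c *m nmx x y z) = tmx a b c.
Proof.
move=> abc; have [a0 b0 c0] := prod3_neq0 abc.
have X2E : X2 (tmx a b c *m nmx x y z) = b * c.
  rewrite mat3_mul X2_mat3 [X in first_nz X _ _](_ : _ = 0); last by ring.
  rewrite [X in first_nz _ X _](_ : _ = 0); last by ring.
  by rewrite first_nz3; ring.
have X3E : X3 (tmx a b c *m nmx x y z) = c.
  rewrite mat3_mul X3_mat3 [X in first_nz X _ _](_ : _ = 0); last by ring.
  rewrite [X in first_nz _ X _](_ : _ = 0); last by ring.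
  by rewrite first_nz3; ring.
rewrite /Delta X2E X3E /X1 det_mulmx det_nmx det_tmx abc mulr1.
congr tmx => //; last by rewrite mulfK.
by rewrite -abc -(mulrA a b c) mulfK ?mulf_neq0.
Qed.

Lemma Delta_diag a b c : a * b * c = 1 -> Delta (tmx a b c) = tmx a b c.
Proof. by move=> abc; rewrite -{1}[tmx a b c]mulmx1 -nmx0 Delta_torus. Qed.

Lemma sigma_diag_pos (d : 'M[R]_3) a b c : a * b * c = 1 ->
  0 < a -> 0 < b -> sigma_diag d (Delta (tmx a b c)) = false.
Proof.
move=> abc a0 b0; rewrite Delta_diag// /sigma_diag /hilbert !mat3E.
have an : (a < 0) = false by rewrite ltNge ltW.
have bn : (b < 0) = false by rewrite ltNge ltW.
by rewrite (prod3_sgn abc) an bn !andbF.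
Qed.

Ltac minor := match goal with |- first_nz ?A ?B ?C = _ =>
  first [ rewrite (_ : A = 0); [|by ring] | idtac];
  first [ rewrite (_ : B = 0); [|by ring] | idtac] end.

Lemma long_sign_nmx x y z : long_sign (nmx x y z) = false.
Proof.
have h1E : w_alpha1 *m nmx x y z = mat3 0 (-1) (- y) 1 x z 0 0 1.
  by rewrite mat3_mul; congr mat3; ring.
have h2E : w_alpha2 *m (w_alpha1 *m nmx x y z) = mat3 0 (-1) (- y) 0 0 (-1) 1 x z.
  by rewrite h1E mat3_mul; congr mat3; ring.
have h3E : w_long *m nmx x y z = mat3 0 0 1 0 (-1) (- y) 1 x z.
  by rewrite w_longE mat3_mul; congr mat3; ring.
have [a1 a2] : X2 (nmx x y z) = 1 /\ X3 (nmx x y z) = 1.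
  rewrite X2_mat3 X3_mat3; split; minor; rewrite first_nz3; ring.
have [a3 a4] : X2 (w_alpha1 *m nmx x y z) = 1 /\ X3 (w_alpha1 *m nmx x y z) = 1.
  rewrite h1E X2_mat3 X3_mat3; split; minor; last by rewrite first_nz3.
  by rewrite first_nz2; last (by rewrite mul1r mulr0 subr0 oner_neq0); ring.
have [a5 a6] : X2 (w_alpha2 *m (w_alpha1 *m nmx x y z)) = 1 /\
    X3 (w_alpha2 *m (w_alpha1 *m nmx x y z)) = 1.
  rewrite h2E X2_mat3 X3_mat3; split; last by rewrite first_nz1 ?oner_neq0.
  minor; rewrite first_nz2; first by ring.
  by rewrite (_ : _ - _ = 1) ?oner_neq0//; ring.
have [a7 a8] : X2 (w_long *m nmx x y z) = 1 /\ X3 (w_long *m nmx x y z) = 1.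
  rewrite h3E X2_mat3 X3_mat3; split; last by rewrite first_nz1 ?oner_neq0.
  by rewrite first_nz1; [ring|rewrite (_ : _ - _ = 1) ?oner_neq0//; ring].
by rewrite long_signE ?det_nmx ?a1 ?a2 ?a3 ?a4 ?a5 ?a6 ?a7 ?a8 ?oner_neq0// !ltr10.
Qed.

(** [long_signE] evaluated at [w_long] times a diagonal matrix times a unipotent one. There [X2] and
    [X3] are, up to sign, products of diagonal entries, whose signs are [e1], [e2], [e3]; the
    unipotent factor does not enter. *)
Definition long_torus_sign (e1 e2 : bool) : bool :=
  let e3 := e1 (+) e2 in
  simple_sign (e2 (+) e3) e3 (~~ (e1 (+) e3)) e3
  (+) simple_sign (~~ (e1 (+) e3)) e3 (~~ (e1 (+) e3)) e1
  (+) simple_sign (~~ (e1 (+) e3)) e1 (e1 (+) e2) e1.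

Lemma long_sign_torus a b c x y z : a * b * c = 1 ->
  long_sign (w_long *m tmx a b c *m nmx x y z) = long_torus_sign (a < 0) (b < 0).
Proof.
move=> abc; have [a0 b0 c0] := prod3_neq0 abc.
set h := _ *m nmx x y z.
have hE : h = mat3 0 0 c 0 (- b) (- b * y) a (a * x) (a * z).
  by rewrite /h w_longE !mat3_mul; congr mat3; ring.
have h1E : w_alpha1 *m h = mat3 0 b (b * y) 0 0 c a (a * x) (a * z).
  by rewrite hE mat3_mul; congr mat3; ring.
have h2E : w_alpha2 *m (w_alpha1 *m h) = mat3 0 b (b * y) (- a) (- a * x) (- a * z) 0 0 c.
  by rewrite h1E mat3_mul; congr mat3; ring.
have h3E : w_long *m h = mat3 a (a * x) (a * z) 0 b (b * y) 0 0 c.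
  by rewrite hE w_longE mat3_mul; congr mat3; ring.
have ab : a * b != 0 by rewrite mulf_neq0.
have ac : - (a * c) != 0 by rewrite oppr_eq0 mulf_neq0.
have bc : b * c != 0 by rewrite mulf_neq0.
have [a1 a2] : X2 h = a * b /\ X3 h = a.
  rewrite hE X2_mat3 X3_mat3; split; last by rewrite first_nz1.
  by rewrite first_nz1; [ring|rewrite (_ : _ - _ = a * b)//; ring].
have [a3 a4] : X2 (w_alpha1 *m h) = - (a * c) /\ X3 (w_alpha1 *m h) = a.
  rewrite h1E X2_mat3 X3_mat3; split; last by rewrite first_nz1.
  minor; rewrite first_nz2; first by ring.
  by rewrite (_ : _ - _ = - (a * c))//; ring.
have [a5 a6] : X2 (w_alpha2 *m (w_alpha1 *m h)) = - (a * c) /\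
    X3 (w_alpha2 *m (w_alpha1 *m h)) = c.
  rewrite h2E X2_mat3 X3_mat3; split; last by rewrite first_nz3.
  minor; rewrite first_nz2; first by ring.
  by rewrite (_ : _ - _ = - (a * c))//; ring.
have [a7 a8] : X2 (w_long *m h) = b * c /\ X3 (w_long *m h) = c.
  rewrite h3E X2_mat3 X3_mat3; split; last by rewrite first_nz3.
  by minor; rewrite first_nz3; ring.
have dh : \det h = 1 by rewrite /h 2!det_mulmx det_nmx det_tmx det_w_long mul1r mulr1.
rewrite long_signE ?a1 ?a2 ?a3 ?a4 ?a5 ?a6 ?a7 ?a8// /long_torus_sign.
rewrite !sgnN ?mulf_neq0// !sgnM// (prod3_sgn abc).
by case: (a < 0); case: (b < 0).
Qed.

Lemma tmx1 : tmx 1 1 1 = 1%:M :> 'M[R]_3.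
Proof. by rewrite mat3_1. Qed.

Lemma sigma_nmx x y z (h : 'M[R]_3) : sigma (nmx x y z) h = false.
Proof.
rewrite -[nmx x y z]mulmx1 -tmx1 sigma_torus ?sigma_diag1//; by rewrite !mulr1.
Qed.

Lemma sigma_w_long x y z (h : 'M[R]_3) :
  sigma (w_long *m nmx x y z) h = long_sign (nmx x y z *m h).
Proof.
have -> : w_long *m nmx x y z = nmx 0 0 0 *m tmx 1 1 1 *m w_long *m nmx x y z.
  by rewrite nmx0 tmx1 !mul1mx.
by rewrite sigma_long ?sigma_diag1// !mulr1.
Qed.

Lemma sigma_w_long1 (h : 'M[R]_3) : sigma w_long h = long_sign h.
Proof. by have := @sigma_w_long 0 0 0 h; rewrite nmx0 mulmx1 mul1mx. Qed.

(** [w_long] is an involution, but its lift squares to the nontrivial central element of the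
    cover. *)
Lemma long_sign_w_long : long_sign (w_long : 'M[R]_3) = true.
Proof.
have := @long_sign_torus 1 1 1 0 0 0; rewrite tmx1 nmx0 !mulmx1 => -> //.
  by rewrite ltr10.
by rewrite !mulr1.
Qed.

Lemma tinv_w_long : tinv (lift (w_long : 'M[R]_3)) = (w_long, true).
Proof.
by rewrite /tinv /= inv_w_long sigma_w_long1 long_sign_w_long.
Qed.

Lemma conj_wl_lift x y z : conj_wl (lift (nmx x y z)) =
  (w_long *m nmx x y z *m w_long, ~~ long_sign (nmx x y z *m w_long)).
Proof.
by rewrite /conj_wl tinv_w_long /tmul /= sigma_w_long1 sigma_w_long long_sign_nmx.
Qed.

Lemma conj_wl_lift1 : conj_wl (lift 1%:M) = (1%:M : 'M[R]_3, false).
Proof.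
by rewrite -{1}nmx0 conj_wl_lift nmx0 mulmx1 mul1mx w_longK long_sign_w_long.
Qed.

Lemma tinv_nmx x y z : tinv (lift (nmx x y z)) = lift (nmx (- x) (- y) (x * y - z)).
Proof. by rewrite /tinv /= inv_nmx sigma_nmx. Qed.

End CoverElements.

Section Mat2.
Variable T : comNzRingType.

Definition mat2 (a b c d : T) : 'M[T]_2 :=
  \matrix_(r < 2, k < 2) nth 0 (nth [::] [:: [:: a; b]; [:: c; d]] r) k.

Lemma mat2_mul a b c d a' b' c' d' : mat2 a b c d *m mat2 a' b' c' d' =
  mat2 (a * a' + b * c') (a * b' + b * d') (c * a' + d * c') (c * b' + d * d').
Proof.
apply/matrixP => r k; rewrite !mxE !big_ord_recl big_ord0 !mxE /= addr0.
by case: r => [[|[|r]] hr] //; case: k => [[|[|k]] hk].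
Qed.

Lemma mat2_1 : 1%:M = mat2 1 0 0 1.
Proof.
apply/matrixP => r k; rewrite !mxE.
by case: r => [[|[|r]] hr] //; case: k => [[|[|k]] hk].
Qed.

Lemma mat2_tr a b c d : (mat2 a b c d)^T = mat2 a c b d.
Proof.
apply/matrixP => r k; rewrite !mxE.
by case: r => [[|[|r]] hr] //; case: k => [[|[|k]] hk].
Qed.

Lemma mat2_scale s a b c d : s *: mat2 a b c d = mat2 (s * a) (s * b) (s * c) (s * d).
Proof.
apply/matrixP => r k; rewrite !mxE.
by case: r => [[|[|r]] hr] //; case: k => [[|[|k]] hk].
Qed.

Lemma mat2_col0 a b c d (v : 'cV[T]_2) : (mat2 a b c d *m v) 0 0 = a * v 0 0 + b * v 1 0.
Proof.
rewrite !mxE !big_ord_recl big_ord0 !mxE /= addr0.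
by congr (_ + _ * v _ _); apply: val_inj.
Qed.

Lemma mat2_col1 a b c d (v : 'cV[T]_2) : (mat2 a b c d *m v) 1 0 = c * v 0 0 + d * v 1 0.
Proof.
rewrite !mxE !big_ord_recl big_ord0 !mxE /= addr0.
by congr (_ + _ * v _ _); apply: val_inj.
Qed.

End Mat2.

(** * Equivariant sections evaluated through the big cell *)

Section Values.
Context {R : realType}.
Implicit Types (a b c x y z t : R).

Definition msig (e1 e2 : bool) : 'M[R]_3 :=
  tmx ((-1) ^+ e1) ((-1) ^+ e2) ((-1) ^+ e1 * (-1) ^+ e2).

Lemma msig_prod (e1 e2 : bool) : (-1) ^+ e1 * (-1) ^+ e2 * ((-1) ^+ e1 * (-1) ^+ e2) = 1 :> R.
Proof. by rewrite -expr2 exprMn !sqrr_sign mulr1. Qed.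

Lemma msig_abs a b c : a * b * c = 1 ->
  msig (a < 0) (b < 0) *m tmx `|a| `|b| `|c| = tmx a b c.
Proof.
move=> abc; rewrite mat3_mul; have [a0 b0 c0] := prod3_neq0 abc.
have E t : t = (-1) ^+ (t < 0)%R * `|t| by exact: numEsign.
by congr mat3; rewrite ?(mulr0, mul0r, addr0, add0r)// [RHS]E// (prod3_sgn abc) signr_addb.
Qed.

(** The inverse transposes of the matrices [J ^+ e1 *m K ^+ e2] of [phi], without the sign. *)
Definition unit_part (e1 e2 : bool) : 'M[R[i]]_2 :=
  if e1 then (if e2 then mat2 0 'i%C 'i%C 0 else mat2 0 (-1) 1 0)
  else (if e2 then mat2 'i%C 0 0 (- 'i%C) else mat2 1 0 0 1).

(** The sign [torus_sign] is produced by [tinv]: it is the cocycle of a sign matrix with itself. *)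
Lemma contragredient_phi (e1 e2 e : bool) :
  contragredient (@phi R) (tinv (msig e1 e2, e)) =
  (-1) ^+ (e (+) torus_sign e1 e2) *: unit_part e1 e2.
Proof.
have iE : invmx (msig e1 e2) = msig e1 e2.
  apply: mulmx1_inv; rewrite mat3_mul mat3_1.
  congr mat3; rewrite ?(mulr0, mul0r, addr0, add0r)// -expr2 ?exprMn ?sqrr_sign//.
  by rewrite mulr1.
have sE : sigma (msig e1 e2) (msig e1 e2) = torus_sign e1 e2.
  have := @sigma_torus R 0 0 0 ((-1) ^+ e1) ((-1) ^+ e2) ((-1) ^+ e1 * (-1) ^+ e2).
  rewrite nmx0 mul1mx => -> //; last exact: msig_prod.
  by rewrite Delta_diag ?msig_prod// sigma_diag_torus ?msig_prod// !signr_lt0.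
rewrite /tinv iE /= sE /contragredient /phi /=.
set s := (-1) ^+ _.
have -> : ((msig e1 e2) i0 i0 < 0) = e1 by rewrite mat3E signr_lt0.
have -> : ((msig e1 e2) i1 i1 < 0) = e2 by rewrite mat3E signr_lt0.
have s2 : s * s = 1 by rewrite /s -expr2 sqrr_sign.
have i2 : 'i%C * 'i%C = -1 :> R[i] by rewrite -expr2 sqr_i.
rewrite -/(mat2 0 (-1) 1 0) -/(mat2 (- 'i%C) 0 0 'i%C).
rewrite -[RHS]trmxK; congr trmx; apply: mulmx1_inv.
rewrite linearZ /= -scalemxAl -scalemxAr scalerA s2 scale1r.
clearbody s; clear iE sE.
by case: e1; case: e2; rewrite /= ?expr0 ?expr1 ?mulmx1 ?mul1mx ?mat2_mul
  ?mat2_tr ?mat2_mul mat2_1 ?mat2_mul; congr mat2; ring: i2.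
Qed.

End Values.

Section TermValue.
Context {R : realType}.
Implicit Types (a b c x y z t : R).

Definition scale3 (lam : 'rV[R[i]]_3) a b c : R[i] :=
  \prod_(k < 3) cpow (tmx a b c k k) (- ((- lam) 0 k - rho R 0 k)).

Variables (lam : 'rV[R[i]]_3) (f : section R).
Hypothesis ef : equivariant (- lam) (contragredient (@phi R)) f.

Lemma tM_msig (e1 e2 b : bool) : tM (msig e1 e2 : 'M[R]_3, b).
Proof. by exists e1, e2, b. Qed.

Lemma tN_nmx x y z : tN (lift (nmx x y z : 'M[R]_3)).
Proof. by exists (nmx x y z) => //; exact: unip_nmx. Qed.

(** A diagonal matrix of arbitrary signs is split into a factor in [tM] and one in [tA]. The sign
    [e'] of the product in the cover is left unspecified, which allows an arbitrary base point [g]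
    and suffices for bounds on norms. *)
Lemma section_value (g : Gt R) x y z a b c : a * b * c = 1 ->
  tG g ->
  exists e' : bool, forall e, f (g.1 *m tmx a b c *m (w_long *m nmx x y z *m w_long), e) =
  scale3 lam `|a| `|b| `|c| *:
    (contragredient (@phi R) (tinv (msig (a < 0) (b < 0), e (+) e')) *m f g).
Proof.
move=> abc tg.
have [a0 b0 c0] := prod3_neq0 abc.
have tAabs : tA (lift (tmx `|a| `|b| `|c|)).
  by exists `|a|, `|b|, `|c|; split; rewrite ?normr_gt0// -!normrM abc normr1.
have tNm : tNminus (conj_wl (lift (nmx x y z))).
  by exists (lift (nmx x y z)) => //; exact: tN_nmx.
have key e1 := ef tg (tM_msig (a < 0) (b < 0) e1) tAabs tNm.
pose t0 := tmul (tmul (tmul g (msig (a < 0) (b < 0), false)) (lift (tmx `|a| `|b| `|c|)))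
  (conj_wl (lift (nmx x y z))).
exists t0.2 => e1; rewrite -[RHS](key (e1 (+) t0.2)); congr f.
rewrite /t0 /tmul conj_wl_lift /= -!mulmxA; congr pair.
  by rewrite (mulmxA (msig _ _)) msig_abs// !mulmxA.
case: g.2; case: (sigma _ _); case: (sigma _ _); case: (sigma _ _);
 by case: (long_sign _); case: e1.
Qed.

(** At a base point in N the sign of [section_value] becomes explicit, since [sigma_nmx] and
    [sigma_torus] evaluate every cocycle that occurs. *)
Lemma section_value_nmx x y z x2 y2 z2 a b c (e : bool) : a * b * c = 1 ->
  let nm := w_long *m nmx x2 y2 z2 *m w_long in
  f (nmx x y z *m tmx a b c *m nm,
    e (+) sigma_diag (tmx a b c) (Delta nm)
      (+) ~~ long_sign (nmx x2 y2 z2 *m w_long)) =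
  scale3 lam `|a| `|b| `|c| *:
    (contragredient (@phi R) (tinv (msig (a < 0) (b < 0), e)) *m f (lift (nmx x y z))).
Proof.
move=> abc nm; have [a0 b0 c0] := prod3_neq0 abc.
have abc' : `|a| * `|b| * `|c| = 1 by rewrite -!normrM abc normr1.
have tAabs : tA (lift (tmx `|a| `|b| `|c|)).
  by exists `|a|, `|b|, `|c|; split; rewrite ?normr_gt0.
have tNm : tNminus (conj_wl (lift (nmx x2 y2 z2))).
  by exists (lift (nmx x2 y2 z2)) => //; exact: tN_nmx.
have tg : tG (lift (nmx x y z)) by exact: det_nmx.
rewrite -[RHS](ef tg (tM_msig (a < 0) (b < 0) e) tAabs tNm); congr f.
rewrite conj_wl_lift /tmul /= -/nm.
have mE : nmx x y z *m msig (a < 0) (b < 0) *m tmx `|a| `|b| `|c| =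
    nmx x y z *m tmx a b c by rewrite -mulmxA msig_abs.
rewrite mE sigma_nmx !sigma_torus ?msig_prod// sigma_diag_pos ?normr_gt0//.
congr pair; rewrite !addbF; exact: addbAC.
Qed.

(** Three inversions meet in a term of the series: the one in its definition, and one each from
    [act_dist] and [act]. *)
Lemma tinv3 (g : 'M[R]_3) (e : bool) :
  tinv (tinv (tinv (g, e))) = (invmx g, e (+) sigma (invmx g) g).
Proof.
rewrite /tinv /= !invmxK; congr pair.
by case: e; case: (sigma g (invmx g)); case: (sigma (invmx g) g).
Qed.

(** Since [w_long] is an involution, the inverse of [g] times [w_long] is the inverse of the right
    unipotent part, times a diagonal matrix, times a conjugate under [w_long] of the inverse of the
    left unipotent part. The last factor lies in the opposite unipotent group, so equivariance
    leaves a value of [f] on N. *)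
Lemma term_value x2 y2 z2 a b c x y z p q r (e : bool) : a * b * c = 1 ->
  let g := nmx x2 y2 z2 *m w_long *m tmx a b c *m nmx x y z in
  f (tmul (lift (nmx p q r)) (tmul (tinv (tinv (tinv (g, e)))) (lift w_long))) =
  ((-1) ^+ (e (+) ~~ long_torus_sign (a < 0) (b < 0)) *
    scale3 lam `|a^-1| `|b^-1| `|c^-1|) *:
    (unit_part (a < 0) (b < 0) *m f (lift (nmx p q r *m invmx (nmx x y z)))).
Proof.
move=> abc g; have [a0 b0 c0] := prod3_neq0 abc.
have abc' : a^-1 * b^-1 * c^-1 = 1 by rewrite -!invfM abc invr1.
pose n' : 'M[R]_3 := nmx (- x2) (- y2) (x2 * y2 - z2).
pose v' : 'M[R]_3 := nmx (- x) (- y) (x * y - z).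
have n'K : n' *m nmx x2 y2 z2 = 1%:M.
  by rewrite /n' mul_nmx -nmx0; congr nmx; ring.
have v'K : nmx x y z *m v' = 1%:M by rewrite /v' mul_nmx -nmx0; congr nmx; ring.
have tK : tmx a b c *m tmx a^-1 b^-1 c^-1 = 1%:M.
  by rewrite mat3_mul mat3_1; congr mat3; rewrite ?(mulr0, mul0r, addr0, add0r, mulfV).
have nK : nmx x2 y2 z2 *m n' = 1%:M.
  by rewrite /n' mul_nmx -nmx0; congr nmx; ring.
have gE : invmx g = v' *m tmx a^-1 b^-1 c^-1 *m w_long *m n'.
  rewrite /g; move: (w_long) (@w_longK R) => w wK; apply: mulmx1_inv.
  rewrite -!mulmxA (mulmxA (nmx x y z)) v'K mul1mx.
  by rewrite (mulmxA (tmx a b c)) tK mul1mx (mulmxA w w) wK mul1mx.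
rewrite tinv3 {2}/tmul /= gE /v' /n' !sigma_long// -/n' -/v'.
have n'g : n' *m g = w_long *m tmx a b c *m nmx x y z.
  by rewrite /g; move: (w_long) => w; rewrite !mulmxA n'K mul1mx.
rewrite n'g long_sign_torus//.
have -> : w_long *m (w_long *m tmx a b c *m nmx x y z) = tmx a b c *m nmx x y z.
  by move: (w_long) (@w_longK R) => w wK; rewrite !mulmxA wK mul1mx.
rewrite Delta_torus// sigma_diag_torus// ?sgnV//.
rewrite /tmul /= sigma_nmx /= !addbF [w_long *m (n' *m w_long)]mulmxA.
have -> : nmx p q r *m (v' *m tmx a^-1 b^-1 c^-1 *m w_long *m n' *m w_long) =
    nmx p q r *m v' *m tmx a^-1 b^-1 c^-1 *m (w_long *m n' *m w_long).
  by move: (w_long) => w; rewrite !mulmxA.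
have pv : nmx p q r *m v' = nmx (p - x) (q - y) (r + (x * y - z) + p * - y).
  by rewrite /v' mul_nmx.
(* The signs that depend on the left unipotent part [n'] are grouped exactly as [section_value_nmx]
   wants them, so that they disappear. *)
have -> : e (+) (torus_sign (a < 0) (b < 0) (+) long_torus_sign (a < 0) (b < 0))
    (+) (sigma_diag (tmx a^-1 b^-1 c^-1) (Delta (w_long *m n' *m w_long))
    (+) long_sign (n' *m w_long)) =
   (e (+) (torus_sign (a < 0) (b < 0) (+) ~~ long_torus_sign (a < 0) (b < 0)))
    (+) sigma_diag (tmx a^-1 b^-1 c^-1) (Delta (w_long *m n' *m w_long))
    (+) ~~ long_sign (n' *m w_long).
  by case: e; case: torus_sign; case: long_torus_sign; case: sigma_diag;
    case: long_sign.
rewrite pv section_value_nmx// contragredient_phi !sgnV inv_nmx -/v' pv.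
rewrite -scalemxAl scalerA mulrC; congr ((-1) ^+ _ * _ *: _).
by case: e; case: torus_sign; case: long_torus_sign.
Qed.

End TermValue.

Section ComplexPowers.
Context {R : realType}.
Implicit Types (z w : R[i]) (a x y : R).

Lemma cexpD z w : cexp (z + w) = cexp z * cexp w.
Proof.
case: z => a b; case: w => c d; rewrite /cexp /= expRD cosD sinD.
by apply: eq_ReIm; rewrite /= ; ring.
Qed.

Lemma cexp0 : cexp 0 = 1 :> R[i].
Proof. by rewrite /cexp /= expR0 cos0 sin0 mulr1 mulr0. Qed.

Lemma nrm_cexp z : nrm (cexp z) = expR (complex.Re z).
Proof.
rewrite nrmE /cexp /= !exprMn -mulrDr cos2Dsin2 mulr1 sqrtr_sqr.
by rewrite ger0_norm ?expR_ge0.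
Qed.

Lemma nrm_cpow a z : 0 < a -> nrm (cpow a z) = a `^ complex.Re z.
Proof.
move=> a0; rewrite nrm_cexp ReM /= mul0r subr0 /powR gt_eqF// mulrC.
by [].
Qed.

Lemma cpow1 z : cpow 1 z = 1.
Proof. by rewrite /cpow ln1 mul0r cexp0. Qed.

Lemma e2piD x y : e2pi (x + y) = e2pi x * e2pi y :> R[i].
Proof.
rewrite /e2pi mulrDr cosD sinD; apply: eq_ReIm => /=; ring.
Qed.

Lemma e2pi0 : e2pi 0 = 1 :> R[i].
Proof. by rewrite /e2pi mulr0 cos0 sin0. Qed.

Lemma e2piV x : (e2pi x)^-1 = e2pi (- x) :> R[i].
Proof.
have E : e2pi x * e2pi (- x) = 1 by rewrite -e2piD subrr e2pi0.
have x0 : e2pi x != 0 by apply: contra_eq_neq E => ->; rewrite mul0r eq_sym oner_neq0.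
by apply: (mulfI x0); rewrite E mulfV.
Qed.

Lemma nrm_e2pi x : nrm (e2pi x : R[i]) = 1.
Proof. by rewrite nrmE /e2pi /= cos2Dsin2 sqrtr1. Qed.

End ComplexPowers.

Section BigCell.
Context {R : realType}.
Implicit Types (g : 'M[R]_3).

Lemma pluecker_relation (T : comNzRingType) (m : 'M[T]_3) :
  pA1 m * pC2 m + pB1 m * pB2 m + pC1 m * pA2 m = 0.
Proof. by rewrite /pA1 /pB1 /pC1 /pA2 /pB2 /pC2; ring. Qed.

Lemma long_decomp g : \det g = 1 -> pA1 g != 0 -> pA2 g != 0 ->
  exists x y z, g = nmx x y z *m w_long *m
    tmx (- pA1 g) (pA2 g / pA1 g) (- pA2 g)^-1 *m
    nmx (pB1 g / pA1 g) (- (pB2 g / pA2 g)) (pC1 g / pA1 g).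
Proof.
rewrite [g]mat3_eta; move: (g i0 i0) (g i0 i1) (g i0 i2) (g i1 i0) (g i1 i1)
  (g i1 i2) (g i2 i0) (g i2 i1) (g i2 i2) => a b c d e f h k l.
rewrite det_mat3 /pA1 /pB1 /pC1 /pA2 /pB2 !mat3E !oppr_eq0 => dg h0 m0.
exists ((a * k - b * h) / (d * k - e * h)), (d / h), (a / h).
(* The determinant equation is solved for the corner entry, whose cofactor is the nonzero minor;
   what remains are rational identities. *)
have cE : c = (1 - a * (e * l - f * k) + b * (d * l - f * h)) / (d * k - e * h).
  by apply: (mulIf m0); rewrite mulfVK//; lra.
rewrite w_longE !mat3_mul cE; congr mat3; field; rewrite ?m0 ?h0 ?oppr_eq0 ?m0 ?h0//.
Qed.


(** The Pluecker relation eliminates [pC1] in favour of [pC2], which makes [pA2] the only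
    denominator of the third coordinate. *)
Lemma inv_unip_part g : pA1 g != 0 -> pA2 g != 0 ->
  invmx (nmx (pB1 g / pA1 g) (- (pB2 g / pA2 g)) (pC1 g / pA1 g)) =
  nmx (- (pB1 g / pA1 g)) (pB2 g / pA2 g) (pC2 g / pA2 g).
Proof.
move=> a0 b0; rewrite inv_nmx opprK; congr nmx.
have := pluecker_relation g; move: (pA1 g) (pB1 g) (pC1 g) (pA2 g) (pB2 g) (pC2 g) a0 b0.
move=> a b c d e h a0 d0 E.
have -> : h = - (b * e + c * d) / a by apply: (mulfI a0); rewrite mulrCA mulfV// mulr1; lra.
by field; rewrite a0 d0.
Qed.

Definition weight2 (lam : 'rV[R[i]]_3) (a b : R) : R[i] :=
  cpow a (-1 - lam 0 i0 + lam 0 i1) * cpow b (-1 - lam 0 i1 + lam 0 i2).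

Lemma scale3E (lam : 'rV[R[i]]_3) (a b c : R) : scale3 lam a b c =
  cpow a (lam 0 i0 + 1) * cpow b (lam 0 i1) * cpow c (lam 0 i2 - 1).
Proof.
rewrite /scale3 !big_ord_recl big_ord0 mulr1 mulrA /rho !mxE /=.
have -> : fintype.lift ord0 ord0 = i1 :> 'I_3 by apply: val_inj.
have -> : fintype.lift ord0 (fintype.lift ord0 ord0) = i2 :> 'I_3 by apply: val_inj.
have -> : ord0 = i0 :> 'I_3 by apply: val_inj.
by congr (cpow _ _ * cpow _ _ * cpow _ _); ring.
Qed.

Lemma scale3_weight (lam : 'rV[R[i]]_3) (a b : R) : a != 0 -> b != 0 ->
  scale3 lam `|(- a)^-1| `|(b / a)^-1| `|((- b)^-1)^-1| = weight2 lam `|a| `|b|.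
Proof.
move=> a0 b0; rewrite invrK !normrV ?unitfE ?oppr_eq0 ?mulf_neq0 ?invr_eq0//.
rewrite normrM !normrN normrV ?unitfE// invfM invrK.
have pa : 0 < `|a| by rewrite normr_gt0.
have pb : 0 < `|b| by rewrite normr_gt0.
rewrite scale3E /weight2 /cpow lnM ?posrE ?invr_gt0// !lnV ?posrE//.
rewrite -!cexpD rmorphD !rmorphN; congr cexp; ring.
Qed.

Definition restrN (f : section R) (k : 'I_2) (p : R * R * R) : R[i] :=
  f (lift (n3 p)) k 0.

(** With [s1], [s2] telling whether A_1, A_2 are positive, [sign_factor] and [sign_component]
    describe, up to sign, the only nonzero entry in the first row of [unit_part s1 (s1 (+) s2)]. *)
Definition sign_factor (s1 s2 : bool) : R[i] := if s1 == s2 then 1 else 'i%C.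
Definition sign_component (s1 : bool) : 'I_2 := if s1 then 1 else 0.

(* n(-p) n(X,Y,Z) in coordinates, n(X,Y,Z)^-1 being the last factor of g in
   the decomposition of the big cell *)
Definition moved (g : 'M[R]_3) (p : R * R * R) : R * R * R :=
  (- (pB1 g / pA1 g) - p.1.1, pB2 g / pA2 g - p.1.2,
   pC2 g / pA2 g + p.1.1 * p.1.2 - p.2 - p.1.1 * (pB2 g / pA2 g)).

Lemma moved_nmx (g : 'M[R]_3) p :
  nmx (- p.1.1) (- p.1.2) (p.1.1 * p.1.2 - p.2) *m
  nmx (- (pB1 g / pA1 g)) (pB2 g / pA2 g) (pC2 g / pA2 g) = n3 (moved g p).
Proof. by rewrite mul_nmx /n3 /moved /=; congr nmx; ring. Qed.

Lemma big_cell_value (lam : 'rV[R[i]]_3) (f : section R) (g : 'M[R]_3) (e : bool) p :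
  equivariant (- lam) (contragredient (@phi R)) f ->
  \det g = 1 -> pA1 g != 0 -> pA2 g != 0 ->
  f (tmul (tinv (lift (n3 p))) (tmul (tinv (tinv (tinv (g, e)))) (lift w_long))) 0 0 =
  (-1) ^+ e * weight2 lam `|pA1 g| `|pA2 g| *
  (sign_factor (0 < pA1 g) (0 < pA2 g) * restrN f (sign_component (0 < pA1 g)) (moved g p)).
Proof.
move=> ef dg a0 b0; have [x [y [z gE]]] := long_decomp dg a0 b0.
rewrite {1}gE tinv_nmx (term_value ef); last first.
  by move: (pA1 g) (pA2 g) a0 b0 => a b a0 b0; field; rewrite ?oppr_eq0 ?a0 ?b0.
rewrite scale3_weight// inv_unip_part// moved_nmx mxE.
have -> : (- pA1 g < 0) = (0 < pA1 g) by rewrite oppr_lt0.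
have -> : (pA2 g / pA1 g < 0) = (0 < pA1 g) (+) (0 < pA2 g).
  have S (t : R) : t != 0 -> (t < 0) = ~~ (0 < t).
    by move=> t0; rewrite -{1}[t]opprK sgnN ?oppr_eq0// oppr_lt0.
  by rewrite sgnM ?invr_eq0// sgnV addbC !S// addNb addbN negbK.
rewrite -/(n3 _) /unit_part /sign_factor /sign_component /restrN.
case: (0 < pA1 g); case: (0 < pA2 g); rewrite mat2_col0 /=;
  rewrite ?signr_addb ?mul0r ?mul1r ?add0r ?addr0 ?addbT ?addbF; rewrite ?expr1; ring.
Qed.

(** [w_end] lies in [tM] and acts there by exchanging the two components up to sign. Hence the
    Jacquet integral of f_1 belongs to the terms with A_1 > 0, which see the second component on
    N. *)
Lemma jacquet_value (lam : 'rV[R[i]]_3) (f : section R) (m1 m2 : int) p :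
  equivariant (- lam) (contragredient (@phi R)) f ->
  jacquet_integrand m1 m2 f 0 p = restrN f 1 p * (psi m1 m2 (n3 p))^-1 /\
  jacquet_integrand m1 m2 f 1 p = - (restrN f 0 p * (psi m1 m2 (n3 p))^-1).
Proof.
move=> ef.
have abc : -1 * 1 * -1 = 1 :> R by ring.
have E : f (tmul (lift (n3 p)) (w_end R)) = mat2 0 1 (-1) 0 *m f (lift (n3 p)).
  have s0 : sigma_diag (tmx (-1) 1 (-1)) (tmx 1 1 1 : 'M[R]_3) = false.
    by rewrite /sigma_diag /hilbert !mat3E ltr10 !andbF.
  have n0 : ((1 : R) < 0) = false by rewrite ltr10.
  have n1 : ((-1 : R) < 0) = true by rewrite ltrN10.
  have := @section_value_nmx R lam f ef p.1.1 p.1.2 p.2 0 0 0 (-1) 1 (-1) false abc.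
  rewrite /= nmx0 mulmx1 mul1mx w_longK mulmx1 long_sign_w_long -tmx1.
  rewrite Delta_diag ?mulr1// s0 scale3E !normrN !normr1 !cpow1 !mulr1 scale1r.
  rewrite contragredient_phi n0 n1 /= => H.
  rewrite /tmul /w_end /= sigma_nmx -/(n3 p) in H *.
  rewrite H; congr (_ *m _).
  by rewrite mat2_scale; congr mat2; ring.
rewrite /jacquet_integrand E mat2_col0 mat2_col1 /restrN !mul0r !mul1r add0r addr0.
by rewrite mulN1r mulNr.
Qed.

End BigCell.

(** * Decay of sections on N *)

Section Pivot.
Context {R : realType}.
Implicit Types (a b c d e f g h i x y z : R).

(** One signed permutation matrix for each order of the rows, listed in the order of the cases of
    [pivot_decomp]; the signs make the determinant 1. *)
Definition weyl_seq : seq 'M[R]_3 :=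
  [:: mat3 1 0 0 0 1 0 0 0 1; mat3 0 1 0 (-1) 0 0 0 0 1;
      mat3 (-1) 0 0 0 0 1 0 1 0; mat3 0 1 0 0 0 1 1 0 0;
      mat3 0 0 1 1 0 0 0 1 0; mat3 0 0 1 0 1 0 (-1) 0 0].

Lemma det_weyl (P : 'M[R]_3) : P \in weyl_seq -> \det P = 1.
Proof.
by rewrite !inE; do 5 (case/orP => [/eqP->|]; first by rewrite det_mat3; ring);
  move=> /eqP->; rewrite det_mat3; ring.
Qed.

Definition pivoted x y z (P : 'M[R]_3) : Prop :=
  exists x1 y1 z1 u v w p t, [/\ [/\ `|x1| <= 1, `|y1| <= 1 & `|z1| <= 1],
    [/\ 1 <= 2 * `|p| & `|x| <= 2 * `|p|],
    [/\ 1 <= `|t|, `|y| <= `|t| & `|z| <= `|t|] &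
    nmx x y z = P *m nmx x1 y1 z1 *m tmx p^-1 (p / t) t *m
      (w_long *m nmx u v w *m w_long)].

(** Gaussian elimination from the lower right corner, with pivots [i] and then the minor [p]: the
    coordinates of the unipotent factor next to [P] are quotients of entries and minors by these
    pivots, hence at most 1 in absolute value. *)
Lemma pivot_case x y z (P : 'M[R]_3) a b c d e f g h i :
  nmx x y z = P *m mat3 a b c d e f g h i -> \det P = 1 ->
  `|c| <= `|i| -> `|f| <= `|i| -> `|b * i - c * h| <= `|e * i - f * h| ->
  [/\ 1 <= `|i|, `|y| <= `|i| & `|z| <= `|i|] ->
  1 <= 2 * `|e * i - f * h| -> `|x| <= 2 * `|e * i - f * h| ->
  pivoted x y z P.
Proof.
move=> nE dP ci fi bp [i1 yi zi] p1 xp; set p := e * i - f * h in bp p1 xp.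
have i0 : i != 0 by rewrite -normr_gt0; lra.
have p0 : p != 0 by rewrite -normr_gt0; lra.
have dg : a * (e * i - f * h) - b * (d * i - f * g) + c * (d * h - e * g) = 1.
  by have := det_nmx x y z; rewrite nE det_mulmx dP mul1r det_mat3.
exists ((b * i - c * h) / p), (f / i), (c / i), (- (h / i)),
  (- ((d * i - f * g) / p)), (g / i), p, i; split => //.
  by rewrite !normrM !normfV !ler_pdivrMr ?normr_gt0// !mul1r.
have aE : a = (1 + b * (d * i - f * g) - c * (d * h - e * g)) / p.
  by apply: (mulIf p0); rewrite mulfVK// /p; lra.
rewrite nE -!mulmxA; congr (_ *m _); rewrite w_longE !mat3_mul aE.
by rewrite /p in p0 *; congr mat3; field; rewrite ?p0 ?i0.
Qed.

Lemma pivot_case_norm x y z (P : 'M[R]_3) a b c d e f g h i q p :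
  nmx x y z = P *m mat3 a b c d e f g h i -> P \in weyl_seq ->
  b * i - c * h = q -> e * i - f * h = p ->
  `|c| <= `|i| -> `|f| <= `|i| -> `|q| <= `|p| ->
  [/\ 1 <= `|i|, `|y| <= `|i| & `|z| <= `|i|] ->
  1 <= 2 * `|p| -> `|x| <= 2 * `|p| -> pivoted x y z P.
Proof. by move=> nE /det_weyl dP <- <-; exact: (pivot_case nE dP). Qed.

Ltac pivot_tac := match goal with
    | |- _ = _ *m _ => by rewrite mat3_mul; congr mat3; ring
    | |- and3 _ _ _ => split; rewrite ?normrN ?normr1; lra
    | |- _ = _ :> _ => ring
    | |- _ => rewrite ?normrN ?normr1; first [lra | nra]
    end.

(** The choice is greedy: first [t], a maximal entry of the last column z, y, 1, then [p], up to
    sign the larger of the two minors of the last two columns that use the row of [t]. *)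
Lemma pivot_decomp x y z : exists2 P, P \in weyl_seq & pivoted x y z P.
Proof.
have W k : (k < 6)%N -> nth 0 weyl_seq k \in weyl_seq by move=> k6; rewrite mem_nth.
(* When the pivot row is that of y, the minor x is not a candidate for [p]; when it is that of z,
   the minor 1 is not. These two inequalities bound the omitted minor by twice the chosen one. *)
have xyz : `|x| * `|y| <= `|x * y - z| + `|z|.
  by rewrite -normrM -{1}(subrK z (x * y)) ler_normD.
have zxy : `|z| <= `|x * y - z| + `|x| * `|y|.
  rewrite -normrM [X in X + _]distrC -{1}(subrK (x * y) z); exact: ler_normD.
have [x0 y0 z0 m0] : [/\ 0 <= `|x|, 0 <= `|y|, 0 <= `|z| & 0 <= `|x * y - z|] by [].
have [/andP[y1 z1]|nyz] := boolP ((`|y| <= 1) && (`|z| <= 1)).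
  have [x1|x1] := leP `|x| 1.
    exists (nth 0 weyl_seq 0%N); first exact: W.
    apply: (@pivot_case_norm x y z _ 1 x z 0 1 y 0 0 1 x 1) => //;
      first [exact: W | clear W; pivot_tac].
  exists (nth 0 weyl_seq 1%N); first exact: W.
  apply: (@pivot_case_norm x y z _ 0 (-1) (- y) 1 x z 0 0 1 (-1) x) => //;
      first [exact: W | clear W; pivot_tac].
have [zy|yz] := leP `|z| `|y|.
  have y1 : 1 < `|y| by move: nyz; rewrite negb_and -!ltNge => /orP[]; lra.
  have [m1|m1] := leP `|x * y - z| 1.
    exists (nth 0 weyl_seq 2%N); first exact: W.
    apply: (@pivot_case_norm x y z _ (-1) (- x) (- z) 0 0 1 0 1 y (- (x * y - z)) (-1)) => //;
      first [exact: W | clear W; pivot_tac].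
  exists (nth 0 weyl_seq 3%N); first exact: W.
  apply: (@pivot_case_norm x y z _ 0 0 1 1 x z 0 1 y (-1) (x * y - z)) => //;
      first [exact: W | clear W; pivot_tac].
have z1 : 1 < `|z| by move: nyz; rewrite negb_and -!ltNge => /orP[]; lra.
have [m1|m1] := leP `|x * y - z| `|x|.
  exists (nth 0 weyl_seq 4%N); first exact: W.
  apply: (@pivot_case_norm x y z _ 0 1 y 0 0 1 1 x z (- (x * y - z)) (- x)) => //;
      first [exact: W | clear W; pivot_tac].
exists (nth 0 weyl_seq 5%N); first exact: W.
apply: (@pivot_case_norm x y z _ 0 0 (-1) 0 1 y 1 x z x (- (x * y - z))) => //;
      first [exact: W | clear W; pivot_tac].
Qed.

End Pivot.

Section Decay.
Context {R : realType}.
Implicit Types (x y z t : R).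

Definition lorentz (t : R) : R := (1 + t ^+ 2)^-1.

Lemma lorentz_gt0 t : 0 < lorentz t.
Proof. by rewrite invr_gt0 ltr_wpDr ?sqr_ge0. Qed.

Lemma lorentz_ge0 t : 0 <= lorentz t. Proof. exact/ltW/lorentz_gt0. Qed.

(** The default value of [nth] sets the other five chart coordinates to 0, so the chart stays in a
    translate of N. *)
Definition box_row x y z : 'rV[R]_8 := \row_(k < 8) nth 0 [:: x; y; z] k.

Lemma box_rowE x y z (k : nat) : (k < 8)%N ->
  box_row x y z 0 (inord k) = nth 0 [:: x; y; z] k.
Proof. by move=> k8; rewrite mxE inordK. Qed.

Lemma chart_box (g : Gt R) x y z : chart g (box_row x y z) =
  tmul (tmul (tmul g (lift (nmx x y z))) (lift 1%:M)) (1%:M, false).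
Proof.
rewrite /chart !box_rowE//= subr0 oppr0 expR0.
by rewrite -/(tmx 1 1 1) tmx1 nmx0 conj_wl_lift1.
Qed.

Lemma chart_box1 (g : Gt R) x y z : (chart g (box_row x y z)).1 = g.1 *m nmx x y z.
Proof. by rewrite chart_box /= !mulmx1. Qed.

Lemma chart_one x y z : chart (lift 1%:M) (box_row x y z) = lift (nmx x y z).
Proof.
have E (h : 'M[R]_3) u v w : sigma (nmx u v w) h = false by exact: sigma_nmx.
by rewrite chart_box /tmul /= !mul1mx !mulmx1 -nmx0 !E.
Qed.

Definition weyl_lifts : seq (Gt R) := [seq lift P | P <- weyl_seq].

Lemma tG_weyl_lifts g : g \in weyl_lifts -> tG g.
Proof. by move=> /mapP[P /det_weyl dP ->]. Qed.

Lemma seminorm_box (f : section R) M g x y z (k : 'I_2) :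
  seminorm_le weyl_lifts 0 1 f M -> g \in weyl_lifts ->
  `|x| <= 1 -> `|y| <= 1 -> `|z| <= 1 ->
  nrm (f (chart g (box_row x y z)) k 0) <= 2 * M.
Proof.
move=> sf gW x1 y1 z1.
have [||h1 h2] := sf g [::] k (box_row x y z) gW; first by [].
  move=> l; rewrite mxE; case: l => [[|[|[|l]]] hl] //=.
  by rewrite nth_nil normr0.
by rewrite (le_trans (ler_nrm_ReIm _))// mulr2n mulrDl mul1r lerD.
Qed.

Lemma nrm_unit_part (e1 e2 : bool) (s : bool) (v : 'cV[R[i]]_2) (B : R) (k : 'I_2) :
  (forall j, nrm (v j 0) <= B) ->
  nrm ((((-1) ^+ s *: unit_part e1 e2) *m v) k 0) <= B.
Proof.
move=> vB; rewrite -scalemxAl mxE nrmM.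
have -> : nrm ((-1) ^+ s : R[i]) = 1.
  by case: s; rewrite ?expr1 ?expr0 ?nrmN nrm1.
have ni : nrm ('i%C : R[i]) = 1 by rewrite nrmE /= expr0n expr1n add0r sqrtr1.
rewrite mul1r.
have [->|->] : k = 0 \/ k = 1.
- by case: k => [[|[|k]] hk] //; [left|right]; apply: val_inj.
- rewrite /unit_part; case: e1; case: e2; rewrite mat2_col0;
  by rewrite ?mul0r ?mul1r ?add0r ?addr0 ?mulN1r ?mulNr ?nrmN ?nrmM ?ni ?mul1r.
- rewrite /unit_part; case: e1; case: e2; rewrite mat2_col1;
  by rewrite ?mul0r ?mul1r ?add0r ?addr0 ?mulN1r ?mulNr ?nrmN ?nrmM ?ni ?mul1r.
Qed.

Lemma nrm_weight2 (lam : 'rV[R[i]]_3) a b : 0 < a -> 0 < b ->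
  nrm (weight2 lam a b) = a `^ (-1 - complex.Re (lam 0 i0 - lam 0 i1)) *
                          b `^ (-1 - complex.Re (lam 0 i1 - lam 0 i2)).
Proof.
move=> a0 b0; rewrite /weight2 nrmM !nrm_cpow//.
have E (u v : R[i]) : complex.Re (-1 - u + v) = -1 - complex.Re (u - v).
  by case: u => u1 u2; case: v => v1 v2 /=; ring.
by rewrite !E.
Qed.

Lemma powR_decay (a : R) (s : R) (n : nat) : 1 <= a -> n%:R <= 1 + s ->
  a `^ (-1 - s) <= (a ^+ n)^-1.
Proof.
move=> a1 ns; have a0 : 0 <= a by lra.
rewrite -powR_mulrn// -powRN; apply: ler_powR => //; lra.
Qed.

(** The unipotent factor of the pivoted form stays in the unit box, where [M] bounds [f]; the rest
    of the decomposition contributes the weight, and the unknown sign of [section_value] does not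
    affect the norm. *)
Lemma fN_pivot (lam : 'rV[R[i]]_3) (f : section R) (M : R) x y z (k : 'I_2) :
  equivariant (- lam) (contragredient (@phi R)) f ->
  seminorm_le weyl_lifts 0 1 f M ->
  exists p t : R, [/\ 1 <= 2 * `|p| /\ `|x| <= 2 * `|p|,
    [/\ 1 <= `|t|, `|y| <= `|t| & `|z| <= `|t|] &
    nrm (restrN f k (x, y, z)) <= nrm (weight2 lam `|p| `|t|) * (2 * M)].
Proof.
move=> ef sf; have [P PW] := pivot_decomp x y z.
move=> [x1 [y1 [z1 [u [v [w [p [t [[X Y Z] [p1 p2] [t1 t2 t3] nE]]]]]]]]].
exists p, t; split => //.
have p0 : p != 0 by rewrite -normr_gt0; lra.
have t0 : t != 0 by rewrite -normr_gt0; lra.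
have PW' : lift P \in weyl_lifts by exact: map_f.
have tg : tG (chart (lift P) (box_row x1 y1 z1)).
  by rewrite /tG /mkset chart_box1 /= det_mulmx (det_weyl PW) det_nmx mulr1.
have abc : p^-1 * (p / t) * t = 1 by field; rewrite p0 t0.
have [e' eE] := section_value ef u v w abc tg.
rewrite /restrN /n3 /= nE; move: (eE false); rewrite chart_box1 => ->.
have -> : scale3 lam `|p^-1| `|p / t| `|t| = weight2 lam `|p| `|t|.
  have := @scale3_weight R lam (- p) (- t); rewrite !oppr_eq0 => /(_ p0 t0).
  by rewrite !opprK invrN mulrNN invf_div invrK !normrN.
rewrite mxE nrmM; apply: ler_wpM2l; first exact: nrm_ge0.
rewrite contragredient_phi; apply: nrm_unit_part => j.
exact: seminorm_box.
Qed.

(** 32 is 2 * 8 * 2: the constants of [B1] and [B2] in [restrN_le], and the 2 of [seminorm_box]. The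
    power of 2 is due to [p] being bounded below by 1/2 rather than by 1. *)
Definition decay_cst (lam : 'rV[R[i]]_3) : R :=
  32 * 2 `^ (1 + complex.Re (lam 0 i0 - lam 0 i1)).

(** The inverse sixth power of [t] is divided into a fourth power for y and a square for z. The
    second factor [lorentz y] is kept in reserve for the shear in [restrN_moved_le]. *)
Lemma restrN_le (lam : 'rV[R[i]]_3) (f : section R) (M : R) x y z (k : 'I_2) :
  equivariant (- lam) (contragredient (@phi R)) f ->
  5 < complex.Re (lam 0 i0 - lam 0 i1) -> 5 < complex.Re (lam 0 i1 - lam 0 i2) ->
  seminorm_le weyl_lifts 0 1 f M ->
  nrm (restrN f k (x, y, z)) <= decay_cst lam * M * (lorentz x * lorentz y ^+ 2 * lorentz z).
Proof.
move=> ef l1 l2 sf.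
(* The seminorm bound at a single point forces [M] to be nonnegative. *)
have M0 : 0 <= M.
  have := @seminorm_box f M (lift (nth 0 weyl_seq 0%N)) 0 0 0 0 sf.
  rewrite normr0 ler01 => H.
  have /H : lift (nth 0 weyl_seq 0%N) \in weyl_lifts.
    by apply: map_f; rewrite /weyl_seq /= !inE eqxx.
  move=> /(_ isT isT isT).
  by have := @nrm_ge0 R (f (chart (lift (nth 0 weyl_seq 0%N)) (box_row 0 0 0)) 0 0); lra.
have [p [t [[p1 p2] [t1 t2 t3] H]]] := fN_pivot x y z k ef sf.
apply: (le_trans H).
have p0 : 0 < `|p| by lra.
have t0 : 0 < `|t| by lra.
rewrite nrm_weight2//; set s1 := complex.Re _ in l1 *; set s2 := complex.Re _ in l2 *.
have xs : x ^+ 2 <= (2 * `|p|) ^+ 2 by rewrite -[x ^+ 2]real_normK ?num_real// lerXn2r ?nnegrE//; lra.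
have ys : y ^+ 2 <= `|t| ^+ 2 by rewrite -[y ^+ 2]real_normK ?num_real// lerXn2r ?nnegrE//.
have zs : z ^+ 2 <= `|t| ^+ 2 by rewrite -[z ^+ 2]real_normK ?num_real// lerXn2r ?nnegrE//.
have B1 : `|p| `^ (-1 - s1) <= 2 `^ (1 + s1) * (2 * lorentz x).
  have -> : `|p| `^ (-1 - s1) = 2 `^ (1 + s1) * (2 * `|p|) `^ (-1 - s1).
    rewrite powRM ?ler0n// mulrA -powRD ?pnatr_eq0 ?implybT//.
    by rewrite (_ : 1 + s1 + (-1 - s1) = 0) ?powRr0 ?mul1r//; ring.
  apply: ler_wpM2l; first exact: powR_ge0.
  apply: (@le_trans _ _ ((2 * `|p|) ^+ 2)^-1); first by apply: powR_decay => //; lra.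
  rewrite /lorentz -[2 in leRHS]invrK -invfM lef_pV2 ?posrE ?mulr_gt0 ?invr_gt0 ?exprn_gt0//; nra.
have B2 : `|t| `^ (-1 - s2) <= 8 * (lorentz y ^+ 2 * lorentz z).
  apply: (@le_trans _ _ (`|t| ^+ 6)^-1); first by apply: powR_decay => //; lra.
  rewrite /lorentz exprVn -invfM -[8]invrK -invfM lef_pV2 ?posrE; last 2 first.
  - by rewrite exprn_gt0.
  - by rewrite mulr_gt0 ?invr_gt0// mulr_gt0 ?exprn_gt0 ?ltr_wpDr ?sqr_ge0.
  set T := `|t| ^+ 2 in ys zs.
  have T1 : 1 <= T by rewrite exprn_ege1.
  have -> : `|t| ^+ 6 = T ^+ 3 by rewrite -exprM.
  have y2 : (1 + y ^+ 2) ^+ 2 <= (2 * T) ^+ 2.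
    by rewrite lerXn2r ?nnegrE ?addr_ge0 ?sqr_ge0//; nra.
  have z2 : 1 + z ^+ 2 <= 2 * T by lra.
  rewrite ler_pdivrMl//.
  have -> : 8 * T ^+ 3 = (2 * T) ^+ 2 * (2 * T) by ring.
  by apply: ler_pM; rewrite ?exprn_ge0 ?addr_ge0 ?sqr_ge0.
rewrite /decay_cst -/s1.
have M2 : 0 <= 2 * M by exact: mulr_ge0 (ler0n _ _) M0.
apply: (le_trans (ler_wpM2r M2 (ler_pM (powR_ge0 _ _) (powR_ge0 _ _) B1 B2))).
by rewrite le_eqVlt; apply/orP; left; apply/eqP; ring.
Qed.

Lemma lorentz_shift x t : `|t| <= 1 -> lorentz (x - t) <= 4 * lorentz x.
Proof.
rewrite ler_norml => /andP[t1 t2]; rewrite /lorentz -[4]invrK -invfM.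
rewrite lef_pV2 ?posrE ?mulr_gt0 ?invr_gt0 ?ltr_wpDr ?sqr_ge0//.
have tt : t ^+ 2 <= 1 by nra.
have a1 := sqr_ge0 (x - 2 * t); have a2 := sqr_ge0 (x - t).
rewrite ler_pdivrMl//; nra.
Qed.

(** The translation by [p] costs 4 in X, 4 ^ 2 in Y and 6 * (1 + Y ^ 2) in Z, and 4 * 16 * 6 = 384.
    The factor 1 + Y ^ 2 cancels one of the two factors [lorentz Y]. *)
Lemma restrN_moved_le (lam : 'rV[R[i]]_3) (f : section R) (M : R) (g : 'M[R]_3) p (k : 'I_2) :
  equivariant (- lam) (contragredient (@phi R)) f ->
  5 < complex.Re (lam 0 i0 - lam 0 i1) -> 5 < complex.Re (lam 0 i1 - lam 0 i2) ->
  seminorm_le weyl_lifts 0 1 f M -> unit_cube R p ->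
  nrm (restrN f k (moved g p)) <= decay_cst lam * M * 384 *
    (lorentz (pB1 g / pA1 g) * lorentz (pB2 g / pA2 g) * lorentz (pC2 g / pA2 g)).
Proof.
move=> ef l1 l2 sf; case: p => -[p q] r [[/=]]; rewrite !in_itv /=.
move=> /andP[p0 p1] /andP[q0 q1] /andP[r0 r1].
apply: (le_trans (restrN_le _ _ _ _ ef l1 l2 sf)); rewrite /moved /=.
set X := pB1 g / pA1 g; set Y := pB2 g / pA2 g; set Z := pC2 g / pA2 g.
have C0 : 0 <= decay_cst lam * M.
  have := le_trans (nrm_ge0 _) (restrN_le 0 0 0 0 ef l1 l2 sf).
  by rewrite /lorentz expr0n addr0 invr1 expr1n !mulr1.
rewrite -(mulrA _ 384); apply: ler_wpM2l => //.
have HX : lorentz (- X - p) <= 4 * lorentz X.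
  have -> : lorentz X = lorentz (- X) by rewrite /lorentz sqrrN.
  by apply: lorentz_shift; rewrite ger0_norm// ltW.
have HY : lorentz (Y - q) <= 4 * lorentz Y by apply: lorentz_shift; rewrite ger0_norm// ltW.
(* The displacement of the third coordinate; it is not bounded on the cube uniformly in [Y], but
   grows at most linearly in it. *)
set s := p * q - r - p * Y.
have HZ : lorentz (Z + p * q - r - p * Y) <= 6 * (1 + Y ^+ 2) * lorentz Z.
  have -> : Z + p * q - r - p * Y = Z + s by rewrite /s; ring.
  have y0 := sqr_ge0 Y; have z0 := sqr_ge0 Z.
  rewrite /lorentz -[6 * _]invrK -invfM lef_pV2 ?posrE ?mulr_gt0 ?invr_gt0 ?mulr_gt0 ?ltr_wpDr ?sqr_ge0//.
  rewrite ler_pdivrMl ?mulr_gt0 ?ltr_wpDr//.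
  have s2 : s ^+ 2 <= 2 + 2 * Y ^+ 2.
    have a1 : (p * q - r) ^+ 2 <= 1.
      have : -1 <= p * q - r <= 1 by apply/andP; split; nra.
      by move=> /andP[? ?]; nra.
    have a2 : (p * Y) ^+ 2 <= Y ^+ 2.
      by rewrite exprMn ler_piMl// expr_le1// ltW.
    have -> : s ^+ 2 = 2 * (p * q - r) ^+ 2 + 2 * (p * Y) ^+ 2 - (p * q - r + p * Y) ^+ 2.
      by rewrite /s; ring.
    move: a1 a2 (sqr_ge0 (p * q - r + p * Y)); clear.
    by move: (_ ^+ 2) ((p * Y) ^+ 2) ((p * q - r + p * Y) ^+ 2) (Y ^+ 2) => a b c d; lra.
  have zs : Z ^+ 2 <= 2 * (Z + s) ^+ 2 + 2 * s ^+ 2.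
    have -> : 2 * (Z + s) ^+ 2 + 2 * s ^+ 2 = Z ^+ 2 + (Z + 2 * s) ^+ 2 by ring.
    by rewrite lerDl sqr_ge0.
  move: zs (sqr_ge0 (Z + s)) s2 y0; clear.
  by move: (Z ^+ 2) ((Z + s) ^+ 2) (s ^+ 2) (Y ^+ 2) => a b c d; nra.
have step := ler_pM (mulr_ge0 (lorentz_ge0 _) (exprn_ge0 2 (lorentz_ge0 _))) (lorentz_ge0 _)
  (ler_pM (lorentz_ge0 _) (exprn_ge0 2 (lorentz_ge0 _)) HX
    (lerXn2r 2 (lorentz_ge0 _ : _ \in Num.nneg) (mulr_ge0 (ler0n _ 4) (lorentz_ge0 _) : _ \in Num.nneg) HY)) HZ.
apply: (le_trans step).
have yne : 1 + Y ^+ 2 != 0 by rewrite gt_eqF// ltr_wpDr ?sqr_ge0.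
rewrite le_eqVlt; apply/orP; left; apply/eqP; rewrite /lorentz; field.
by rewrite yne !gt_eqF// ltr_wpDr ?sqr_ge0.
Qed.

End Decay.

(** * Integrability and summability of the majorants *)

Section Convergence.
Context {R : realType}.
Local Notation mu := (@lebesgue_measure R).
Local Notation T1 := (measurableTypeR R).
Local Notation T3 := (T1 * T1 * T1)%type.
Local Notation mu3 := (@leb2 R \x mu)%E.

Lemma lorentzE (x : R) : lorentz x = (oneDsqr x)^-1.
Proof. by []. Qed.

Lemma lorentz_le1 (x : R) : lorentz x <= 1.
Proof. by rewrite lorentzE; exact: oneDsqrV_le1. Qed.

Lemma continuous_lorentz : continuous (@lorentz R).
Proof. exact: continuous_oneDsqrV. Qed.

Lemma measurable_lorentz : measurable_fun setT (@lorentz R).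
Proof. exact: continuous_measurable_fun continuous_lorentz. Qed.

Lemma integral_lorentz : (\int[mu]_x (lorentz x)%:E = pi%:E)%E.
Proof.
rewrite ge0_symfun_integralT; last 3 first.
- exact: lorentz_ge0.
- exact: continuous_lorentz.
- by move=> x; rewrite /= /lorentz sqrrN.
rewrite [X in (_ * X)%E](_ : _ = (pi / 2)%:E).
  by rewrite -EFinM mulrC divfK.
rewrite -(integral0y_oneDsqr R); congr integral.
by apply/seteqP; split => x /=; rewrite in_itv /= andbT.
Qed.

Lemma integrable_lorentz3 :
  mu3.-integrable setT (EFin \o (fun p : T3 => lorentz p.1.1 * lorentz p.1.2 * lorentz p.2)).
Proof.
have m1 : measurable_fun setT (fun q : T1 * T1 => lorentz q.1 * lorentz q.2).
  apply: measurable_funM.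
    exact: (measurableT_comp measurable_lorentz measurable_fst).
  exact: (measurableT_comp measurable_lorentz measurable_snd).
have m3 : measurable_fun setT (fun p : T3 => lorentz p.1.1 * lorentz p.1.2 * lorentz p.2).
  apply: measurable_funM; first exact: (measurableT_comp m1 measurable_fst).
  exact: (measurableT_comp measurable_lorentz measurable_snd).
pose h3 (p : T3) : T1 := lorentz p.1.1 * lorentz p.1.2 * lorentz p.2.
have n1 (x y : R) : 0 <= lorentz x * lorentz y by rewrite mulr_ge0 ?lorentz_ge0.
have Z (c : R) : 0 <= c -> (\int[mu]_x (c * lorentz x)%:E = c%:E * pi%:E)%E.
  move=> c0; under eq_integral do rewrite EFinM.
  rewrite ge0_integralZl//; last 2 first.
  - by apply/measurable_EFinP; exact: measurable_lorentz.
  - by move=> x _; rewrite lee_fin lorentz_ge0.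
  by rewrite integral_lorentz.
apply/integrableP; split; first exact/measurable_EFinP.
have -> : (\int[mu3]_p `|(EFin \o h3) p| = \int[mu3]_p (h3 p)%:E)%E.
  by apply: eq_integral => p _ /=; rewrite ger0_norm// mulr_ge0 ?lorentz_ge0.
have E3 := @leb3_tonelli R (EFin \o h3).
have -> : (\int[mu3]_p (h3 p)%:E =
    \int[leb2]_q ((lorentz q.1 * lorentz q.2)%:E * pi%:E))%E.
  etransitivity; first apply: E3.
  - exact/measurable_EFinP.
  - by move=> p; rewrite lee_fin mulr_ge0 ?lorentz_ge0.
  - by apply: eq_integral => q _; exact: (Z (lorentz q.1 * lorentz q.2) (n1 _ _)).
have E2 := @leb2_tonelli R (fun q : T1 * T1 => ((lorentz q.1 * lorentz q.2)%:E * pi%:E)%E).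
have -> : (\int[leb2]_q ((lorentz q.1 * lorentz q.2)%:E * pi%:E) =
   \int[mu]_x (lorentz x * (pi * pi))%:E)%E.
  etransitivity; first apply: E2.
  - apply: emeasurable_funM => //; exact/measurable_EFinP.
  - by move=> p; rewrite -EFinM lee_fin mulr_ge0 ?pi_ge0.
  - apply: eq_integral => x _ /=.
    transitivity (\int[mu]_y ((lorentz x * pi) * lorentz y)%:E)%E.
      by apply: eq_integral => y _; rewrite -EFinM mulrAC.
    by rewrite (Z (lorentz x * pi)) ?mulr_ge0 ?lorentz_ge0 ?pi_ge0// -EFinM mulrA.
apply: (@le_lt_trans _ _ (\int[mu]_x ((pi * pi) * lorentz x)%:E)%E).
  by rewrite le_eqVlt; apply/orP; left; apply/eqP; apply: eq_integral => x _; rewrite mulrC.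
by rewrite (Z (pi * pi)) ?mulr_ge0 ?pi_ge0// -EFinM ltry.
Qed.

(** Telescoping: [lorentz n] is at most 4 / ((n + 1) (n + 2)). *)
Lemma sum_lorentz_nat (N : nat) : \sum_(0 <= k < N) lorentz k%:R <= 4 - 4 / N.+1%:R :> R.
Proof.
elim: N => [|N IH]; first by rewrite big_geq// divr1 subrr.
rewrite big_nat_recr//=; apply: (le_trans (lerD IH (lexx _))).
have N0 : 0 <= N%:R :> R by rewrite ler0n.
have -> : N.+2%:R = N%:R + 2 :> R by rewrite -addn2 natrD.
have -> : N.+1%:R = N%:R + 1 :> R by rewrite -addn1 natrD.
move: (N%:R : R) N0 => n n0.
have -> : 4 - 4 / (n + 2) = 4 - 4 / (n + 1) + 4 / ((n + 1) * (n + 2)).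
  by field; rewrite !gt_eqF//; lra.
rewrite lerD2l /lorentz -[4]invrK -invfM lef_pV2 ?posrE; last 2 first.
- by rewrite ltr_wpDr ?sqr_ge0.
- by rewrite mulr_gt0 ?invr_gt0//; nra.
by rewrite ler_pdivrMl//; nra.
Qed.

Lemma rsummable_lorentz : rsummable [set: int] (fun k => lorentz (k%:~R : R)).
Proof.
apply/rsummable_ge0; first by move=> i _; exact: lorentz_ge0.
have N2 : (\esum_(n in [set: nat]) (lorentz (n%:R : R))%:E <= 4%:E)%E.
  rewrite -nneseries_esumT; last by move=> n; rewrite lee_fin lorentz_ge0.
  apply: lime_le; first by apply: is_cvg_nneseries => n _ _; rewrite lee_fin lorentz_ge0.
  apply: nearW => n; rewrite sumEFin lee_fin (le_trans (sum_lorentz_nat n))//.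
  by rewrite gerBl divr_ge0.
rewrite (esumID (range Posz)); last by move=> i _; rewrite lee_fin lorentz_ge0.
rewrite setTI setTI.
have -> : ~` range Posz = range Negz.
  apply/seteqP; split => [[n|n] /= H|k [n _ <-]] /=.
  - by exfalso; apply: H; exists n.
  - by exists n.
  - by case.
rewrite esum_image; last by move=> i j _ _ [].
rewrite esum_image; last by move=> i j _ _ [].
apply: (@le_lt_trans _ _ (4%:E + 4%:E)%E); last by rewrite -EFinD ltry.
apply: leeD.
  by apply: le_trans N2; apply: le_esum => n _; rewrite lexx.
(* [Negz n] is [- (n + 1)], and its term is dominated by the one at [n]. *)
apply: le_trans N2; apply: le_esum => n _; rewrite lee_fin NegzE.
rewrite mulrNz /lorentz sqrrN lef_pV2 ?posrE ?ltr_wpDr ?sqr_ge0// lerD2l.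
by rewrite lerXn2r ?nnegrE ?ler0n// ler_nat.
Qed.

Lemma rsummable_prod (I J : choiceType) (u : I -> R) (v : J -> R) :
  (forall i, 0 <= u i) -> (forall j, 0 <= v j) ->
  rsummable setT u -> rsummable setT v ->
  rsummable setT (fun k : I * J => u k.1 * v k.2).
Proof.
move=> u0 v0 su sv; apply/rsummable_ge0; first by move=> k _; rewrite mulr_ge0.
have -> : [set: I * J] = [set: I] `*`` (fun=> [set: J]).
  by apply/seteqP; split.
have E := @esum_esum R I J [set: I] (fun=> [set: J]) (fun i j => (u i * v j)%:E).
rewrite -E; last by move=> i j _ _; rewrite lee_fin mulr_ge0.
have fv : (\esum_(j in [set: J]) (v j)%:E < +oo)%E.
  exact: (rsummable_ge0 (fun j _ => v0 j)).1 sv.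
have -> : \esum_(i in [set: I]) \esum_(j in [set: J]) (u i * v j)%:E =
   \esum_(i in [set: I]) ((fine (\esum_(j in [set: J]) (v j)%:E))%:E * (u i)%:E)%E.
  apply: eq_esum => i _; under eq_esum do rewrite EFinM.
  rewrite esumZl// fineK ?esum_fin_num// muleC//.
rewrite esumZl; last 2 first.
- by apply: fine_ge0; apply: esum_ge0 => j _; rewrite lee_fin.
- by move=> i; rewrite lee_fin.
apply: lte_mul_pinfty => //.
- by rewrite lee_fin fine_ge0// esum_ge0// => j _; rewrite lee_fin.
- exact: (rsummable_ge0 (fun i _ => u0 i)).1 su.
Qed.

End Convergence.

Section Regularity.
Context {R : realType}.
Local Notation mu := (@lebesgue_measure R).
Local Notation T1 := (measurableTypeR R).
Local Notation T3 := (T1 * T1 * T1)%type.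
Local Notation mu3 := (@leb2 R \x mu)%E.

Lemma continuous_box_row :
  continuous (fun p : R * R * R => box_row p.1.1 p.1.2 p.2).
Proof.
have -> : (fun p : R * R * R => box_row p.1.1 p.1.2 p.2) = (fun p =>
    p.1.1 *: delta_mx 0 (inord 0) + p.1.2 *: delta_mx 0 (inord 1)
    + p.2 *: delta_mx 0 (inord 2) : 'rV[R]_8).
  apply/funext => p; apply/rowP => k; rewrite !mxE !eqxx /=.
  rewrite -!val_eqE /= !inordK//.
  case: k => [[|[|[|k]]] hk] /=; rewrite ?mulr1 ?mulr0 ?addr0 ?add0r//.
  by rewrite nth_nil.
have c1 : continuous (fun p : R * R * R => p.1.1).
  by move=> p; apply: (@continuous_comp _ _ _ fst fst); exact: cvg_fst.
have c2 : continuous (fun p : R * R * R => p.1.2).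
  move=> p; apply: (@continuous_comp _ _ _ fst snd); first exact: cvg_fst.
  exact: cvg_snd.
have c3 : continuous (fun p : R * R * R => p.2) by move=> p; exact: cvg_snd.
move=> p; apply: cvgD; first apply: cvgD; apply: cvgZr_tmp.
- exact: c1.
- exact: c2.
- exact: c3.
Qed.

Lemma smooth_continuous (m : nat) (F : 'rV[R]_m -> R) : smooth F -> continuous F.
Proof. by move=> /(_ [::])[]. Qed.

Lemma continuous_box_bounded (F : 'rV[R]_8 -> R) : continuous F ->
  exists M, forall v : 'rV[R]_8, (forall l, `|v 0 l| <= 1) -> `|F v| <= M.
Proof.
move=> cF.
have cB : compact [set v : 'rV[R]_8 | forall i, `[(-1 : R), 1]%classic (v ord0 i)].
  exact: (@rV_compact _ _ (fun=> `[(-1 : R), 1]%classic) (fun=> @segment_compact _ _ _)).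
have /compact_bounded[M [_ HM]] := continuous_compact (continuous_subspaceT cF) cB.
exists (M + 1) => v v1; apply: (HM (M + 1)); first by rewrite ltrDl.
by exists v => // i /=; rewrite in_itv /= -ler_norml v1.
Qed.

(** Only values on the unit box of six charts are involved, so continuity and compactness
    suffice. *)
Lemma seminorm_ex (f : section R) : smooth_section f ->
  exists M, seminorm_le weyl_lifts 0 1 f M.
Proof.
move=> sf.
suff H gs : {subset gs <= weyl_lifts} -> exists M, seminorm_le gs 0 1 f M.
  exact: H.
elim: gs => [|g gs IH] gsW; first by exists 0 => g.
have [|M HM] := IH; first by move=> x xgs; rewrite gsW// inE xgs orbT.
have tg : tG g by apply: tG_weyl_lifts; rewrite gsW// inE eqxx.
have [M1 H1] := continuous_box_bounded (smooth_continuous (proj1 (sf g 0 tg))).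
have [M2 H2] := continuous_box_bounded (smooth_continuous (proj2 (sf g 0 tg))).
have [M3 H3] := continuous_box_bounded (smooth_continuous (proj1 (sf g 1 tg))).
have [M4 H4] := continuous_box_bounded (smooth_continuous (proj2 (sf g 1 tg))).
exists (`|M| + `|M1| + `|M2| + `|M3| + `|M4|) => h al j v; rewrite inE.
have n0 := normr_ge0.
have [a b c d e] := And5 (n0 _ _ M) (n0 _ _ M1) (n0 _ _ M2) (n0 _ _ M3) (n0 _ _ M4).
have [a' b' c' d' e'] := And5 (ler_norm M) (ler_norm M1) (ler_norm M2) (ler_norm M3) (ler_norm M4).
case/orP => [/eqP -> |hgs] sal v1; last first.
  by have [u1 u2] := HM h al j v hgs sal v1; split; lra.
move: sal; rewrite leqn0 => /nilP -> /=.
have [->|->] : j = 0 \/ j = 1.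
- by case: j => [[|[|j]] hj] //; [left|right]; apply: val_inj.
- by have u1 := H1 v v1; have u2 := H2 v v1; split; lra.
- by have u1 := H3 v v1; have u2 := H4 v v1; split; lra.
Qed.

(** Along [box_row] the chart at the identity is the lift of N itself, so smoothness in that chart
    gives continuity in the coordinates of N. *)
Lemma cmeasurable_restrN (f : section R) k : smooth_section f -> cmeasurable (restrN f k).
Proof.
move=> sf; have tg : tG (lift (1%:M : 'M[R]_3)) by exact: det1.
have [/smooth_continuous c1 /smooth_continuous c2] := sf _ k tg.
split.
- have -> : @complex.Re R \o restrN f k = re_chart f (lift 1%:M) k \o
      (fun p : R * R * R => box_row p.1.1 p.1.2 p.2).
    by apply/funext => p; rewrite /= /re_chart chart_one.
  apply: continuous_measurable3 => p.
  apply: continuous_comp; [exact: continuous_box_row|exact: c1].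
- have -> : @complex.Im R \o restrN f k = im_chart f (lift 1%:M) k \o
      (fun p : R * R * R => box_row p.1.1 p.1.2 p.2).
    by apply/funext => p; rewrite /= /im_chart chart_one.
  apply: continuous_measurable3 => p.
  apply: continuous_comp; [exact: continuous_box_row|exact: c2].
Qed.

Lemma cmeasurable_psi (m1 m2 : int) :
  cmeasurable (fun p : R * R * R => psi m1 m2 (n3 p)).
Proof.
have mt : measurable_fun setT (fun p : T3 => 2 * pi * (m1%:~R * p.1.1 + m2%:~R * p.1.2)).
  apply: measurable_funM => //; apply: measurable_funD; apply: measurable_funM => //.
    exact: (measurableT_comp measurable_fst measurable_fst).
  exact: (measurableT_comp measurable_snd measurable_fst).
have E p : psi m1 m2 (n3 p) = e2pi (m1%:~R * p.1.1 + m2%:~R * p.1.2) :> R[i].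
  by rewrite /psi /n3 !mat3E.
split.
- have -> : @complex.Re R \o (fun p : R * R * R => psi m1 m2 (n3 p)) =
     cos \o (fun p : T3 => 2 * pi * (m1%:~R * p.1.1 + m2%:~R * p.1.2)).
    by apply/funext => p; exact: (congr1 (@complex.Re R) (E p)).
  apply: measurableT_comp => //; apply: continuous_measurable_fun => x; exact: continuous_cos.
- have -> : @complex.Im R \o (fun p : R * R * R => psi m1 m2 (n3 p)) =
     sin \o (fun p : T3 => 2 * pi * (m1%:~R * p.1.1 + m2%:~R * p.1.2)).
    by apply/funext => p; exact: (congr1 (@complex.Im R) (E p)).
  apply: measurableT_comp => //; apply: continuous_measurable_fun => x; exact: continuous_sin.
Qed.

Lemma cintegrable_restrN (lam : 'rV[R[i]]_3) (f : section R) k :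
  smooth_section f -> equivariant (- lam) (contragredient (@phi R)) f ->
  5 < complex.Re (lam 0 i0 - lam 0 i1) -> 5 < complex.Re (lam 0 i1 - lam 0 i2) ->
  cintegrable setT (restrN f k).
Proof.
move=> sf ef l1 l2; have [M HM] := seminorm_ex sf.
apply: (@cintegrable_le _ _ (fun p => decay_cst lam * M * (lorentz p.1.1 * lorentz p.1.2 * lorentz p.2))).
- exact: cmeasurable_restrN.
- case=> -[x y] z; apply: (le_trans (restrN_le x y z k ef l1 l2 HM)).
  have C0 : 0 <= decay_cst lam * M.
    have := le_trans (nrm_ge0 _) (restrN_le 0 0 0 0 ef l1 l2 HM).
    by rewrite /lorentz expr0n addr0 invr1 expr1n !mulr1.
  apply: ler_wpM2l => //; apply: ler_wpM2r; first exact: lorentz_ge0.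
  apply: ler_wpM2l; first exact: lorentz_ge0.
  by rewrite expr2 ler_piMl ?lorentz_ge0 ?lorentz_le1.
- apply: (eq_integrable measurableT _ _ _ (integrableZl measurableT (decay_cst lam * M) (@integrable_lorentz3 R))).
  by move=> p _; rewrite /= EFinM.
Qed.

Lemma psiV (m1 m2 : int) (p : R * R * R) :
  (psi m1 m2 (n3 p))^-1 = psi (- m1) (- m2) (n3 p) :> R[i].
Proof.
by rewrite /psi /n3 !mat3E e2piV; congr e2pi; rewrite !mulrNz; ring.
Qed.

Lemma nrm_psi (m1 m2 : int) (n : 'M[R]_3) : nrm (psi m1 m2 n) = 1.
Proof. exact: nrm_e2pi. Qed.

Lemma cintegrableM_psi (m1 m2 : int) (F : R * R * R -> R[i]) :
  cintegrable setT F -> cintegrable setT (fun p => F p * psi m1 m2 (n3 p)).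
Proof.
move=> IF; have mF := cintegrable_measurable IF.
have [I1 I2] := IF.
apply: (@cintegrable_le _ _ (fun p => `|complex.Re (F p)| + `|complex.Im (F p)|)).
- exact: cmeasurableM (cmeasurable_psi _ _).
- by move=> p; rewrite nrmM nrm_psi mulr1 ler_nrm_ReIm.
- exact: (integrableD measurableT (integrable_norm I1) (integrable_norm I2)).
Qed.

End Regularity.

(** * Cosets of the arithmetic group *)

Section Integral.
Implicit Types (g h k : 'M[int]_3) (C D : set 'M[int]_3).

Lemma Gamma_oo_nmx x y z : Gamma_oo (nmx x y z).
Proof. by exists x, y, z. Qed.

Lemma Gamma_ooM h k : Gamma_oo h -> Gamma_oo k -> Gamma_oo (h *m k).
Proof. by move=> [x [y [z ->]]] [x' [y' [z' ->]]]; rewrite mul_nmx; exact: Gamma_oo_nmx. Qed.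

Lemma Gamma_oo1 : Gamma_oo 1%:M.
Proof. by rewrite -nmx0; exact: Gamma_oo_nmx. Qed.

Lemma Gamma_oo_inv h : Gamma_oo h ->
  exists2 h', Gamma_oo h' & h' *m h = 1%:M /\ h *m h' = 1%:M.
Proof.
move=> [x [y [z ->]]]; exists (nmx (- x) (- y) (x * y - z)); first exact: Gamma_oo_nmx.
by rewrite !mul_nmx -nmx0; split; congr nmx; ring.
Qed.

Lemma GammaP g : Gamma g <-> [/\ \det g = 1,
  [/\ (4 %| g i0 i0 - 1)%Z, (4 %| g i1 i1 - 1)%Z & (4 %| g i2 i2 - 1)%Z] &
  [/\ (4 %| g i1 i0)%Z, (4 %| g i2 i0)%Z & (4 %| g i2 i1)%Z]].
Proof.
split => [[dg d1 d2]|[dg [a b c] [d e f]]].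
  by split => //; split => //; exact: d2.
split => // [l|l m].
  by case: l => [[|[|[|l]]] hl] //; [move: a|move: b|move: c];
    congr (is_true (4 %| g _ _ - 1)%Z); apply: val_inj.
by case: l => [[|[|[|l]]] hl]; case: m => [[|[|[|m]]] hm] //= _; [move: d|move: e|move: f];
  congr (is_true (4 %| g _ _)%Z); apply: val_inj.
Qed.

Lemma dvdzMD (a b x y : int) : (4 %| a)%Z -> (4 %| b)%Z -> (4 %| a * x + b * y)%Z.
Proof. by move=> ha hb; rewrite rpredD// dvdz_mulr. Qed.

Lemma Gamma_nmx_l g x y z : Gamma g -> Gamma (nmx x y z *m g).
Proof.
move=> /GammaP; rewrite [g]mat3_eta; move: (g i0 i0) (g i0 i1) (g i0 i2) (g i1 i0)
  (g i1 i1) (g i1 i2) (g i2 i0) (g i2 i1) (g i2 i2) => a b c d e f l m n.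
rewrite !mat3E => -[dg [h1 h2 h3] [h4 h5 h6]]; apply/GammaP.
split; first by rewrite det_mulmx det_nmx mul1r.
- rewrite mat3_mul !mat3E; split.
  + have -> : 1 * a + x * d + z * l - 1 = (a - 1) * 1 + (d * x + l * z) by ring.
    by rewrite rpredD ?dvdzMD// dvdz_mulr.
  + have -> : 0 * b + 1 * e + y * m - 1 = (e - 1) * 1 + m * y by ring.
    by rewrite dvdzMD.
  + by rewrite !mul0r !add0r mul1r.
- rewrite mat3_mul !mat3E; split.
  + have -> : 0 * a + 1 * d + y * l = d * 1 + l * y by ring.
    by rewrite dvdzMD.
  + by rewrite !mul0r !add0r mul1r.
  + by rewrite !mul0r !add0r mul1r.
Qed.

Lemma Gamma_nmx_r g x y z : Gamma g -> Gamma (g *m nmx x y z).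
Proof.
move=> /GammaP; rewrite [g]mat3_eta; move: (g i0 i0) (g i0 i1) (g i0 i2) (g i1 i0)
  (g i1 i1) (g i1 i2) (g i2 i0) (g i2 i1) (g i2 i2) => a b c d e f l m n.
rewrite !mat3E => -[dg [h1 h2 h3] [h4 h5 h6]]; apply/GammaP.
split; first by rewrite det_mulmx det_nmx mulr1.
- rewrite mat3_mul !mat3E; split.
  + by rewrite !mulr0 !addr0 mulr1.
  + have -> : d * x + e * 1 + f * 0 - 1 = d * x + (e - 1) * 1 by ring.
    by rewrite dvdzMD.
  + have -> : l * z + m * y + n * 1 - 1 = (l * z + m * y) + (n - 1) * 1 by ring.
    by rewrite rpredD ?dvdzMD// dvdz_mulr.
- rewrite mat3_mul !mat3E; split.
  + by rewrite !mulr0 !addr0 mulr1.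
  + by rewrite !mulr0 !addr0 mulr1.
  + have -> : l * x + m * 1 + n * 0 = l * x + m * 1 by ring.
    by rewrite dvdzMD.
Qed.

Lemma Gamma_dvd g : Gamma g -> [/\ pA1 g = 4 * A1 g, pB1 g = 4 * B1 g,
  pA2 g = 4 * A2 g & pB2 g = 4 * B2 g].
Proof.
move=> /GammaP[_ _ [d e f]].
have D (a : int) : (4 %| a)%Z -> a = 4 * (a %/ 4)%Z by move=> h; rewrite mulrC divzK.
split; apply: D; rewrite /pA1 /pB1 /pA2 /pB2 ?rpredN//.
- rewrite (_ : _ - _ = g i1 i0 * g i2 i1 + g i2 i0 * (- g i1 i1)); last by ring.
  exact: dvdzMD.
- rewrite (_ : _ - _ = g i1 i0 * g i2 i2 + g i2 i0 * (- g i1 i2)); last by ring.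
  exact: dvdzMD.
Qed.

Section Pluecker.
Variable (T : comNzRingType).

Lemma pluecker_l (g : 'M[T]_3) x y z : let g' := nmx x y z *m g in
  [/\ pA1 g' = pA1 g, pB1 g' = pB1 g & pC1 g' = pC1 g] /\
  [/\ pA2 g' = pA2 g, pB2 g' = pB2 g & pC2 g' = pC2 g].
Proof.
rewrite /= [g]mat3_eta mat3_mul /pA1 /pB1 /pC1 /pA2 /pB2 /pC2 !mat3E.
by split; split; ring.
Qed.

Lemma pluecker_r (g : 'M[T]_3) x y z : let g' := g *m nmx x y z in
  [/\ pA1 g' = pA1 g, pB1 g' = pB1 g + pA1 g * x & pA2 g' = pA2 g] /\
  [/\ pB2 g' = pB2 g - y * pA2 g &
    pC2 g' = pC2 g + (x * y - z) * pA2 g - x * pB2 g].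
Proof.
rewrite /= [g]mat3_eta mat3_mul /pA1 /pB1 /pC1 /pA2 /pB2 /pC2 !mat3E.
by split; split; ring.
Qed.

End Pluecker.

Section Real.
Context {R : realType}.

Lemma toR_nmx x y z : toR R (nmx x y z) = nmx x%:~R y%:~R z%:~R.
Proof.
rewrite [toR R _]mat3_eta [nmx x%:~R _ _]mat3_eta; congr mat3; rewrite !mxE //=.
Qed.

Lemma toRM g h : toR R (g *m h) = toR R g *m toR R h.
Proof. exact: map_mxM. Qed.

Lemma det_toR g : \det (toR R g) = (\det g)%:~R.
Proof. exact: det_map_mx. Qed.

Lemma toR_inj g h : toR R g = toR R h -> g = h.
Proof.
by move=> E; apply/matrixP => i j; have /matrixP/(_ i j) := E; rewrite !mxE; exact: intr_inj.
Qed.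

Lemma pluecker_toR g : [/\ pA1 (toR R g) = (pA1 g)%:~R, pB1 (toR R g) = (pB1 g)%:~R &
   pC1 (toR R g) = (pC1 g)%:~R] /\
  [/\ pA2 (toR R g) = (pA2 g)%:~R, pB2 (toR R g) = (pB2 g)%:~R &
   pC2 (toR R g) = (pC2 g)%:~R].
Proof.
rewrite /pA1 /pB1 /pC1 /pA2 /pB2 /pC2 !mxE.
by split; split; rewrite ?(rmorphN, rmorphB, rmorphM).
Qed.

(** Left unipotent factors do not change A_1 and A_2, and at [w_long *m b] these are, up to sign,
    products of diagonal entries of [b]. Conversely, [long_decomp] applies when both are nonzero. *)
Lemma big_cellP g : big_cell R g <-> [/\ Gamma g, pA1 g != 0 & pA2 g != 0].
Proof.
have [[a1 _ _] [a2 _ _]] := pluecker_toR g.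
split => [[Gg [n [b [[x [y [z ->]]] [db bz] gE]]]]|[Gg n1 n2]].
  have b10 : b i1 i0 = 0 by exact: bz.
  have b20 : b i2 i0 = 0 by exact: bz.
  have b21 : b i2 i1 = 0 by exact: bz.
  move: gE db; rewrite [b]mat3_eta b10 b20 b21 => gE db.
  have d3 : b i0 i0 * b i1 i1 * b i2 i2 = 1 by rewrite -db det_mat3; ring.
  have [c1 c2 c3] := prod3_neq0 d3.
  split => //.
    rewrite -(intr_eq0 R) -a1 gE w_longE !mat3_mul /pA1 !mat3E.
    by rewrite ?(mul0r, mulr0, add0r, addr0, mul1r, mulr1) oppr_eq0.
  rewrite -(intr_eq0 R) -a2 gE w_longE !mat3_mul /pA2 !mat3E.
  rewrite (_ : - (_ - _) = - (b i0 i0 * b i1 i1)); last by ring.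
  by rewrite oppr_eq0 mulf_neq0.
split => //.
have [dg _ _] := Gg.
have dR : \det (toR R g) = 1 by rewrite det_toR dg.
have m1 : pA1 (toR R g) != 0 by rewrite a1 intr_eq0.
have m2 : pA2 (toR R g) != 0 by rewrite a2 intr_eq0.
have [x [y [z gE]]] := long_decomp dR m1 m2.
exists (nmx x y z); eexists; split; last first.
- by rewrite {1}gE -mulmxA; reflexivity.
- split.
    rewrite det_mulmx det_nmx det_tmx mulr1.
    by move: (pA1 _) (pA2 _) m1 m2 => a b a0 b0; field; rewrite ?oppr_eq0 ?a0 ?b0.
  move=> i j; rewrite mat3_mul !mxE.
  by case: i => [[|[|[|i]]] hi]; case: j => [[|[|[|j]]] hj] //= _;
    rewrite ?(mul0r, mulr0, add0r, addr0).
- by exists x, y, z.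
Qed.

End Real.
End Integral.

(** * Left and double cosets in the big cell *)

Section Cosets.
Context {R : realType}.
Implicit Types (g h k : 'M[int]_3) (C D : set 'M[int]_3).
Local Notation LQ := (left_quotient Gamma_oo (big_cell R)).
Local Notation DQ a := (double_quotient Gamma_oo (Sset a.1 a.2)).

Definition lcos g : set 'M[int]_3 := [set h *m g | h in Gamma_oo].
Definition dcos g : set 'M[int]_3 :=
  [set h *m g *m k | h in Gamma_oo & k in Gamma_oo].

Lemma lcos_mem g : lcos g g.
Proof. by exists 1%:M; [exact: Gamma_oo1|rewrite mul1mx]. Qed.

Lemma dcos_mem g : dcos g g.
Proof. by exists 1%:M; [exact: Gamma_oo1|exists 1%:M; [exact: Gamma_oo1|rewrite mul1mx mulmx1]]. Qed.

Lemma lcos_eq g h : Gamma_oo h -> lcos (h *m g) = lcos g.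
Proof.
move=> Hh; have [h' Hh' [h'h hh']] := Gamma_oo_inv Hh.
apply/seteqP; split => [_ [u Hu <-]|_ [u Hu <-]].
  by exists (u *m h); [exact: Gamma_ooM|rewrite mulmxA].
exists (u *m h'); first exact: Gamma_ooM.
by rewrite -!mulmxA (mulmxA h') h'h mul1mx.
Qed.

Lemma dcos_eq g h k : Gamma_oo h -> Gamma_oo k -> dcos (h *m g *m k) = dcos g.
Proof.
move=> Hh Hk; have [h' Hh' [h'h hh']] := Gamma_oo_inv Hh.
have [k' Hk' [k'k kk']] := Gamma_oo_inv Hk.
apply/seteqP; split => [_ [u Hu [v Hv <-]]|_ [u Hu [v Hv <-]]].
  exists (u *m h); first exact: Gamma_ooM.
  by exists (k *m v); [exact: Gamma_ooM|rewrite !mulmxA].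
exists (u *m h'); first exact: Gamma_ooM.
exists (k' *m v); first exact: Gamma_ooM.
by rewrite -!mulmxA (mulmxA h') h'h mul1mx (mulmxA k) kk' mul1mx.
Qed.

Lemma Gamma_big_l h g : Gamma_oo h -> big_cell R g -> big_cell R (h *m g).
Proof.
move=> [x [y [z ->]]] /big_cellP[Gg a b]; apply/big_cellP.
by have [[-> _ _] [-> _ _]] := pluecker_l g x y z; split => //; exact: Gamma_nmx_l.
Qed.

Lemma Gamma_big_r k g : Gamma_oo k -> big_cell R g -> big_cell R (g *m k).
Proof.
move=> [x [y [z ->]]] /big_cellP[Gg a b]; apply/big_cellP.
by have [[-> _ ->] _] := pluecker_r g x y z; split => //; exact: Gamma_nmx_r.
Qed.

Lemma Sset_dcos (a : int * int) g h k : Gamma_oo h -> Gamma_oo k ->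
  Sset a.1 a.2 g -> Sset a.1 a.2 (h *m g *m k).
Proof.
move=> [x [y [z ->]]] [x' [y' [z' ->]]] [Gg e1 e2].
have [[a1 _ a2] _] := pluecker_r (nmx x y z *m g) x' y' z'.
have [[b1 _ _] [b2 _ _]] := pluecker_l g x y z.
by split; rewrite ?a1 ?a2 ?b1 ?b2//; apply: Gamma_nmx_r; exact: Gamma_nmx_l.
Qed.

Lemma Sset_big (a : int * int) g : a.1 != 0 -> a.2 != 0 -> Sset a.1 a.2 g -> big_cell R g.
Proof. by move=> a1 a2 [Gg e1 e2]; apply/big_cellP; rewrite e1 e2 !mulf_neq0. Qed.

Lemma LQ_repr C : LQ C -> big_cell R (coset_repr C) /\ C = lcos (coset_repr C).
Proof.
move=> [g bg <-]; rewrite -/(lcos g).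
have [h Hh hE] : lcos g (coset_repr (lcos g)) by apply: xgetPex; exists g; exact: lcos_mem.
by rewrite -hE lcos_eq//; split => //; exact: Gamma_big_l.
Qed.

Lemma DQ_repr (a : int * int) D : DQ a D ->
  Sset a.1 a.2 (coset_repr D) /\ D = dcos (coset_repr D).
Proof.
move=> [g Sg <-]; rewrite -/(dcos g).
have [h Hh [k Hk hE]] : dcos g (coset_repr (dcos g)).
  by apply: xgetPex; exists g; exact: dcos_mem.
by rewrite -hE dcos_eq//; split => //; exact: Sset_dcos.
Qed.

(** [pC1] is left out: the Pluecker relation determines it from the others when [pA2] is nonzero. *)
Definition pluecker5 g : int * int * int * int * int := (pA1 g, pA2 g, pB1 g, pB2 g, pC2 g).

(** Equal coordinates give equal diagonal and right unipotent parts in [long_decomp], so the two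
    matrices differ by a real unipotent factor on the left. That factor is integral, being a
    quotient of integral matrices of determinant 1. *)
Lemma pluecker5_lcos g g' : big_cell R g -> big_cell R g' -> pluecker5 g = pluecker5 g' ->
  exists2 h, Gamma_oo h & g' = h *m g.
Proof.
move=> /big_cellP[Gg a0 b0] /big_cellP[Gg' a0' b0'] [eA1 eA2 eB1 eB2 eC2].
have eC1 : pC1 g = pC1 g'.
  apply: (mulIf b0); have := pluecker_relation g; have := pluecker_relation g'.
  rewrite -eA1 -eA2 -eB1 -eB2 -eC2 => <- /eqP; rewrite -subr_eq0 => /eqP E.
  by apply/eqP; rewrite -subr_eq0 -E; apply/eqP; ring.
have [[d1 d2 d3] [d4 d5 d6]] := @pluecker_toR R g.
have [[d1' d2' d3'] [d4' d5' d6']] := @pluecker_toR R g'.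
have [dg _ _] := Gg; have [dg' _ _] := Gg'.
have dR : \det (toR R g) = 1 by rewrite det_toR dg.
have dR' : \det (toR R g') = 1 by rewrite det_toR dg'.
have m1 : pA1 (toR R g) != 0 by rewrite d1 intr_eq0.
have m2 : pA2 (toR R g) != 0 by rewrite d4 intr_eq0.
have m1' : pA1 (toR R g') != 0 by rewrite d1' intr_eq0.
have m2' : pA2 (toR R g') != 0 by rewrite d4' intr_eq0.
have [x [y [z gE]]] := long_decomp dR m1 m2.
have [x' [y' [z' gE']]] := long_decomp dR' m1' m2'.
rewrite d1' d2' d3' d4' d5' -eA1 -eA2 -eB1 -eB2 -eC1 in gE'.
rewrite d1 d2 d3 d4 d5 in gE.
have E : toR R g' = nmx (x' - x) (y' - y) (z' - z - (x' - x) * y) *m toR R g.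
  rewrite gE gE'; move: (w_long) => w; rewrite !mulmxA mul_nmx.
  by congr (nmx _ _ _ *m _ *m _ *m _); ring.
have ug : g \in unitmx by rewrite unitmxE dg unitr1.
have uR : toR R g \in unitmx by rewrite unitmxE dR unitr1.
pose h := g' *m invmx g.
have hg : g' = h *m g by rewrite /h mulmxKV.
have hR : toR R h = nmx (x' - x) (y' - y) (z' - z - (x' - x) * y).
  by rewrite -[LHS](mulmxK uR) -toRM -hg E mulmxK.
clearbody h; exists h => //; exists (h i0 i1), (h i1 i2), (h i0 i2); apply: (@toR_inj R).
have H i j : (h i j)%:~R = nmx (x' - x) (y' - y) (z' - z - (x' - x) * y) i j.
  by rewrite -hR /toR mxE.
by rewrite toR_nmx hR !H !mat3E.
Qed.

Lemma pluecker5_inj : {in LQ &, injective (pluecker5 \o coset_repr)}.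
Proof.
move=> C C' /set_mem LC /set_mem LC' /= E.
have [b1 ->] := LQ_repr LC; have [b2 ->] := LQ_repr LC'.
by have [h Hh ->] := pluecker5_lcos b1 b2 E; rewrite lcos_eq.
Qed.

Lemma countable_LQ : countable LQ.
Proof.
apply/countable_injP; exists (pickle \o pluecker5 \o coset_repr) => C C' LC LC' /=.
by move=> /(pcan_inj pickleK); exact: pluecker5_inj.
Qed.

Definition nonzero_pairs : set (int * int) := [set a | a.1 != 0 /\ a.2 != 0].

(** Coordinates on the left cosets: the pair (A_1, A_2), a double coset, and the element of
    [Gamma_oo] by which its representative is translated on the right. *)
Definition glue (x : ((int * int) * set 'M[int]_3) * (int * int * int)) : set 'M[int]_3 :=
  lcos (coset_repr x.1.2 *m nmx x.2.1.1 x.2.1.2 x.2.2).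

(** Injectivity says that right translation is free on the left cosets of the big cell: it changes
    B_1, B_2 and C_2 by multiples of the nonzero A_1, A_2 that reveal the translation. *)
Lemma glue_bij : set_bij ((nonzero_pairs `*`` (fun a => DQ a)) `*`` (fun=> setT)) LQ glue.
Proof.
split.
- move=> [[a D] m] /= [[[a1 a2] DD] _]; have [SD _] := DQ_repr DD.
  exists (coset_repr D *m nmx m.1.1 m.1.2 m.2) => //.
  by apply: Gamma_big_r; [exact: Gamma_oo_nmx|exact: Sset_big SD].
- move=> [[a D] m] [[a' D'] m'] /set_mem[[/= [a1 a2] DD] _].
  move=> /set_mem[[/= [a1' a2'] DD'] _]; rewrite /glue /=.
  have [SD DE] := DQ_repr DD; have [SD' DE'] := DQ_repr DD'.
  set g := coset_repr D in SD DE *; set g' := coset_repr D' in SD' DE' *.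
  move=> E; have : lcos (g *m nmx m.1.1 m.1.2 m.2) (g' *m nmx m'.1.1 m'.1.2 m'.2).
    by rewrite E; exact: lcos_mem.
  move=> [h Hh hE].
  have [k' Hk' [k'k kk']] := Gamma_oo_inv (Gamma_oo_nmx m'.1.1 m'.1.2 m'.2).
  have g'E : g' = h *m g *m (nmx m.1.1 m.1.2 m.2 *m k').
    by rewrite mulmxA -(mulmxA h) hE -mulmxA kk' mulmx1.
  have DD2 : D' = D.
    by rewrite DE' g'E DE dcos_eq//; apply: Gamma_ooM => //; exact: Gamma_oo_nmx.
  have gg : g' = g by rewrite /g' DD2.
  have [x [y [z hxyz]]] := Hh; move: hE; rewrite hxyz gg => hE.
  have [[r1 r2 r3] [r4 r5]] := pluecker_r g m'.1.1 m'.1.2 m'.2.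
  have [[s1 s2 s3] [s4 s5]] := pluecker_r g m.1.1 m.1.2 m.2.
  have [[l1 l2 l3] [l4 l5 l6]] := pluecker_l (g *m nmx m.1.1 m.1.2 m.2) x y z.
  rewrite hE in l1 l2 l3 l4 l5 l6.
  have [_ eg1 eg2] := SD; have [_ eg1' eg2'] := SD'; rewrite gg eg1 eg2 in eg1' eg2'.
  have ea : a = a'.
    by rewrite [a]surjective_pairing [a']surjective_pairing; congr pair;
      apply: (mulfI (_ : 4 != 0 :> int)).
  have n1 : pA1 g != 0 by rewrite eg1 mulf_neq0.
  have n2 : pA2 g != 0 by rewrite eg2 mulf_neq0.
  have e1 : m'.1.1 = m.1.1.
    by apply: (mulfI n1); apply: (addrI (pB1 g)); rewrite -r2 l2 s2.
  have e2 : m'.1.2 = m.1.2.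
    apply: (mulIf n2); apply: oppr_inj; apply: (addrI (pB2 g)).
    by rewrite -r4 l5 s4.
  (* [pC2] is compared last, since its change also involves the first two parameters. *)
  have e3 : m'.2 = m.2.
    move: l6; rewrite r5 s5 e1 e2 => /(addIr) /(addrI) /(mulIf n2) /addrI.
    exact: oppr_inj.
  have em : m' = m by apply: injective_projections => //; apply: injective_projections.
  by rewrite ea DD2 em.
- move=> C LC; have [bC CE] := LQ_repr LC; set g := coset_repr C in bC CE.
  have [Gg n1 n2] := (big_cellP g).1 bC.
  have [e1 _ e2 _] := Gamma_dvd Gg.
  pose a := (A1 g, A2 g).
  have Sg : Sset a.1 a.2 g by split.
  have na : nonzero_pairs a.
    by split; [move: n1; rewrite e1|move: n2; rewrite e2]; rewrite mulf_eq0 negb_or => /andP[].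
  have DD : DQ a (dcos g) by exists g.
  have [SD DE] := DQ_repr DD.
  have [h Hh [k Hk hE]] : dcos g (coset_repr (dcos g)).
    by apply: xgetPex; exists g; exact: dcos_mem.
  have [k' [x [y [z k'E]]] [k'k kk']] := Gamma_oo_inv Hk.
  exists ((a, dcos g), (x, y, z)) => //.
  rewrite /glue /= -k'E -hE -mulmxA kk' mulmx1 lcos_eq//.
Qed.

(** Right translation reduces [pB1] modulo [pA1], and [pB2], [pC2] modulo [pA2], which leaves
    finitely many values of [pluecker5]. *)
Lemma finite_DQ (a : int * int) : nonzero_pairs a -> finite_set (DQ a).
Proof.
move=> [a1 a2].
pose N := (absz (4 * a.1)%R + absz (4 * a.2)%R)%N.
pose I : set int := Posz @` `I_N.
have fI : finite_set I by apply: finite_image; exact: finite_II.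
pose sel (x : int * int * int) := xget 0 [set g | Sset a.1 a.2 g /\
  [/\ pB1 g = x.1.1, pB2 g = x.1.2 & pC2 g = x.2]].
apply: (@sub_finite_set _ _ ((dcos \o sel) @` ((I `*` I) `*` I))); last first.
  by apply: finite_image; do 2 (apply: finite_setX => //).
move=> D DD; have [SD DE] := DQ_repr DD.
set g := coset_repr D in SD DE.
have [Gg e1 e2] := SD.
have n1 : pA1 g != 0 by rewrite e1 mulf_neq0.
have n2 : pA2 g != 0 by rewrite e2 mulf_neq0.
have modI (x d : int) : d != 0 -> (absz d <= N)%N -> I (x %% d)%Z.
  move=> d0 dN; have m0 := modz_ge0 x d0; have ml := ltz_mod x d0.
  exists (absz (x %% d)%Z); last by rewrite gez0_abs.
  rewrite /= -ltz_nat gez0_abs// (lt_le_trans ml)// -abszE lez_nat//.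
(* [i] and [j] reduce [pB1] and [pB2]. [c] is [pC2] after the contribution of [i] and [pB2], and the
   summand [i * j] of [k] cancels the product term of [pluecker_r]. *)
pose i := - (pB1 g %/ pA1 g)%Z; pose j := (pB2 g %/ pA2 g)%Z.
pose c := pC2 g - i * pB2 g; pose k := i * j + (c %/ pA2 g)%Z.
pose g1 := g *m nmx i j k.
have [[r1 r2 r3] [r4 r5]] := pluecker_r g i j k.
have S1 : Sset a.1 a.2 g1.
  by have := Sset_dcos Gamma_oo1 (Gamma_oo_nmx i j k) SD; rewrite mul1mx.
have q1 : pB1 g1 = (pB1 g %% pA1 g)%Z by rewrite r2 /i {1}(divz_eq (pB1 g) (pA1 g)); ring.
have q2 : pB2 g1 = (pB2 g %% pA2 g)%Z by rewrite r4 /j {1}(divz_eq (pB2 g) (pA2 g)); ring.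
have q3 : pC2 g1 = (c %% pA2 g)%Z.
  have := divz_eq c (pA2 g); rewrite r5 /k {1}/c => ce.
  by rewrite -[RHS](addKr ((c %/ pA2 g)%Z * pA2 g)) -ce; ring.
pose x := (pB1 g1, pB2 g1, pC2 g1).
exists x.
  split => /=; first split => /=; rewrite ?q1 ?q2 ?q3; apply: modI => //;
  by rewrite ?e1 ?e2 ?leq_addr ?leq_addl.
have [Ss [s1 s2 s3]] : Sset a.1 a.2 (sel x) /\
  [/\ pB1 (sel x) = x.1.1, pB2 (sel x) = x.1.2 & pC2 (sel x) = x.2].
  have := @xgetPex _ (0 : 'M[int]_3) [set g | Sset a.1 a.2 g /\
    [/\ pB1 g = x.1.1, pB2 g = x.1.2 & pC2 g = x.2]].
  by apply; exists g1.
have kE : pluecker5 g1 = pluecker5 (sel x).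
  by rewrite /pluecker5 s1 s2 s3 /=; have [_ -> ->] := S1; have [_ -> ->] := Ss.
have [h Hh hE] := pluecker5_lcos (Sset_big a1 a2 S1) (Sset_big a1 a2 Ss) kE.
rewrite /= hE DE /g1 mulmxA; apply: dcos_eq => //; exact: Gamma_oo_nmx.
Qed.

End Cosets.

(** * Convergence and continuity of the Eisenstein series *)

Section Eisenstein.
Context {R : realType}.
Variable s : 'M[int]_3 -> bool.
Local Notation LQ := (left_quotient Gamma_oo (big_cell R)).
Implicit Types (lam : 'rV[R[i]]_3) (f : section R) (g r : 'M[int]_3) (p : R * R * R).

Definition big_cell_term lam f r p : R[i] :=
  (-1) ^+ s r * weight2 lam `|pA1 (toR R r)| `|pA2 (toR R r)| *
  (sign_factor (0 < pA1 (toR R r)) (0 < pA2 (toR R r)) *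
   restrN f (sign_component (0 < pA1 (toR R r))) (moved (toR R r) p)).

(** Makes the untranslated series the case p = 0 of the translated one. *)
Lemma tmul_origin (u : Gt R) : tmul (tinv (lift (n3 (0, 0, 0)))) u = u.
Proof.
case: u => m b; rewrite /n3 tinv_nmx /tmul /= oppr0 mulr0 addr0 sigma_nmx nmx0.
by rewrite mul1mx addbF.
Qed.

Lemma big_cell_toR r : big_cell R r ->
  [/\ \det (toR R r) = 1, pA1 (toR R r) != 0 & pA2 (toR R r) != 0].
Proof.
move=> /big_cellP[[dr _ _] a b]; have [[-> _ _] [-> _ _]] := @pluecker_toR R r.
by rewrite det_toR dr !intr_eq0.
Qed.

Lemma big_cell_term_value lam f r p : equivariant (- lam) (contragredient (@phi R)) f ->
  big_cell R r ->
  f (tmul (tinv (lift (n3 p))) (tmul (tinv (tinv (tinv (splitting R s r)))) (lift w_long))) 0 0 =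
  big_cell_term lam f r p.
Proof. by move=> ef /big_cell_toR[d a b]; exact: big_cell_value. Qed.

Lemma eisenstein_term_value lam f C : equivariant (- lam) (contragredient (@phi R)) f ->
  LQ C -> pairing f (eisenstein_term s C) = big_cell_term lam f (coset_repr C) (0, 0, 0).
Proof.
move=> ef /LQ_repr[bC _]; rewrite -(big_cell_term_value _ ef bC) tmul_origin.
by [].
Qed.

Definition lorentz5 (k : int * int * int * int * int) : R :=
  lorentz k.1.1.1.1%:~R * lorentz k.1.1.1.2%:~R * lorentz k.1.1.2%:~R * lorentz k.1.2%:~R * lorentz k.2%:~R.

Lemma rsummable_lorentz5 : rsummable setT lorentz5.
Proof.
have h0 (k : int) : 0 <= lorentz (k%:~R : R) by exact: lorentz_ge0.
have s1 := @rsummable_lorentz R.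
have s2 := rsummable_prod h0 h0 s1 s1.
have n2 (k : int * int) : 0 <= lorentz (k.1%:~R : R) * lorentz k.2%:~R by rewrite mulr_ge0.
have s3 := rsummable_prod n2 h0 s2 s1.
have n3 (k : int * int * int) :
  0 <= lorentz (k.1.1%:~R : R) * lorentz k.1.2%:~R * lorentz k.2%:~R by rewrite mulr_ge0.
have s4 := rsummable_prod n3 h0 s3 s1.
have n4 (k : int * int * int * int) :
  0 <= lorentz (k.1.1.1%:~R : R) * lorentz k.1.1.2%:~R * lorentz k.1.2%:~R * lorentz k.2%:~R.
  by rewrite mulr_ge0.
exact: (rsummable_prod n4 h0 s4 s1).
Qed.

Lemma rsummable_pluecker5 : rsummable LQ (fun C => lorentz5 (pluecker5 (coset_repr C))).
Proof.
have h0 k : 0 <= lorentz5 k by rewrite /lorentz5 !mulr_ge0 ?lorentz_ge0.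
apply/rsummable_ge0 => //.
rewrite -(esum_image LQ (fun C => pluecker5 (coset_repr C)) (fun k => (lorentz5 k)%:E)); last first.
  exact: pluecker5_inj.
have /(rsummable_ge0 (fun k _ => h0 k)) := rsummable_lorentz5.
apply: le_lt_trans; rewrite [leRHS](esumID ((fun C => pluecker5 (coset_repr C)) @` LQ)); last first.
  by move=> k _; rewrite lee_fin.
by rewrite setTI; apply: leeDl; apply: esum_ge0 => k _; rewrite lee_fin.
Qed.

Lemma lorentz_div (x a : R) : 1 <= `|a| -> lorentz (x / a) <= a ^+ 2 * lorentz x.
Proof.
move=> a1; have a2 : 1 <= a ^+ 2 by rewrite -real_normK ?num_real// exprn_ege1.
have a0 : 0 < a ^+ 2 by lra.
have x0 := sqr_ge0 x.
rewrite /lorentz -[a ^+ 2 in leRHS]invrK -invfM lef_pV2 ?posrE; last 2 first.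
- by rewrite ltr_wpDr ?sqr_ge0.
- by rewrite mulr_gt0 ?invr_gt0// ltr_wpDr.
rewrite exprMn exprVn mulrC [leRHS](_ : _ = (a ^+ 2 + x ^+ 2) / a ^+ 2).
  by rewrite ler_pM2r ?invr_gt0//; lra.
by field; rewrite -normr_gt0; lra.
Qed.

Lemma int_norm_ge1 (a : int) : a != 0 -> 1 <= `|a%:~R : R|.
Proof. by move=> a0; rewrite -intr_norm ler1z -gtz0_ge1 normr_gt0. Qed.

Lemma lorentz_pow (a : R) (n : nat) : 1 <= `|a| ->
  (`|a| ^+ (n + 2))^-1 * `|a| ^+ n <= 2 * lorentz a.
Proof.
move=> a1; have a0 : `|a| != 0 by rewrite gt_eqF//; lra.
have a2 : 1 <= a ^+ 2 by rewrite -real_normK ?num_real// exprn_ege1.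
rewrite exprD invfM mulrC mulrA mulfV ?expf_neq0// mul1r real_normK ?num_real//.
rewrite /lorentz -[2 in leRHS]invrK -invfM lef_pV2 ?posrE; last 2 first.
- by lra.
- by rewrite mulr_gt0 ?invr_gt0// ltr_wpDr ?sqr_ge0.
by rewrite ler_pdivrMl//; lra.
Qed.

(** 384 comes from [restrN_moved_le]; 4 is 2 * 2, from [lorentz_pow] used for A_1 and for A_2. *)
Definition eisenstein_cst lam : R := decay_cst lam * 384 * 4.

(** Replacing the quotients of Pluecker coordinates by their numerators costs the square of [a] for
    one quotient and the fourth power of [b] for two. The weight supplies inverse powers 2 + 2 and 4
    + 2, and the remaining squares give [lorentz a] and [lorentz b]. *)
Lemma big_cell_term_le lam f (M : R) r p : equivariant (- lam) (contragredient (@phi R)) f ->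
  5 < complex.Re (lam 0 i0 - lam 0 i1) -> 5 < complex.Re (lam 0 i1 - lam 0 i2) ->
  seminorm_le weyl_lifts 0 1 f M -> big_cell R r -> unit_cube R p ->
  nrm (big_cell_term lam f r p) <= eisenstein_cst lam * M * lorentz5 (pluecker5 r).
Proof.
move=> ef l1 l2 sf br Cp; have [_ n1 n2] := (big_cellP r).1 br.
rewrite /big_cell_term; set k := sign_component _.
have := restrN_moved_le (toR R r) k ef l1 l2 sf Cp.
have [[-> -> _] [-> -> ->]] := @pluecker_toR R r.
have := int_norm_ge1 n1; have := int_norm_ge1 n2; rewrite /lorentz5 /pluecker5 /=.
move: ((pA1 r)%:~R : R) ((pA2 r)%:~R : R) ((pB1 r)%:~R : R) ((pB2 r)%:~R : R)
  ((pC2 r)%:~R : R) => a b x y z b1 a1 H.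
have C0 : 0 <= decay_cst lam * M.
  have := le_trans (nrm_ge0 _) (restrN_le 0 0 0 0 ef l1 l2 sf).
  by rewrite /lorentz expr0n addr0 invr1 expr1n !mulr1.
have ap : 0 < `|a| by lra.
have bp : 0 < `|b| by lra.
rewrite nrmM (nrmM (_ ^+ _)) (nrmM (sign_factor _ _)) nrm_weight2//.
have -> : nrm ((-1) ^+ s r : R[i]) = 1.
  by case: (s r); rewrite ?expr1 ?expr0 ?nrmN nrm1.
have -> : nrm (sign_factor (0 < a) (0 < b) : R[i]) = 1.
  rewrite /sign_factor; case: ifP => _; rewrite ?nrm1//.
  by rewrite nrmE /= expr0n expr1n add0r sqrtr1.
rewrite !mul1r; set s1 := complex.Re _ in l1 *; set s2 := complex.Re _ in l2 *.
have P1 : `|a| `^ (-1 - s1) <= (`|a| ^+ (2 + 2))^-1 by apply: powR_decay => //; lra.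
have P2 : `|b| `^ (-1 - s2) <= (`|b| ^+ (4 + 2))^-1 by apply: powR_decay => //; lra.
have Q1 := lorentz_div x a1; have Q2 := lorentz_div y b1; have Q3 := lorentz_div z b1.
have G1 := lorentz_pow 2 a1; have G2 := lorentz_pow 4 b1.
have h0 := @lorentz_ge0 R.
have F1 : nrm (restrN f k (moved (toR R r) p)) <= decay_cst lam * M * 384 *
    (`|a| ^+ 2 * `|b| ^+ 4 * (lorentz x * lorentz y * lorentz z)).
  apply: (le_trans H); apply: ler_wpM2l; first exact: mulr_ge0 C0 (ler0n _ _).
  have := ler_pM (mulr_ge0 (h0 _) (h0 _)) (h0 _) (ler_pM (h0 _) (h0 _) Q1 Q2) Q3.
  move=> /le_trans; apply; rewrite le_eqVlt; apply/orP; left; apply/eqP.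
  rewrite (_ : `|b| ^+ 4 = b ^+ 2 * b ^+ 2); last first.
    by rewrite -[b ^+ 2]real_normK ?num_real// -exprD.
  by rewrite -[`|a| ^+ 2]real_normK ?num_real// normr_id real_normK ?num_real//; ring.
have step := ler_pM (mulr_ge0 (powR_ge0 _ _) (powR_ge0 _ _)) (nrm_ge0 _)
  (ler_pM (powR_ge0 _ _) (powR_ge0 _ _) P1 P2) F1.
apply: (le_trans step).
have -> : (`|a| ^+ (2 + 2))^-1 * (`|b| ^+ (4 + 2))^-1 * (decay_cst lam * M * 384 *
    (`|a| ^+ 2 * `|b| ^+ 4 * (lorentz x * lorentz y * lorentz z))) =
  decay_cst lam * M * 384 * (((`|a| ^+ (2 + 2))^-1 * `|a| ^+ 2) *
    ((`|b| ^+ (4 + 2))^-1 * `|b| ^+ 4) * (lorentz x * lorentz y * lorentz z)).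
  move: ((`|a| ^+ (2 + 2))^-1) ((`|b| ^+ (4 + 2))^-1) (`|a| ^+ 2) (`|b| ^+ 4).
  by move=> *; ring.
have -> : eisenstein_cst lam * M * (lorentz a * lorentz b * lorentz x * lorentz y * lorentz z) =
  decay_cst lam * M * 384 * ((2 * lorentz a) * (2 * lorentz b) * (lorentz x * lorentz y * lorentz z)).
  by rewrite /eisenstein_cst; ring.
apply: ler_wpM2l; first exact: mulr_ge0 C0 (ler0n _ _).
apply: ler_wpM2r; first by rewrite !mulr_ge0.
by apply: ler_pM => //; rewrite mulr_ge0// ?invr_ge0 exprn_ge0.
Qed.

Lemma csummable_big_cell_term lam f p : smooth_section f ->
  equivariant (- lam) (contragredient (@phi R)) f ->
  5 < complex.Re (lam 0 i0 - lam 0 i1) -> 5 < complex.Re (lam 0 i1 - lam 0 i2) ->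
  unit_cube R p -> csummable LQ (fun C => big_cell_term lam f (coset_repr C) p).
Proof.
move=> sf ef l1 l2 Cp; have [M HM] := seminorm_ex sf.
apply: (csummable_le _ (rsummableZ (eisenstein_cst lam * M) rsummable_pluecker5)) => C LC.
by apply: big_cell_term_le => //; exact: (LQ_repr LC).1.
Qed.

Lemma origin_cube : unit_cube R (0, 0, 0).
Proof. by split; [split|] => /=; rewrite in_itv /= lexx ltr01. Qed.

Lemma csummable_eisenstein lam f : Vsmooth (- lam) (contragredient (@phi R)) f ->
  5 < complex.Re (lam 0 i0 - lam 0 i1) -> 5 < complex.Re (lam 0 i1 - lam 0 i2) ->
  csummable LQ (fun C => pairing f (eisenstein_term s C)).
Proof.
move=> [sf ef] l1 l2; have S := csummable_big_cell_term sf ef l1 l2 origin_cube.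
apply: eq_csummable S => C /set_mem LC.
by rewrite (eisenstein_term_value ef LC).
Qed.

(** The bound on each term is linear in the seminorm bound [M], so the summed bound is itself the
    continuity estimate, with derivatives of order 0 only. *)
Lemma Vdist_eisenstein lam :
  5 < complex.Re (lam 0 i0 - lam 0 i1) -> 5 < complex.Re (lam 0 i1 - lam 0 i2) ->
  Vdist lam (eisenstein s).
Proof.
move=> l1 l2; split.
  move=> c f h Vf Vh; rewrite /eisenstein.
  have Sf := csummable_eisenstein Vf l1 l2; have Sh := csummable_eisenstein Vh l1 l2.
  rewrite -csumZ// -csumD//; last exact: csummableZ.
  by apply: eq_csum => C _; rewrite /pairing /eisenstein_term /act_dist /pairing /tau /act !mxE.
exists weyl_lifts, 0%N, 1,
  (2 * (eisenstein_cst lam * fine (\esum_(C in LQ) (lorentz5 (pluecker5 (coset_repr C)))%:E))).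
split; first exact: tG_weyl_lifts.
move=> f M [sf ef] HM; rewrite -/(nrm _).
have h0 k : 0 <= lorentz5 k by rewrite /lorentz5 !mulr_ge0 ?lorentz_ge0.
have fin : (\esum_(C in LQ) (lorentz5 (pluecker5 (coset_repr C)))%:E < +oo)%E.
  exact: (rsummable_ge0 (fun C _ => h0 _)).1 rsummable_pluecker5.
have C0 : 0 <= eisenstein_cst lam * M.
  have := le_trans (nrm_ge0 _) (restrN_le 0 0 0 0 ef l1 l2 HM).
  rewrite /lorentz expr0n addr0 invr1 expr1n !mulr1 => d0.
  have -> : eisenstein_cst lam * M = decay_cst lam * M * (384 * 4) by rewrite /eisenstein_cst; ring.
  exact: mulr_ge0 d0 (mulr_ge0 (ler0n _ _) (ler0n _ _)).
set S := \esum_(C in LQ) _ in fin *.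
have H : nrm (eisenstein s f) <= 2 * (eisenstein_cst lam * M * fine S).
  apply: (@ler_nrm_csum _ _ _ _ (fun C => eisenstein_cst lam * M * lorentz5 (pluecker5 (coset_repr C)))).
    move=> C LC; rewrite (eisenstein_term_value ef LC).
    by apply: big_cell_term_le => //; [exact: (LQ_repr LC).1|exact: origin_cube].
  have SE : (fine S)%:E = S by rewrite fineK// esum_fin_num.
  rewrite EFinM SE /S -esumZl//; last by move=> C; rewrite lee_fin.
by apply: (le_trans H); rewrite le_eqVlt; apply/orP; left; apply/eqP; ring.
Qed.

End Eisenstein.

(** * Unfolding *)

Section Periodicity.
Context {R : realType}.
Implicit Types (p : R * R * R) (f : section R).

Lemma cos_sin_2pi_nat (n : nat) :
  cos (2 * pi * n%:R : R) = 1 /\ sin (2 * pi * n%:R : R) = 0.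
Proof.
elim: n => [|n [IHc IHs]]; first by rewrite mulr0 cos0 sin0.
have e : 2 * pi = pi *+ 2 :> R by rewrite mulr_natl.
have e1 : 2 * pi * n.+1%:R = 2 * pi * n%:R + pi *+ 2 :> R by rewrite -e -natr1; ring.
rewrite e1 (cosD _ (pi *+ 2)) (sinD _ (pi *+ 2)) IHc IHs cos2pi sin2pi.
by rewrite !mul0r !mulr1 subr0 mulr0 addr0.
Qed.

Lemma e2pi_int (m : int) : e2pi (m%:~R : R) = 1.
Proof.
have N (n : nat) : e2pi (n%:R : R) = 1.
  by rewrite /e2pi; have [-> ->] := cos_sin_2pi_nat n.
case: m => n; first exact: N.
by rewrite NegzE mulrNz -e2piV N invr1.
Qed.

Lemma e2pi_periodic (x : R) (m : int) : e2pi (x + m%:~R) = e2pi x.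
Proof. by rewrite e2piD e2pi_int mulr1. Qed.

Lemma psiE (m1 m2 : int) p : psi m1 m2 (n3 p) = e2pi (m1%:~R * p.1.1 + m2%:~R * p.1.2) :> R[i].
Proof. by rewrite /psi /n3 !mat3E. Qed.

Lemma psi_lattice_shift (m1 m2 : int) (d : int * int * int) p :
  psi m1 m2 (n3 (lattice_shift d p)) = psi m1 m2 (n3 p).
Proof.
rewrite !psiE /lattice_shift /heis_shift /aff3 /sgn_shift /= expr0 !mul1r.
rewrite -[RHS](e2pi_periodic _ (m1 * d.1.1 + m2 * d.1.2)); congr e2pi.
by rewrite intrD !intrM; ring.
Qed.

(** If n' is the right unipotent part of [r], then n(p)^-1 (n' n(d))^-1 = (n(d) n(p))^-1 n'^-1, and
    the left factor [h] changes none of the coordinates. *)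
Lemma moved_lattice_shift (r : 'M[int]_3) h (d : int * int * int) p : Gamma_oo h -> big_cell R r ->
  moved (toR R (h *m (r *m nmx d.1.1 d.1.2 d.2))) p = moved (toR R r) (lattice_shift d p).
Proof.
move=> [x [y [z ->]]] br; have [_ a0 b0] := big_cell_toR br.
rewrite !toRM !toR_nmx /moved; move: (toR R r) a0 b0 => g a0 b0.
have [[-> -> _] [-> -> ->]] := pluecker_l (g *m nmx d.1.1%:~R d.1.2%:~R d.2%:~R)
  x%:~R y%:~R z%:~R.
have [[-> -> ->] [-> ->]] := pluecker_r g d.1.1%:~R d.1.2%:~R d.2%:~R.
rewrite /lattice_shift /heis_shift /aff3 /sgn_shift /= expr0 !mul1r.
move: (pA1 g) (pA2 g) (pB1 g) (pB2 g) (pC2 g) a0 b0 => a b c e u a0 b0.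
by congr (_, _, _); field.
Qed.

Lemma movedE (g : 'M[R]_3) p : moved g p = aff3 true true true (- (pB1 g / pA1 g))
  (pB2 g / pA2 g) (fun q => pC2 g / pA2 g + q.1 * q.2 - q.1 * (pB2 g / pA2 g)) p.
Proof.
rewrite /moved /aff3 /sgn_shift expr1.
by congr (_, _, _); ring.
Qed.

Lemma measurable_moved_corr (g : 'M[R]_3) : measurable_fun setT
  (fun q : measurableTypeR R * measurableTypeR R =>
     (pC2 g / pA2 g + q.1 * q.2 - q.1 * (pB2 g / pA2 g) : measurableTypeR R)).
Proof.
apply: measurable_funB; first by apply: measurable_funD => //; exact: measurable_funM.
by apply: measurable_funM.
Qed.

Definition twisted_moment (m1 m2 : int) f k : R[i] :=
  cint setT (fun q => restrN f k q * (psi m1 m2 (n3 q))^-1).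

(** [psi] is a character and [moved g p] is n(p)^-1 n(X, Y, Z), so the value of [psi] at p is its
    value at (X, Y, Z) times its inverse at the moved point. The first is the exponential, the
    second stays in the integral. *)
Lemma cint_moved (m1 m2 : int) f k (g : 'M[R]_3) : cintegrable setT (restrN f k) ->
  cintegrable setT (fun p => psi m1 m2 (n3 p) * restrN f k (moved g p)) /\
  cint setT (fun p => psi m1 m2 (n3 p) * restrN f k (moved g p)) =
  e2pi (m1%:~R * (- (pB1 g / pA1 g)) + m2%:~R * (pB2 g / pA2 g)) *
    twisted_moment m1 m2 f k.
Proof.
move=> If; pose F q := restrN f k q * psi (- m1) (- m2) (n3 q).
have IF : cintegrable setT F by exact: cintegrableM_psi.
have [IG EG] := cint_aff3 true true true (- (pB1 g / pA1 g)) (pB2 g / pA2 g)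
  (measurable_moved_corr g) IF.
set c := e2pi _.
have [IZ EZ] := cintZ c measurableT IG.
have E : (fun p => psi m1 m2 (n3 p) * restrN f k (moved g p)) =
    (fun p => c * (F \o aff3 true true true (- (pB1 g / pA1 g)) (pB2 g / pA2 g)
      (fun q => pC2 g / pA2 g + q.1 * q.2 - q.1 * (pB2 g / pA2 g))) p).
  apply/funext => p; rewrite /= -movedE /F mulrCA [LHS]mulrC; congr (_ * _).
  rewrite !psiE /c -e2piD; congr e2pi; rewrite /moved /= !mulrNz; ring.
rewrite E; split; first exact: IZ.
rewrite EZ EG; congr (_ * _); apply: eq_cint => q _; rewrite /F psiV//.
Qed.

End Periodicity.

(** * Symmetry of the exponential sums under conjugation *)

Section Conjugation.
Context {R : realType}.
Variables (s : 'M[int]_3 -> bool) (hs : miller_splitting R s).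
Implicit Types (g h k : 'M[int]_3) (C D : set 'M[int]_3) (a : int * int).
Local Notation DQ a := (double_quotient Gamma_oo (Sset a.1 a.2)).

Definition flip g : 'M[int]_3 := tmx 1 1 (-1) *m g *m tmx 1 1 (-1).

Lemma flip_mat3 (a b c d e f u v w : int) : flip (mat3 a b c d e f u v w) =
  mat3 a b (- c) d e (- f) (- u) (- v) w.
Proof. by rewrite /flip !mat3_mul; congr mat3; ring. Qed.

Lemma flipK : involutive flip.
Proof. by move=> g; rewrite [g]mat3_eta !flip_mat3 !opprK. Qed.

Lemma flipM g h : flip (g *m h) = flip g *m flip h.
Proof.
rewrite [g]mat3_eta [h]mat3_eta !mat3_mul !flip_mat3 mat3_mul.
by congr mat3; ring.
Qed.

Lemma flip_Gamma_oo h : Gamma_oo h -> Gamma_oo (flip h).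
Proof.
move=> [x [y [z ->]]]; exists x, (- y), (- z).
by rewrite flip_mat3 oppr0.
Qed.

Lemma flip_Gamma g : Gamma g -> Gamma (flip g).
Proof.
move=> /GammaP; rewrite [g]mat3_eta flip_mat3; move: (g i0 i0) (g i0 i1) (g i0 i2) (g i1 i0)
  (g i1 i1) (g i1 i2) (g i2 i0) (g i2 i1) (g i2 i2) => a b c d e f l m n.
rewrite !mat3E => -[dg H1 [h4 h5 h6]]; apply/GammaP; split.
- by rewrite -dg !det_mat3; ring.
- by rewrite !mat3E.
- by rewrite !mat3E !rpredN.
Qed.

Lemma pluecker_flip g : [/\ pA1 (flip g) = - pA1 g, pB1 (flip g) = - pB1 g,
  pA2 (flip g) = - pA2 g & pB2 (flip g) = pB2 g].
Proof.
rewrite [g]mat3_eta flip_mat3 /pA1 /pB1 /pA2 /pB2 !mat3E.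
by split; ring.
Qed.

Lemma flip_Sset (a1 a2 : int) g : Sset a1 a2 g -> Sset (- a1) (- a2) (flip g).
Proof.
move=> [Gg e1 e2]; have [d1 _ d2 _] := pluecker_flip g.
by split; [exact: flip_Gamma|rewrite d1 e1 mulrN|rewrite d2 e2 mulrN].
Qed.

Lemma flip_dcos g : [set flip x | x in dcos g] = dcos (flip g).
Proof.
apply/seteqP; split => [_ [_ [h Hh [k Hk <-]] <-]|_ [h Hh [k Hk <-]]].
  exists (flip h); first exact: flip_Gamma_oo.
  by exists (flip k); [exact: flip_Gamma_oo|rewrite flipM (flipM h)].
exists (flip h *m g *m flip k); last by rewrite flipM (flipM (flip h)) !flipK.
exists (flip h); first exact: flip_Gamma_oo.
by exists (flip k); [exact: flip_Gamma_oo|].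
Qed.

Definition sigma_summand (a1 a2 n1 n2 : int) g : R[i] :=
  (-1) ^+ s g * e2pi (n1%:~R * ((B1 g)%:~R / a1%:~R) + n2%:~R * ((B2 g)%:~R / a2%:~R)).

(** Within a double coset B_1 and B_2 change by multiples of A_1 and A_2, so the exponent changes by
    an integer; the summand is thus independent of the representative chosen by [coset_repr]. *)
Lemma sigma_summand_dcos a (n1 n2 : int) g h k : nonzero_pairs a -> Sset a.1 a.2 g ->
  Gamma_oo h -> Gamma_oo k ->
  sigma_summand a.1 a.2 n1 n2 (h *m g *m k) = sigma_summand a.1 a.2 n1 n2 g.
Proof.
move=> [a1 a2] Sg Hh Hk; have [Gg e1 e2] := Sg.
have [Gg' _ _] := Sset_dcos Hh Hk Sg.
have Gh : Gamma (h *m g) by have [x [y [z ->]]] := Hh; exact: Gamma_nmx_l.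
rewrite /sigma_summand (miller_right hs)// (miller_left hs)//; congr (_ * _).
have [_ b1 _ b2] := Gamma_dvd Gg; have [_ b1' _ b2'] := Gamma_dvd Gg'.
move: b1' b2'; have [x [y [z ->]]] := Hh; have [x' [y' [z' ->]]] := Hk.
have [[_ -> _] [-> _]] := pluecker_r (nmx x y z *m g) x' y' z'.
have [[-> -> _] [-> -> _]] := pluecker_l g x y z.
set g' := _ *m _ *m _; rewrite b1 b2 e1 e2 => b1' b2'.
have -> : B1 g' = B1 g + a.1 * x'.
  by apply: (mulfI (_ : 4 != 0 :> int)) => //; rewrite -b1'; ring.
have -> : B2 g' = B2 g - y' * a.2.
  by apply: (mulfI (_ : 4 != 0 :> int)) => //; rewrite -b2'; ring.
rewrite -[RHS](e2pi_periodic _ (n1 * x' - n2 * y')); congr e2pi.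
have c1 : a.1%:~R != 0 :> R by rewrite intr_eq0.
have c2 : a.2%:~R != 0 :> R by rewrite intr_eq0.
by rewrite !(intrD, intrB, mulrNz, intrM); field; rewrite c1 c2.
Qed.

(** [flip] negates A_1, B_1, A_2 and keeps B_2, so only the second quotient in the exponent changes
    sign. *)
Lemma SigmaN a (n1 n2 : int) : nonzero_pairs a ->
  Sigma R s (- a.1) (- a.2) n1 n2 = Sigma R s a.1 a.2 n1 (- n2).
Proof.
move=> na; have [a1 a2] := na.
rewrite /Sigma (@reindex_fsbig _ _ _ _ _ (fun D => [set flip x | x in D]) (DQ a)); last first.
  have inv D : [set flip x | x in [set flip x | x in D]] = D.
    rewrite image_comp (_ : flip \o flip = id) ?image_id//.
    by apply/funext => x; exact: flipK.
  split.
  - move=> _ [g Sg <-]; rewrite -/(dcos g) flip_dcos.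
    by exists (flip g) => //; exact: flip_Sset.
  - by move=> D D' _ _ E; rewrite -[D]inv E inv.
  - move=> _ [g Sg <-]; exists (dcos (flip g)); last by rewrite flip_dcos flipK.
    by exists (flip g) => //; rewrite -[a.1]opprK -[a.2]opprK; exact: flip_Sset.
apply: eq_fsbigr => D /set_mem DD; have [SD DE] := DQ_repr DD.
set g := coset_repr D in SD DE *; rewrite DE flip_dcos.
have [h Hh [k Hk <-]] : dcos (flip g) (coset_repr (dcos (flip g))).
  by apply: xgetPex; exists (flip g); exact: dcos_mem.
have na' : nonzero_pairs (- a.1, - a.2) by rewrite /nonzero_pairs /= !oppr_eq0.
rewrite -/(sigma_summand _ _ _ _ _) (@sigma_summand_dcos (- a.1, - a.2))//; last first.
  exact: flip_Sset.
rewrite /sigma_summand (miller_conj hs); last exact: Sset_big SD.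
have [Gg _ _] := SD; have [Gf _ _] := flip_Sset SD.
have [_ b1 _ b2] := Gamma_dvd Gg; have [_ b1' _ b2'] := Gamma_dvd Gf.
move: b1' b2'; have [_ -> _ ->] := pluecker_flip g; rewrite b1 b2 => b1' b2'.
have -> : B1 (flip g) = - B1 g.
  by apply: (mulfI (_ : 4 != 0 :> int)) => //; rewrite -b1'; ring.
have -> : B2 (flip g) = B2 g.
  by apply: (mulfI (_ : 4 != 0 :> int)) => //; rewrite -b2'; ring.
congr (_ * e2pi _).
have c1 : a.1%:~R != 0 :> R by rewrite intr_eq0.
have c2 : a.2%:~R != 0 :> R by rewrite intr_eq0.
by rewrite !mulrNz; field; rewrite c1 c2.
Qed.

End Conjugation.

(** * Sums over nonzero pairs, split by sign patterns *)

Section SignSplitting.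
Context {R : realType}.

Definition with_signs (x : (int * int) * (bool * bool)) : int * int :=
  ((-1) ^+ x.2.1 * x.1.1, (-1) ^+ x.2.2 * x.1.2).

Lemma with_signs_bij :
  set_bij (positive_pairs `*`` (fun=> [set: bool * bool])) nonzero_pairs with_signs.
Proof.
have key (b b' : bool) (x y : int) : 0 < x -> 0 < y -> (-1) ^+ b * x = (-1) ^+ b' * y ->
  b = b' /\ x = y.
  by case: b; case: b'; rewrite ?expr0 ?expr1 ?mul1r ?mulN1r => x0 y0 E; split => //;
    first [lra|exfalso; lra].
split.
- move=> [[a1 a2] [b1 b2]] [/= [/= p1 p2] _].
  by split; rewrite /= mulf_neq0 ?signr_eq0 ?gt_eqF.
- move=> [[a1 a2] [b1 b2]] [[c1 c2] [d1 d2]] /set_mem[[/= p1 p2] _].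
  move=> /set_mem[[/= q1 q2] _] [/(key _ _ _ _ p1 q1)[-> ->]].
  by move=> /(key _ _ _ _ p2 q2)[-> ->].
- move=> [a1 a2] [/= n1 n2]; exists ((`|a1|, `|a2|), (a1 < 0, a2 < 0)).
    by split => //; split; rewrite /= normr_gt0.
  by rewrite /with_signs /= -!numEsign.
Qed.

(** [T2] lists the patterns with negative first entry in the order in which the conjugation matches
    them with the two terms of [T1]. *)
Lemma csum_signs (T : int * int -> R[i]) : csummable nonzero_pairs T ->
  let T1 a := T a + T (a.1, - a.2) in
  let T2 a := T (- a.1, - a.2) + T (- a.1, a.2) in
  [/\ csummable positive_pairs T1, csummable positive_pairs T2 &
    csum nonzero_pairs T = csum positive_pairs T1 + csum positive_pairs T2].
Proof.
move=> ST T1 T2.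
have bb : [set: bool * bool] =
    [set` [:: (false, false); (false, true); (true, true); (true, false)]].
  by apply/seteqP; split => // -[[] []].
have S4 (V : nmodType) (F : bool * bool -> V) : \sum_(b \in [set: bool * bool]) F b =
    F (false, false) + F (false, true) + (F (true, true) + F (true, false)).
  rewrite bb -fsbig_seq// !big_cons big_nil /=. by rewrite addr0 !addrA.
have fb : finite_set [set: bool * bool] by rewrite bb; exact: finite_seq.
have S := (csummable_reindex T with_signs_bij).1 ST.
have [_ S12 E12] := csum_fubini (F := fun a b => T (with_signs (a, b)))
  (eq_csummable (fun k _ => congr1 (fun u => T (with_signs u)) (surjective_pairing k)) S).
have /csummable_nrm Sn := S.
have [Sn12 _] := rsum_fubini (f := fun a b => nrm (T (with_signs (a, b))))
  (eq_rsummable (fun k _ => congr1 (fun u => nrm (T (with_signs u))) (surjective_pairing k)) Sn).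
have sg a : [/\ with_signs (a, (false, false)) = a,
   with_signs (a, (false, true)) = (a.1, - a.2),
   with_signs (a, (true, true)) = (- a.1, - a.2) &
   with_signs (a, (true, false)) = (- a.1, a.2)].
  by rewrite /with_signs /= !mul1r !mulN1r -surjective_pairing.
(* The four norms are an inner sum of the absolutely convergent double sum, which dominates [T1] and
   [T2] at once. *)
have Sle (F : int * int -> R[i]) : (forall a, nrm (F a) <= nrm (T a) + nrm (T (a.1, - a.2))
    + (nrm (T (- a.1, - a.2)) + nrm (T (- a.1, a.2)))) -> csummable positive_pairs F.
  move=> Fle; apply: (csummable_le _ Sn12) => a _; apply: (le_trans (Fle a)).
  rewrite (rsum_fset _ fb).2 S4; have [-> -> -> ->] := sg a; exact: lexx.
have s1 : csummable positive_pairs T1.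
  by apply: Sle => a; rewrite (le_trans (ler_nrmD _ _))// lerDl addr_ge0 ?nrm_ge0.
have s2 : csummable positive_pairs T2.
  by apply: Sle => a; rewrite (le_trans (ler_nrmD _ _))// lerDr addr_ge0 ?nrm_ge0.
split => //; rewrite (csum_reindex T with_signs_bij) -csumD//.
transitivity (csum positive_pairs (fun a => csum setT (fun b => T (with_signs (a, b))))).
  by rewrite E12; apply: eq_csum => k _; rewrite /= -surjective_pairing.
apply: eq_csum => a _; rewrite (csum_fset _ fb).2 S4.
by have [-> -> -> ->] := sg a.
Qed.

End SignSplitting.

Section Unfolding.
Context {R : realType}.
Variables (s : 'M[int]_3 -> bool) (hs : miller_splitting R s).
Variables (lam : 'rV[R[i]]_3) (f : section R).
Hypotheses (sf : smooth_section f) (ef : equivariant (- lam) (contragredient (@phi R)) f).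
Hypotheses (l1 : 5 < complex.Re (lam 0 i0 - lam 0 i1))
           (l2 : 5 < complex.Re (lam 0 i1 - lam 0 i2)).
Variables (m1 m2 : int).
Local Notation LQ := (left_quotient Gamma_oo (big_cell R)).
Local Notation DQ a := (double_quotient Gamma_oo (Sset a.1 a.2)).

Lemma twisted_value p : unit_cube R p ->
  pairing f (twisted_translate m1 m2 (eisenstein s) (n3 p)) =
  csum LQ (fun C => psi m1 m2 (n3 p) * big_cell_term s lam f (coset_repr C) p).
Proof.
move=> Cp; rewrite csumZ; last exact: csummable_big_cell_term.
congr (_ * _); apply: eq_csum => C /set_mem LC.
have [bC _] := LQ_repr LC; rewrite -(big_cell_term_value s p ef bC).
rewrite /pairing /eisenstein_term /act_dist /pairing /tau /act.
rewrite !tinv_nmx; set u := tmul (tinv _) _.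
(* Three nested inversions, from [twisted_translate], [act_dist] and [act], amount to one. *)
by have -> : nmx (- - - p.1.1) (- - - p.1.2) (- - p.1.1 * - - p.1.2 -
    (- p.1.1 * - p.1.2 - (p.1.1 * p.1.2 - p.2))) =
  nmx (- p.1.1) (- p.1.2) (p.1.1 * p.1.2 - p.2) by congr nmx; ring.
Qed.

Lemma eq_cintegrable (E : set (R * R * R)) (F G : R * R * R -> R[i]) :
  measurable (E : set (measurableTypeR R * measurableTypeR R * measurableTypeR R)) ->
  {in E, F =1 G} -> cintegrable E F -> cintegrable E G.
Proof.
move=> mE FG [I1 I2].
by split; [apply: eq_integrable I1|apply: eq_integrable I2] => // p Ep /=; rewrite FG.
Qed.

Definition orbit_coef (a : int * int) : R[i] :=
  weight2 lam `|4 * a.1%:~R| `|4 * a.2%:~R| * sign_factor (0 < a.1) (0 < a.2) *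
  twisted_moment m1 m2 f (sign_component (0 < a.1)).

(** By periodicity [psi] too may be taken at the shifted point. The terms of one double coset thus
    become the lattice translates of a single function, as the tiling requires. *)
Lemma big_cell_term_glue a (D : set 'M[int]_3) (d : int * int * int) p : nonzero_pairs a -> DQ a D ->
  let r := coset_repr D in
  psi m1 m2 (n3 p) * big_cell_term s lam f (coset_repr (glue ((a, D), d))) p =
  (-1) ^+ s r * (weight2 lam `|4 * a.1%:~R| `|4 * a.2%:~R| * sign_factor (0 < a.1) (0 < a.2)) *
  (psi m1 m2 (n3 (lattice_shift d p)) * restrN f (sign_component (0 < a.1)) (moved (toR R r) (lattice_shift d p))).
Proof.
move=> [a1 a2] DD r; have [SD _] := DQ_repr DD; rewrite -/r in SD.
have br := Sset_big (R := R) a1 a2 SD; have [Gr e1 e2] := SD.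
rewrite /glue /= -/r; set g := r *m _.
have [h Hh <-] : lcos g (coset_repr (lcos g)).
  by apply: xgetPex; exists g; exact: lcos_mem.
rewrite psi_lattice_shift /big_cell_term moved_lattice_shift//.
have Gg : Gamma g by exact: Gamma_nmx_r.
rewrite (miller_left hs)// (miller_right hs)//; last exact: Gamma_oo_nmx.
have [[-> _ _] [-> _ _]] := @pluecker_toR R (h *m g).
have [x [y [z ->]]] := Hh.
have [[-> _ _] [-> _ _]] := pluecker_l g x y z.
have [[-> _ ->] _] := pluecker_r r d.1.1 d.1.2 d.2.
have P (x0 : int) : (4 * x0)%:~R = 4 * x0%:~R :> R by rewrite intrM.
have Q (x0 : int) : (0 < 4 * x0%:~R :> R) = (0 < x0) by rewrite pmulr_rgt0 ?ltr0n// ltr0z.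
rewrite e1 e2 !P !Q; move: (restrN _ _ _) (weight2 _ _ _) (sign_factor _ _) (psi _ _ _) (_ ^+ _).
by move=> *; ring.
Qed.

(** The frequency [- m1] reflects that the first coordinate of the point (X, Y, Z) is - B_1 /
    A_1. *)
Lemma csum_glue a (D : set 'M[int]_3) : nonzero_pairs a -> DQ a D ->
  csum [set: int * int * int] (fun d => cint (unit_cube R) (fun p =>
    psi m1 m2 (n3 p) * big_cell_term s lam f (coset_repr (glue ((a, D), d))) p)) =
  orbit_coef a * sigma_summand s a.1 a.2 (- m1) m2 (coset_repr D).
Proof.
move=> na DD; have [SD _] := DQ_repr DD; have [a1 a2] := na; set r := coset_repr D in SD *.
pose k := sign_component (0 < a.1).
pose c : R[i] := (-1) ^+ s r *
  (weight2 lam `|4 * a.1%:~R| `|4 * a.2%:~R| * sign_factor (0 < a.1) (0 < a.2)).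
pose G p := psi m1 m2 (n3 p) * restrN f k (moved (toR R r) p).
have [IG EG] := cint_moved m1 m2 (toR R r) (cintegrable_restrN k sf ef l1 l2).
have [IZ EZ] := cintZ c measurableT IG.
have [_ T] := csum_tiling IZ.
transitivity (csum [set: int * int * int]
    (fun m => cint (unit_cube R) ((fun p => c * G p) \o lattice_shift m))).
  apply: eq_csum => d _; apply: eq_cint => p _.
  by rewrite (big_cell_term_glue d p na DD).
rewrite T EZ EG /sigma_summand /orbit_coef /c -/k.
have [[-> -> _] [-> -> _]] := @pluecker_toR R r.
have [Gr e1 e2] := SD; have [_ -> _ ->] := Gamma_dvd Gr; rewrite e1 e2.
have c1 : a.1%:~R != 0 :> R by rewrite intr_eq0.
have c2 : a.2%:~R != 0 :> R by rewrite intr_eq0.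
have P (x : int) : (4 * x)%:~R = 4 * x%:~R :> R by rewrite intrM.
set u := e2pi _; set v := e2pi _.
have -> : u = v.
  rewrite /u /v; congr e2pi; rewrite !mulrNz !P; move: a.1%:~R a.2%:~R c1 c2 => x y c1 c2.
  by field; rewrite c1 c2.
move: (twisted_moment _ _ _ _) (weight2 _ _ _) (sign_factor _ _) v (_ ^+ _).
by move=> *; ring.
Qed.

Lemma twisted_bound : exists (b : set 'M[int]_3 -> R), rsummable LQ b /\
  forall C p, LQ C -> unit_cube R p ->
    nrm (psi m1 m2 (n3 p) * big_cell_term s lam f (coset_repr C) p) <= b C.
Proof.
have [M HM] := seminorm_ex sf.
exists (fun C => eisenstein_cst lam * M * lorentz5 (pluecker5 (coset_repr C))).
split; first exact: rsummableZ rsummable_pluecker5.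
move=> C p LC Cp; rewrite nrmM nrm_psi mul1r.
by apply: big_cell_term_le => //; exact: (LQ_repr LC).1.
Qed.

Lemma cmeasurable_twisted r : cmeasurable (fun p => psi m1 m2 (n3 p) * big_cell_term s lam f r p).
Proof.
apply: cmeasurableM; first exact: cmeasurable_psi.
apply: cmeasurableM; first exact: cmeasurable_cst.
apply: cmeasurableM; first exact: cmeasurable_cst.
set k := sign_component _.
have := cmeasurable_comp (measurable_aff3 true true true (- (pB1 (toR R r) / pA1 (toR R r)))
  (pB2 (toR R r) / pA2 (toR R r)) (measurable_moved_corr (toR R r))) (cmeasurable_restrN k sf).
congr cmeasurable; apply/funext => p; rewrite /= -movedE//.
Qed.

Lemma unfolding :
  [/\ cintegrable (unit_cube R)
        (fun p => pairing f (twisted_translate m1 m2 (eisenstein s) (n3 p))),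
      csummable nonzero_pairs (fun a => orbit_coef a * Sigma R s a.1 a.2 (- m1) m2) &
      pairing f (fourier_coefficient m1 m2 (eisenstein s)) =
      csum nonzero_pairs (fun a => orbit_coef a * Sigma R s a.1 a.2 (- m1) m2)].
Proof.
have [b [sb bP]] := twisted_bound.
pose F C p := psi m1 m2 (n3 p) * big_cell_term s lam f (coset_repr C) p.
pose H C := cint (unit_cube R) (F C).
have mF C : LQ C -> cmeasurable (F C) by move=> _; exact: cmeasurable_twisted.
have [I E] := csum_exchange countable_LQ sb mF bP.
have tv : {in unit_cube R, (fun p => csum LQ (F^~ p)) =1
    (fun p => pairing f (twisted_translate m1 m2 (eisenstein s) (n3 p)))}.
  by move=> p /set_mem Cp; rewrite twisted_value.
have -> : pairing f (fourier_coefficient m1 m2 (eisenstein s)) = csum LQ H.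
  by rewrite -E; apply: eq_cint => p /tv.
have SH : csummable LQ H.
  apply: (csummable_le _ (rsummableZ 2 sb)) => C LC.
  by have [_] := cintegrable_cube (mF C LC) (bP C ^~ LC).
(* Absolute summability over left cosets is transported to the triples (pair, double coset,
   translation), so that both regroupings below are instances of Fubini. *)
have SG := (csummable_reindex H glue_bij).1 SH.
have [_ S1 E1] := csum_fubini (F := fun i d => H (glue (i, d))) SG.
have inner : {in nonzero_pairs `*`` (fun a => DQ a),
    (fun i => csum [set: int * int * int] (fun d => H (glue (i, d)))) =1
    (fun i => orbit_coef i.1 * sigma_summand s i.1.1 i.1.2 (- m1) m2 (coset_repr i.2))}.
  by move=> [a D] /set_mem[na DD]; exact: csum_glue.
have S2 := eq_csummable inner S1.
have [_ S3 E3] := csum_fubini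
  (F := fun a D => orbit_coef a * sigma_summand s a.1 a.2 (- m1) m2 (coset_repr D)) S2.
have outer : {in nonzero_pairs, (fun a => csum (DQ a)
      (fun D => orbit_coef a * sigma_summand s a.1 a.2 (- m1) m2 (coset_repr D))) =1
    (fun a => orbit_coef a * Sigma R s a.1 a.2 (- m1) m2)}.
  (* Finiteness of the set of double cosets identifies the unordered sum with the finitely supported
     one in [Sigma]. *)
  move=> a /set_mem na.
  have [sa ea] := csum_fset (fun D => sigma_summand s a.1 a.2 (- m1) m2 (coset_repr D) : R[i])
    (@finite_DQ R a na).
  by rewrite csumZ// ea.
split.
- exact: eq_cintegrable (@measurable_unit_cube R) tv I.
- exact: eq_csummable outer S3.
- by rewrite (csum_reindex H glue_bij) -(eq_csum outer) E3 -(eq_csum inner) E1.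
Qed.

End Unfolding.

Lemma cintegrable_jacquet (R : realType) (lam : 'rV[R[i]]_3) (f : section R) (m1 m2 : int) k :
  Vsmooth (- lam) (contragredient (@phi R)) f ->
  5 < complex.Re (lam 0 i0 - lam 0 i1) -> 5 < complex.Re (lam 0 i1 - lam 0 i2) ->
  cintegrable setT (jacquet_integrand m1 m2 f k) /\
  cint setT (jacquet_integrand m1 m2 f k) =
    (if k == 0 then twisted_moment m1 m2 f 1 else - twisted_moment m1 m2 f 0).
Proof.
move=> [sf ef] l1 l2.
have I j : cintegrable setT (fun p => restrN f j p * (psi m1 m2 (n3 p))^-1).
  have := cintegrableM_psi (- m1) (- m2) (cintegrable_restrN j sf ef l1 l2).
  by congr cintegrable; apply/funext => p; rewrite psiV.
have [->|] := eqVneq k 0.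
  have E : jacquet_integrand m1 m2 f 0 = (fun p => restrN f 1 p * (psi m1 m2 (n3 p))^-1).
    by apply/funext => p; have [] := jacquet_value m1 m2 p ef.
  by rewrite E; split; first exact: I.
case: k => [[|[|k]] hk] //= _.
rewrite (_ : Ordinal hk = 1); last exact: val_inj.
have [IZ EZ] := cintZ (-1) measurableT (I 0).
have E : jacquet_integrand m1 m2 f 1 = (fun p => -1 * (restrN f 0 p * (psi m1 m2 (n3 p))^-1)).
  by apply/funext => p; have [_ ->] := jacquet_value m1 m2 p ef; rewrite mulN1r.
by rewrite E; split; [exact: IZ|rewrite EZ mulN1r].
Qed.

Theorem proposition44 (R : realType) (s : 'M[int]_3 -> bool)
    (hs : miller_splitting R s) :
  exists c : R,
  forall (lam : 'rV[R[i]]_3),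
  \sum_(k < 3) lam 0 k = 0 ->
  c < complex.Re (lam 0 i0 - lam 0 i1) -> c < complex.Re (lam 0 i1 - lam 0 i2) ->
  Vdist lam (eisenstein s) /\
  forall (m1 m2 : int) (f : section R),
  Vsmooth (- lam) (contragredient (@phi R)) f ->
  let weight (a : int * int) : R[i] :=
    cpow `|4 * a.1%:~R| (-1 - lam 0 i0 + lam 0 i1) *
    cpow `|4 * a.2%:~R| (-1 - lam 0 i1 + lam 0 i2) in
  let term1 (a : int * int) : R[i] :=
    weight a * (Sigma R s a.1 a.2 (- m1) m2 +
                'i%C * Sigma R s a.1 (- a.2) (- m1) m2) *
    cint setT (jacquet_integrand m1 m2 f 0) in
  let term2 (a : int * int) : R[i] :=
    weight a * (- Sigma R s a.1 a.2 (- m1) (- m2) -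
                'i%C * Sigma R s a.1 (- a.2) (- m1) (- m2)) *
    cint setT (jacquet_integrand m1 m2 f 1) in
  [/\ csummable (left_quotient Gamma_oo (big_cell R))
        (fun C => pairing f (eisenstein_term s C)),
      cintegrable (unit_cube R)
        (fun p => pairing f (twisted_translate m1 m2 (eisenstein s) (n3 p))),
      (forall k : 'I_2, cintegrable setT (jacquet_integrand m1 m2 f k)),
      csummable positive_pairs term1 /\ csummable positive_pairs term2 &
      pairing f (fourier_coefficient m1 m2 (eisenstein s)) =
      csum positive_pairs term1 + csum positive_pairs term2].
Proof.
(* The largest exponent asked of [powR_decay] is 6, which needs 6 <= 1 + s. *)
exists 5 => lam _ l1 l2; split; first exact: Vdist_eisenstein.
move=> m1 m2 f Vf weight term1 term2; have [sf ef] := Vf.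
have J k := cintegrable_jacquet m1 m2 k Vf l1 l2.
have [I ST ->] := unfolding hs sf ef l1 l2 m1 m2.
have [S1 S2 ->] := csum_signs ST.
have nz a : positive_pairs a -> nonzero_pairs a /\ nonzero_pairs (a.1, - a.2).
  by move=> [p1 p2]; rewrite /nonzero_pairs /= oppr_eq0 !gt_eqF.
have E1 : {in positive_pairs, (fun a => orbit_coef lam f m1 m2 a * Sigma R s a.1 a.2 (- m1) m2 +
    orbit_coef lam f m1 m2 (a.1, - a.2) * Sigma R s a.1 (- a.2) (- m1) m2) =1 term1}.
  move=> a /set_mem[p1 p2]; rewrite /term1 (J 0).2 eqxx /orbit_coef /=.
  rewrite p1 p2 oppr_gt0 (lt_gtF p2) mulrNz mulrN normrN /sign_factor /= -/(weight a).
  rewrite /weight2 -/(weight a); ring.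
(* Negative A_1 selects the first component on N, whose moment is minus the Jacquet integral of f_2;
   this is the origin of the minus signs in [term2]. *)
have E2 : {in positive_pairs, (fun a =>
    orbit_coef lam f m1 m2 (- a.1, - a.2) * Sigma R s (- a.1) (- a.2) (- m1) m2 +
    orbit_coef lam f m1 m2 (- a.1, a.2) * Sigma R s (- a.1) a.2 (- m1) m2) =1 term2}.
  move=> a /set_mem pa; have [na na'] := nz _ pa; have [p1 p2] := pa.
  have := SigmaN hs (- m1) m2 na'; rewrite /= opprK => ->.
  rewrite (SigmaN hs (- m1) m2 na) /term2 (J 1).2 /= /orbit_coef /=.
  rewrite p2 !oppr_gt0 (lt_gtF p1) (lt_gtF p2) !mulrNz !mulrN !normrN /sign_factor /=.
  rewrite /weight2 -/(weight a); ring.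
split => //.
- exact: csummable_eisenstein Vf l1 l2.
- by move=> k; exact: (J k).1.
- by split; [exact: eq_csummable E1 S1|exact: eq_csummable E2 S2].
- by rewrite (eq_csum E1) (eq_csum E2).
Qed.
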